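(* Let $\mathcal C,\mathcal D,\mathcal E$ be finite tensor categories over a field $\Bbbk$. (i) Let $\mathcal M$ be a $(\mathcal C,\mathcal D)$-bimodule category and $\mathcal N$ a $(\mathcal D,\mathcal C)$-bimodule category. Switching the arguments of a bilinear functor induces, for every linear category $\mathcal A$, an equivalence $$\widetilde\varphi_{\mathcal M,\mathcal N}:\mathrm{Fun}^{\mathrm{bal,r.e.}}(\mathcal M\times\mathcal N,\mathcal A)\to\mathrm{Fun}^{\mathrm{bal,r.e.}}(\mathcal N\times\mathcal M,\mathcal A)$$ of categories of right exact multi-balanced functors, and $\widetilde\varphi_{\mathcal N,\mathcal M}\circ\widetilde\varphi_{\mathcal M,\mathcal N}=\mathrm{id}$. (ii) The equivalence from (i) induces an equivalence $$\varphi_{\mathcal M,\mathcal N}:\mathrm{Tr}_{\mathcal C}(\mathcal M\boxtimes_{\mathcal D}\mathcal N)\to\mathrm{Tr}_{\mathcal D}(\mathcal N\boxtimes_{\mathcal C}\mathcal M),$$ unique up to unique natural isomorphism, together with a natural isomorphism $\varphi_{\mathcal N,\mathcal M}\circ\varphi_{\mathcal M,\mathcal N}\simeq\mathrm{id}$. (iii) For a $(\mathcal D,\mathcal C)$-bimodule category $\mathcal M$, a $(\mathcal C,\mathcal E)$-bimodule category $\mathcal N$ and an $(\mathcal E,\mathcal D)$-bimodule category $\mathcal K$, the argument-permuting equivalences satisfy $$\widetilde\varphi_{\mathcal K\times\mathcal M,\mathcal N}\circ\widetilde\varphi_{\mathcal M\times\mathcal N,\mathcal K}=\widetilde\varphi_{\mathcal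 M,\mathcal N\times\mathcal K}:\ \mathrm{Fun}^{\mathrm{bal,r.e.}}(\mathcal M\times\mathcal N\times\mathcal K,\mathcal A)\to\mathrm{Fun}^{\mathrm{bal,r.e.}}(\mathcal N\times\mathcal K\times\mathcal M,\mathcal A).$$ This induces a natural isomorphism of functors (omitting the associator of relative tensor products) $$m_{\mathcal M,\mathcal N,\mathcal K}:\ \varphi_{\mathcal K\boxtimes_{\mathcal D}\mathcal M,\,\mathcal N}\circ\varphi_{\mathcal M\boxtimes_{\mathcal C}\mathcal N,\,\mathcal K}\to\varphi_{\mathcal M,\,\mathcal N\boxtimes_{\mathcal E}\mathcal K}.$$ (iv) For a $(\mathcal C,\mathcal C)$-bimodule category $\mathcal M$, the composite $$\mathrm{Fun}^{\mathrm{bal,r.e.}}(\mathcal M,\mathcal A)\xrightarrow{\phi_1}\mathrm{Fun}^{\mathrm{bal,r.e.}}(\mathcal C\times\mathcal M,\mathcal A)\xrightarrow{\widetilde\varphi_{\mathcal C,\mathcal M}}\mathrm{Fun}^{\mathrm{bal,r.e.}}(\mathcal M\times\mathcal C,\mathcal A)\xrightarrow{\phi_2}\mathrm{Fun}^{\mathrm{bal,r.e.}}(\mathcal M,\mathcal A)$$ of equivalences is canonically naturally isomorphic to the identity, where $\phi_1(\mathsf F)(c\times m)=\mathsf F(c\triangleright m)$ and $\phi_2(\mathsf G)(m)=\mathsf G(m\times 1_{\mathcal C})$. This defines a natural isomorphism $\kappa_{\mathcal M}:\varphi_{\mathcal C,\mathcal M}\to\mathrm{id}$ (with $\mathrm{Tr}_{\mathcal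 C}(\mathcal C\boxtimes_{\mathcal C}\mathcal M)$ and $\mathrm{Tr}_{\mathcal C}(\mathcal M\boxtimes_{\mathcal C}\mathcal C)$ identified with $\mathrm{Tr}_{\mathcal C}(\mathcal M)$ via the unit equivalences).
   Context: Conventions. $\Bbbk$ is a fixed field; all categories are finite $\Bbbk$-linear abelian (finite-dimensional morphism spaces, all objects of finite length, every object has a projective cover, finitely many isomorphism classes of simple objects), called ''linear categories''; functors and natural transformations are linear (multilinear on products). A finite tensor category is such a category with a linear monoidal structure, simple unit, and left and right duals. (Bi)module categories have actions $\triangleright,\triangleleft$ exact in each argument with the usual coherence isomorphisms. Balanced functors on one bimodule category. For a $(\mathcal C,\mathcal C)$-bimodule category $\mathcal M$, $\mathsf F:\mathcal M\to\mathcal A$ is balanced if equipped with natural isomorphisms $\beta_{x,c}:\mathsf F(x\triangleleft c)\to\mathsf F(c\triangleright x)$ such that, up to bimodule constraints, $\beta_{x,c\otimes d}=\beta_{d\triangleright x,c}\circ\beta_{x\triangleleft c,d}$ and $\beta_{x,1}$ is compatible with the unit constraints. Multi-balanced functors. For a $(\mathcal C,\mathcal D)$-bimodule category $\mathcal M$ and a $(\mathcal D,\mathcal C)$-bimodule category $\mathcal N$, a bilinear functor $\mathsf F:\mathcal M\times\mathcal N\to\mathcal A$ is multi-balanced if equipped with natural isomorphisms $\beta_{c,m\times n}:\mathsf F(c\triangleright m\times n)\to\mathsf F(m\times n\triangleleft c)$ ($c\in\mathcal C$) and $\gamma_{d,m\times n}:\mathsf F(m\triangleleft d\times n)\to\mathsf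 F(m\times d\triangleright n)$ ($d\in\mathcal D$), each satisfying its pentagon and triangle identities, and compatible: $\beta_{c,m\times d\triangleright n}\circ\gamma_{d,c\triangleright m\times n}=\gamma_{d,m\times n\triangleleft c}\circ\beta_{c,m\triangleleft d\times n}$ (up to bimodule constraints). Multi-balanced natural transformations are those compatible with all balancings. Analogously one defines multi-balanced functors on any cyclically composable string of bimodule categories (consecutive tensor categories agree, and the two outermost tensor categories agree), with a balancing for each intermediate tensor category and for the outermost one, pairwise compatible. $\mathrm{Fun}^{\mathrm{bal,r.e.}}$ denotes the category of (multi-)balanced functors that are right exact in each argument. Relative tensor product. $\mathcal M\boxtimes_{\mathcal D}\mathcal N$ is the linear category equipped with a universal $\mathcal D$-balanced functor (natural isomorphisms $\mathsf F(m\triangleleft d\times n)\cong\mathsf F(m\times d\triangleright n)$ with pentagon and triangle) with respect to functors right exact in each argument, with specified adjoint equivalences; it inherits a bimodule structure from the outer actions. Category-valued trace. For a $(\mathcal C,\mathcal C)$-bimodule category $\mathcal X$, $\mathrm{Tr}_{\mathcal C}(\mathcal X)$ is a linear category with a balanced functor $\mathsf B_{\mathcal X}:\mathcal X\to\mathrm{Tr}_{\mathcal C}(\mathcal X)$ such that for every linear category $\mathcal A$ composition with $\mathsf B_{\mathcal X}$ is an equivalence from right exact functors $\mathrm{Tr}_{\mathcal C}(\mathcal X)\to\mathcal A$ to right exact balanced functors $\mathcal X\to\mathcal A$ (with a specified quasi-inverse forming an adjoint equivalence). By the universal properties, right exact functors $\mathrm{Tr}_{\mathcal C}(\mathcal M\boxtimes_{\mathcal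 D}\mathcal N)\to\mathcal A$ correspond to right exact multi-balanced functors $\mathcal M\times\mathcal N\to\mathcal A$; ''induced'' in (ii)–(iv) means induced via this correspondence. *)

(* Defs.v *)
From mathcomp Require Import all_boot all_algebra.
From Stdlib Require Import FunctionalExtensionality ProofIrrelevance.

Set Implicit Arguments.
Unset Strict Implicit.
Unset Printing Implicit Defensive.

Import GRing.Theory.
Local Open Scope ring_scope.

(* The balancing of a multi-balanced functor on M x N is written            *)
(*   [b2o] : F(c ▷ m, n) -> F(m, n ◁ c)   and   [b2i] : F(m ◁ d, n) -> F(m, d ▷ n), *)
(* an isomorphism is a morphism [fwd] together with its inverse [bwd], and  *)
(* relative tensor products, traces, associators and unit equivalences are  *)
(* structures characterized by their universal properties, so that all      *)
(* statements apply to any choice of them.                                  *)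

Declare Scope tcat_scope.
Delimit Scope tcat_scope with T.
Local Open Scope tcat_scope.

Record cat := Cat {
  ob :> Type;
  hom : ob -> ob -> Type;
  idm : forall x, hom x x;
  comp : forall x y z, hom y z -> hom x y -> hom x z;
  compA : forall w x y z (h : hom y z) (g : hom x y) (f : hom w x),
    comp h (comp g f) = comp (comp h g) f;
  comp1m : forall x y (f : hom x y), comp (idm y) f = f;
  compm1 : forall x y (f : hom x y), comp f (idm x) = f
}.
Arguments hom {c} x y : simpl never.
Arguments idm {c} x : simpl never.
Arguments comp {c x y z} g f : simpl never.
Arguments compA {c w x y z} h g f.
Arguments comp1m {c x y} f.
Arguments compm1 {c x y} f.

Notation "g ∘ f" := (comp g f) (at level 40, left associativity) : tcat_scope.

Set Primitive Projections.

Record iso (X : cat) (x y : X) := Iso {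
  fwd : hom x y;
  bwd : hom y x;
  bwdK : fwd ∘ bwd = idm y;
  fwdK : bwd ∘ fwd = idm x
}.
Arguments iso {X} x y.
Arguments Iso {X x y} fwd bwd bwdK fwdK.

Definition iid (X : cat) (x : X) : iso x x :=
  Iso (idm x) (idm x) (comp1m _) (comp1m _).

Definition iinv (X : cat) (x y : X) (i : iso x y) : iso y x :=
  Iso (bwd i) (fwd i) (fwdK i) (bwdK i).

Lemma icomp_subproof (X : cat) (x y z : X) (a : hom y z) (a' : hom z y)
    (b : hom x y) (b' : hom y x) :
  a ∘ a' = idm z -> b ∘ b' = idm y -> (a ∘ b) ∘ (b' ∘ a') = idm z.
Proof. by move=> ea eb; rewrite compA -(compA a) eb compm1. Qed.

Definition icomp (X : cat) (x y z : X) (j : iso y z) (i : iso x y) : iso x z :=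
  Iso (fwd j ∘ fwd i) (bwd i ∘ bwd j)
    (icomp_subproof (bwdK j) (bwdK i)) (icomp_subproof (fwdK i) (fwdK j)).

Definition mono (X : cat) (x y : X) (f : hom x y) : Prop :=
  forall w (g h : hom w x), f ∘ g = f ∘ h -> g = h.

Definition epi (X : cat) (x y : X) (f : hom x y) : Prop :=
  forall z (g h : hom y z), g ∘ f = h ∘ f -> g = h.

Definition is_iso (X : cat) (x y : X) (f : hom x y) : Prop :=
  exists i : iso x y, fwd i = f.

Record functor (X Y : cat) := Functor {
  fob :> X -> Y;
  fmap : forall x y, hom x y -> hom (fob x) (fob y);
  fmap1 : forall x, fmap (idm x) = idm (fob x);
  fmapM : forall x y z (g : hom y z) (f : hom x y), fmap (g ∘ f) = fmap g ∘ fmap f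
}.
Arguments fmap {X Y} f0 {x y} f.
Arguments fmap1 {X Y} f0 x.
Arguments fmapM {X Y} f0 {x y z} g f.

Definition fid (X : cat) : functor X X :=
  @Functor X X (fun x => x) (fun _ _ f => f) (fun _ => erefl) (fun _ _ _ _ _ => erefl).

Lemma fcomp_map1 (X Y Z : cat) (G : functor Y Z) (F : functor X Y) x :
  fmap G (fmap F (idm x)) = idm (G (F x)).
Proof. by rewrite !fmap1. Qed.

Lemma fcomp_mapM (X Y Z : cat) (G : functor Y Z) (F : functor X Y) x y z
    (g : hom y z) (f : hom x y) :
  fmap G (fmap F (g ∘ f)) = fmap G (fmap F g) ∘ fmap G (fmap F f).
Proof. by rewrite !fmapM. Qed.

Definition fcomp (X Y Z : cat) (G : functor Y Z) (F : functor X Y) : functor X Z :=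
  @Functor X Z (fun x => G (F x)) (fun _ _ f => fmap G (fmap F f))
    (fcomp_map1 G F) (fun x y z => @fcomp_mapM X Y Z G F x y z).

Notation "G ∘F F" := (fcomp G F) (at level 40, left associativity) : tcat_scope.

Lemma imap_subproof (X Y : cat) (F : functor X Y) (x y : X) (f : hom x y) (g : hom y x) :
  f ∘ g = idm y -> fmap F f ∘ fmap F g = idm (F y).
Proof. by move=> e; rewrite -fmapM e fmap1. Qed.

Definition imap (X Y : cat) (F : functor X Y) (x y : X) (i : iso x y) : iso (F x) (F y) :=
  Iso (fmap F (fwd i)) (fmap F (bwd i))
    (imap_subproof F (bwdK i)) (imap_subproof F (fwdK i)).

Unset Primitive Projections.

Record nat_trans (X Y : cat) (F G : functor X Y) := NatTrans {
  nt :> forall x, hom (F x) (G x);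
  nt_nat : forall x y (f : hom x y), nt y ∘ fmap F f = fmap G f ∘ nt x
}.

Lemma nt_ext (X Y : cat) (F G : functor X Y) (a b : nat_trans F G) :
  (forall x, a x = b x) -> a = b.
Proof.
case: a b => [a Ha] [b Hb] /= e.
have {}e : a = b by apply: functional_extensionality_dep.
by case: _ / e in Hb *; congr NatTrans; apply: proof_irrelevance.
Qed.

Definition nt_id (X Y : cat) (F : functor X Y) : nat_trans F F.
Proof.
by exists (fun x => idm (F x)) => x y f; rewrite comp1m compm1.
Defined.

Definition nt_comp (X Y : cat) (F G H : functor X Y)
  (b : nat_trans G H) (a : nat_trans F G) : nat_trans F H.
Proof.
exists (fun x => b x ∘ a x) => x y f.
by rewrite -compA nt_nat compA nt_nat compA.
Defined.

Definition Funct (X Y : cat) : cat.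
Proof.
refine (@Cat (functor X Y) (@nat_trans X Y) (@nt_id X Y) (@nt_comp X Y) _ _ _).
- by move=> *; apply: nt_ext => x /=; rewrite compA.
- by move=> *; apply: nt_ext => x /=; rewrite comp1m.
- by move=> *; apply: nt_ext => x /=; rewrite compm1.
Defined.

Definition is_equiv (X Y : cat) (F : functor X Y) : Prop :=
  exists G : functor Y X,
    inhabited (@iso (Funct X X) (fid X) (G ∘F F)) /\
    inhabited (@iso (Funct Y Y) (F ∘F G) (fid Y)).

Record adj_equiv (X Y : cat) (F : functor X Y) := AdjEquiv {
  ae_inv : functor Y X;
  ae_unit : @iso (Funct X X) (fid X) (ae_inv ∘F F);
  ae_counit : @iso (Funct Y Y) (F ∘F ae_inv) (fid Y);
  ae_zig : forall x : X, nt (fwd ae_counit) (F x) ∘ fmap F (nt (fwd ae_unit) x) = idm (F x);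
  ae_zag : forall y : Y,
    fmap ae_inv (nt (fwd ae_counit) y) ∘ nt (fwd ae_unit) (ae_inv y) = idm (ae_inv y)
}.

Set Primitive Projections.

Record sub_ob (X : cat) (P : X -> Prop) := SubOb { so :> X; so_prf : P so }.

Definition fullsub (X : cat) (P : X -> Prop) : cat :=
  @Cat (sub_ob P) (fun x y => @hom X x y) (fun x => @idm X x)
    (fun x y z g f => @comp X x y z g f)
    (fun w x y z h g f => @compA X w x y z h g f)
    (fun x y f => @comp1m X x y f) (fun x y f => @compm1 X x y f).

Definition restrict (X Y : cat) (P : X -> Prop) (Q : Y -> Prop) (F : functor X Y)
    (H : forall x, P x -> Q (F x)) : functor (fullsub P) (fullsub Q) :=
  @Functor (fullsub P) (fullsub Q) (fun x => SubOb (H x (so_prf x)))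
    (fun x y f => @fmap X Y F x y f) (fun x => @fmap1 X Y F x)
    (fun x y z g f => @fmapM X Y F x y z g f).

(* Products.  Pairs have primitive projections, so that exchanging the     *)
(* components twice is the identity by conversion.                         *)
Record pr (A B : Type) := Pr { p1 : A; p2 : B }.
Notation "⟨ x , y ⟩" := (Pr x y) (at level 0, format "⟨ x ,  y ⟩") : tcat_scope.

Definition prodcat (X Y : cat) : cat.
Proof.
refine (@Cat (pr X Y) (fun p q => pr (hom (p1 p) (p1 q)) (hom (p2 p) (p2 q)))
  (fun p => ⟨idm (p1 p), idm (p2 p)⟩)
  (fun p q r g f => ⟨p1 g ∘ p1 f, p2 g ∘ p2 f⟩) _ _ _).
- by move=> *; rewrite !compA.
- by move=> x y [f g]; rewrite !comp1m.
- by move=> x y [f g]; rewrite !compm1.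
Defined.
Notation "X × Y" := (prodcat X Y) (at level 40, left associativity) : tcat_scope.

Notation fmap2 F f g := (@fmap _ _ F ⟨_, _⟩ ⟨_, _⟩ ⟨f, g⟩).
Notation fmap3 F f g h :=
  (@fmap _ _ F ⟨⟨_, _⟩, _⟩ ⟨⟨_, _⟩, _⟩ ⟨⟨f, g⟩, h⟩).

Lemma pr_ext (A B : Type) (u v : pr A B) : p1 u = p1 v -> p2 u = p2 v -> u = v.
Proof. by case: u v => [a b] [c d] /= -> ->. Qed.

Definition ipr (X Y : cat) (x x' : X) (y y' : Y) (i : iso x x') (j : iso y y') :
  @iso (X × Y) ⟨x, y⟩ ⟨x', y'⟩.
Proof.
by exists ⟨fwd i, fwd j⟩ ⟨bwd i, bwd j⟩; apply: pr_ext;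
  [exact: bwdK | exact: bwdK | exact: fwdK | exact: fwdK].
Defined.

Definition insl (X Y : cat) (y : Y) : functor X (X × Y).
Proof.
exists (fun x => ⟨x, y⟩) (fun _ _ f => ⟨f, idm y⟩) => // *.
by apply: pr_ext => //; exact: esym (comp1m _).
Defined.

Definition insr (X Y : cat) (x : X) : functor Y (X × Y).
Proof.
exists (fun y => ⟨x, y⟩) (fun _ _ f => ⟨idm x, f⟩) => // *.
by apply: pr_ext => //; exact: esym (comp1m _).
Defined.

Definition exch (X Y : cat) : functor (X × Y) (Y × X) :=
  @Functor (X × Y) (Y × X) (fun p => ⟨p2 p, p1 p⟩) (fun _ _ f => ⟨p2 f, p1 f⟩)
    (fun _ => erefl) (fun _ _ _ _ _ => erefl).

(* -------------------------------------------------------------------- *)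
Unset Primitive Projections.
(* Linear categories                                                     *)

Record linbase (k : fieldType) := LinBase {
  lob : Type;
  lhom : lob -> lob -> vectType k;
  lid : forall x, lhom x x;
  lcomp : forall x y z, lhom y z -> lhom x y -> lhom x z;
  lcompA : forall w x y z (h : lhom y z) (g : lhom x y) (f : lhom w x),
    lcomp h (lcomp g f) = lcomp (lcomp h g) f;
  lcomp1m : forall x y (f : lhom x y), lcomp (lid y) f = f;
  lcompm1 : forall x y (f : lhom x y), lcomp f (lid x) = f;
  lcomp_linr : forall x y z (g : lhom y z) a (f f' : lhom x y),
    lcomp g (a *: f + f') = a *: lcomp g f + lcomp g f';
  lcomp_linl : forall x y z (f : lhom x y) a (g g' : lhom y z),
    lcomp (a *: g + g') f = a *: lcomp g f + lcomp g' f
}.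

Definition lcat (k : fieldType) (A : linbase k) : cat :=
  @Cat (lob A) (fun x y => lhom x y) (@lid k A) (@lcomp k A) (@lcompA k A)
    (@lcomp1m k A) (@lcompm1 k A).
Coercion lcat : linbase >-> cat.

Definition zerom (k : fieldType) (A : linbase k) (x y : A) : hom x y := (0 : lhom x y).
Arguments zerom {k A} x y.

Definition is_zero_ob (k : fieldType) (A : linbase k) (z : A) : Prop := idm z = zerom z z.

Definition is_kernel (k : fieldType) (A : linbase k) (x y w : A)
    (f : hom x y) (i : hom w x) : Prop :=
  f ∘ i = zerom w y /\
  forall v (g : hom v x), f ∘ g = zerom v y -> exists! h : hom v w, i ∘ h = g.

Definition is_coker (k : fieldType) (A : linbase k) (x y z : A)
    (f : hom x y) (p : hom y z) : Prop :=
  p ∘ f = zerom x z /\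
  forall w (g : hom y w), g ∘ f = zerom x w -> exists! h : hom z w, h ∘ p = g.

Definition is_biprod (k : fieldType) (A : linbase k) (x y s : A) : Prop :=
  exists (i1 : lhom x s) (i2 : lhom y s) (q1 : lhom s x) (q2 : lhom s y),
    [/\ lcomp q1 i1 = lid x, lcomp q2 i2 = lid y, lcomp q1 i2 = 0, lcomp q2 i1 = 0
      & lcomp i1 q1 + lcomp i2 q2 = lid s].

Definition is_simple (k : fieldType) (A : linbase k) (x : A) : Prop :=
  ~ is_zero_ob x /\
  forall w (i : hom w x), mono i -> is_zero_ob w \/ is_iso i.

Inductive finite_length (k : fieldType) (A : linbase k) : A -> Prop :=
| fl_zero x : is_zero_ob x -> finite_length x
| fl_ext y x s (i : hom y x) (p : hom x s) :
    is_kernel p i -> is_coker i p -> is_simple s -> finite_length y -> finite_length x.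

Definition is_projective (k : fieldType) (A : linbase k) (p : A) : Prop :=
  forall x y (e : hom x y) (f : hom p y), epi e -> exists g : hom p x, e ∘ g = f.

Definition is_proj_cover (k : fieldType) (A : linbase k) (p x : A) (e : hom p x) : Prop :=
  [/\ is_projective p, epi e & forall w (g : hom w p), epi (e ∘ g) -> epi g].

Record is_abelian (k : fieldType) (A : linbase k) : Prop := IsAbelian {
  ab_zero : exists z : A, is_zero_ob z;
  ab_biprod : forall x y : A, exists s, is_biprod x y s;
  ab_ker : forall (x y : A) (f : hom x y), exists w (i : hom w x), is_kernel f i;
  ab_coker : forall (x y : A) (f : hom x y), exists z (p : hom y z), is_coker f p;
  ab_mono : forall (w x : A) (i : hom w x), mono i -> exists y (f : hom x y), is_kernel f i;
  ab_epi : forall (y z : A) (p : hom y z), epi p -> exists x (f : hom x y), is_coker f p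
}.

(* Finite-dimensionality of the morphism spaces is part of [linbase].      *)
Record is_finite (k : fieldType) (A : linbase k) : Prop := IsFinite {
  fin_length : forall x : A, finite_length x;
  fin_proj : forall x : A, exists p (e : hom p x), is_proj_cover e;
  fin_simple : exists (n : nat) (s : 'I_n -> A),
    forall x : A, is_simple x -> exists j, inhabited (iso x (s j))
}.

Record lincat (k : fieldType) := LinCat {
  lbase :> linbase k;
  l_abelian : is_abelian lbase;
  l_finite : is_finite lbase
}.

Definition flinear (k : fieldType) (A B : lincat k) (F : functor A B) : Prop :=
  forall (x y : A) (a : k) (f g : lhom x y),
    fmap F (a *: f + g : lhom x y) = (a *: (fmap F f : lhom _ _) + fmap F g : lhom _ _).

(* Between abelian categories, a linear functor is right (left) exact       *)
(* precisely if it preserves cokernels (kernels).                           *)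
Definition frex (k : fieldType) (A B : lincat k) (F : functor A B) : Prop :=
  forall (x y z : A) (f : hom x y) (p : hom y z),
    is_coker f p -> is_coker (fmap F f) (fmap F p).

Definition flex (k : fieldType) (A B : lincat k) (F : functor A B) : Prop :=
  forall (w x y : A) (f : hom x y) (i : hom w x),
    is_kernel f i -> is_kernel (fmap F f) (fmap F i).

Definition lin_rex (k : fieldType) (A B : lincat k) (F : functor A B) : Prop :=
  flinear F /\ frex F.

Definition lin_exact (k : fieldType) (A B : lincat k) (F : functor A B) : Prop :=
  [/\ flinear F, frex F & flex F].

Definition lin_rex2 (k : fieldType) (A B E : lincat k) (F : functor (A × B) E) : Prop :=
  (forall b : B, lin_rex (F ∘F insl A b)) /\ (forall a : A, lin_rex (F ∘F insr B a)).

Definition lin_exact2 (k : fieldType) (A B E : lincat k) (F : functor (A × B) E) : Prop :=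
  (forall b : B, lin_exact (F ∘F insl A b)) /\ (forall a : A, lin_exact (F ∘F insr B a)).

Definition lin_rex3 (k : fieldType) (A B C E : lincat k)
    (F : functor (A × B × C) E) : Prop :=
  (forall c : C, lin_rex2 (F ∘F insl (A × B) c)) /\
  (forall (a : A) (b : B), lin_rex (F ∘F @insr (A × B) C ⟨a, b⟩)).

Definition FunRe (k : fieldType) (A B : lincat k) : cat :=
  @fullsub (Funct A B) (@lin_rex k A B).

Record tendata (k : fieldType) := TenData {
  tbase :> lincat k;
  tens : functor (tbase × tbase) tbase;
  tone : tbase;
  tassoc : forall x y z : tbase, iso (tens ⟨tens ⟨x, y⟩, z⟩) (tens ⟨x, tens ⟨y, z⟩⟩);
  tlun : forall x : tbase, iso (tens ⟨tone, x⟩) x;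
  trun : forall x : tbase, iso (tens ⟨x, tone⟩) x
}.
Arguments tone {k} t.
Notation "x ⊗ y" := (fob (tens _) ⟨x, y⟩) (at level 38, no associativity) : tcat_scope.
Notation "f ⊗m g" := (fmap2 (tens _) f g) (at level 38, no associativity) : tcat_scope.

Record is_monoidal (k : fieldType) (C : tendata k) : Prop := IsMonoidal {
  tassoc_nat : forall (x x' y y' z z' : C) (f : hom x x') (g : hom y y') (h : hom z z'),
    fwd (tassoc x' y' z') ∘ ((f ⊗m g) ⊗m h) = (f ⊗m (g ⊗m h)) ∘ fwd (tassoc x y z);
  tlun_nat : forall (x y : C) (f : hom x y),
    fwd (tlun y) ∘ (idm (tone C) ⊗m f) = f ∘ fwd (tlun x);
  trun_nat : forall (x y : C) (f : hom x y),
    fwd (trun y) ∘ (f ⊗m idm (tone C)) = f ∘ fwd (trun x);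
  t_pentagon : forall w x y z : C,
    fwd (tassoc w x (y ⊗ z)) ∘ fwd (tassoc (w ⊗ x) y z) =
    (idm w ⊗m fwd (tassoc x y z)) ∘ fwd (tassoc w (x ⊗ y) z) ∘
      (fwd (tassoc w x y) ⊗m idm z);
  t_triangle : forall x y : C,
    (idm x ⊗m fwd (tlun y)) ∘ fwd (tassoc x (tone C) y) = fwd (trun x) ⊗m idm y
}.

Definition dual_pair (k : fieldType) (C : tendata k) (x y : C) : Prop :=
  exists (ev : hom (y ⊗ x) (tone C)) (coev : hom (tone C) (x ⊗ y)),
    fwd (trun x) ∘ (idm x ⊗m ev) ∘ fwd (tassoc x y x) ∘ (coev ⊗m idm x) ∘ bwd (tlun x)
      = idm x /\
    fwd (tlun y) ∘ (ev ⊗m idm y) ∘ bwd (tassoc y x y) ∘ (idm y ⊗m coev) ∘ bwd (trun y)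
      = idm y.

Definition tlinear (k : fieldType) (C : tendata k) : Prop :=
  (forall y : C, flinear (tens C ∘F insl C y)) /\ (forall x : C, flinear (tens C ∘F insr C x)).

Record is_tensor (k : fieldType) (C : tendata k) : Prop := IsTensor {
  ten_mon : is_monoidal C;
  ten_lin : tlinear C;
  ten_simple : is_simple (tone C);
  ten_ldual : forall x : C, exists y : C, dual_pair x y;
  ten_rdual : forall x : C, exists y : C, dual_pair y x
}.

Record tencat (k : fieldType) := TenCat {
  tdata :> tendata k;
  t_ax : is_tensor tdata
}.
Lemma cA (X : cat) (w x y z : X) (f : hom y z) (g : hom x y) (h : hom x z) (u : hom w x) :
  f ∘ g = h -> f ∘ (g ∘ u) = h ∘ u.
Proof. by move=> <-; rewrite compA. Qed.

Lemma cA3 (X : cat) (v w x y z : X) (f : hom y z) (g : hom x y) (h : hom w x)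
    (r : hom w z) (u : hom v w) : f ∘ (g ∘ h) = r -> f ∘ (g ∘ (h ∘ u)) = r ∘ u.
Proof. by move=> <-; rewrite !compA. Qed.

Lemma bwdKA (X : cat) (w x y : X) (i : iso x y) (u : hom w y) : fwd i ∘ (bwd i ∘ u) = u.
Proof. by rewrite compA bwdK comp1m. Qed.

Lemma fwdKA (X : cat) (w x y : X) (i : iso x y) (u : hom w x) : bwd i ∘ (fwd i ∘ u) = u.
Proof. by rewrite compA fwdK comp1m. Qed.

Lemma iso_cancel_r (X : cat) (x y z : X) (i : iso x y) (f g : hom y z) :
  f ∘ fwd i = g ∘ fwd i -> f = g.
Proof. by move=> e; rewrite -(compm1 f) -(compm1 g) -(bwdK i) !compA e. Qed.

Lemma iso_cancel_l (X : cat) (w x y : X) (i : iso x y) (f g : hom w x) :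
  fwd i ∘ f = fwd i ∘ g -> f = g.
Proof. by move=> e; rewrite -(comp1m f) -(comp1m g) -(fwdK i) -!compA e. Qed.

Lemma iso_move_l (X : cat) (w x y : X) (i : iso x y) (f : hom w x) (g : hom w y) :
  fwd i ∘ f = g -> f = bwd i ∘ g.
Proof. by move=> <-; rewrite fwdKA. Qed.

Lemma iso_move_r (X : cat) (x y z : X) (i : iso x y) (f : hom y z) (g : hom x z) :
  f ∘ fwd i = g -> f = g ∘ bwd i.
Proof. by move=> <-; rewrite -compA bwdK compm1. Qed.

Lemma nat_bwd (X : cat) (x x' y y' : X) (i : iso x y) (j : iso x' y')
    (f : hom x x') (g : hom y y') :
  fwd j ∘ f = g ∘ fwd i -> bwd j ∘ g = f ∘ bwd i.
Proof.
move=> e; rewrite -(comp1m (f ∘ bwd i)) -(fwdK j).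
by rewrite -!compA (cA _ e) -compA bwdK compm1.
Qed.

Lemma f2M (X Y Z : cat) (F : functor (X × Y) Z) (x1 x2 x3 : X) (y1 y2 y3 : Y)
    (g : hom x2 x3) (f : hom x1 x2) (g' : hom y2 y3) (f' : hom y1 y2) :
  fmap2 F g g' ∘ fmap2 F f f' = fmap2 F (g ∘ f) (g' ∘ f').
Proof. by rewrite -fmapM. Qed.

Lemma f2c (X Y Z : cat) (F : functor (X × Y) Z) (x1 x2 : X) (y1 y2 : Y)
    (f : hom x1 x2) (g : hom y1 y2) :
  fmap2 F f (idm y2) ∘ fmap2 F (idm x1) g = fmap2 F (idm x2) g ∘ fmap2 F f (idm y1).
Proof. by rewrite !f2M !comp1m !compm1. Qed.

Lemma f21 (X Y Z : cat) (F : functor (X × Y) Z) (x : X) (y : Y) :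
  fmap2 F (idm x) (idm y) = idm (F ⟨x, y⟩).
Proof. by rewrite -fmap1. Qed.

Lemma f2l (X Y Z : cat) (F : functor (X × Y) Z) (x1 x2 x3 : X) (y : Y)
    (g : hom x2 x3) (f : hom x1 x2) :
  fmap2 F (g ∘ f) (idm y) = fmap2 F g (idm y) ∘ fmap2 F f (idm y).
Proof. by rewrite f2M comp1m. Qed.

Lemma f2r (X Y Z : cat) (F : functor (X × Y) Z) (x : X) (y1 y2 y3 : Y)
    (g : hom y2 y3) (f : hom y1 y2) :
  fmap2 F (idm x) (g ∘ f) = fmap2 F (idm x) g ∘ fmap2 F (idm x) f.
Proof. by rewrite f2M comp1m. Qed.

Definition il (X Y Z : cat) (F : functor (X × Y) Z) (x x' : X) (y : Y) (i : iso x x') :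
  iso (F ⟨x, y⟩) (F ⟨x', y⟩) := imap F (ipr i (iid y)).

Definition ir (X Y Z : cat) (F : functor (X × Y) Z) (x : X) (y y' : Y) (i : iso y y') :
  iso (F ⟨x, y⟩) (F ⟨x, y'⟩) := imap F (ipr (iid x) i).

Lemma flin0 (k : fieldType) (A B : lincat k) (F : functor A B) (x y : A) :
  flinear F -> fmap F (zerom x y) = zerom (F x) (F y).
Proof.
move=> linF; have := linF x y (-1) 0 0; rewrite scaler0 addr0.
by rewrite scaleN1r addNr.
Qed.

Lemma lcomp0 (k : fieldType) (A : lincat k) (x y z : A) (f : hom y z) :
  f ∘ zerom x y = zerom x z.
Proof.
have := lcomp_linr f (-1) (0 : lhom x y) 0; rewrite scaler0 addr0.
by rewrite scaleN1r addNr.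
Qed.

Lemma lcomp0l (k : fieldType) (A : lincat k) (x y z : A) (f : hom x y) :
  zerom y z ∘ f = zerom x z.
Proof.
have := lcomp_linl f (-1) (0 : lhom y z) 0; rewrite scaler0 addr0.
by rewrite scaleN1r addNr.
Qed.

Record adjunction (X Y : cat) (L : functor X Y) (R : functor Y X) := Adj {
  adj_eta : forall x, hom x (R (L x));
  adj_eps : forall y, hom (L (R y)) y;
  adj_eta_nat : forall x x' (f : hom x x'),
    adj_eta x' ∘ f = fmap R (fmap L f) ∘ adj_eta x;
  adj_eps_nat : forall y y' (g : hom y y'),
    adj_eps y' ∘ fmap L (fmap R g) = g ∘ adj_eps y;
  adj_t1 : forall x, adj_eps (L x) ∘ fmap L (adj_eta x) = idm (L x);
  adj_t2 : forall y, fmap R (adj_eps y) ∘ adj_eta (R y) = idm (R y)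
}.

Lemma ladj_rex (k : fieldType) (A B : lincat k) (L : functor A B) (R : functor B A) :
  adjunction L R -> flinear L -> flinear R -> frex L.
Proof.
move=> a linL linR x y z f p [pf univ]; split.
  by rewrite -fmapM pf flin0.
move=> w g gf; have [|h [hp hu]] := univ _ (fmap R g ∘ adj_eta a y).
  by rewrite -compA adj_eta_nat compA -fmapM gf flin0 // lcomp0l.
exists (adj_eps a w ∘ fmap L h); split.
  by rewrite -compA -fmapM hp fmapM compA adj_eps_nat -compA adj_t1 compm1.
move=> h' h'p; rewrite (hu (fmap R h' ∘ adj_eta a z)).
  by rewrite fmapM compA adj_eps_nat -compA adj_t1 compm1.
by rewrite -compA adj_eta_nat compA -fmapM h'p.
Qed.

Lemma radj_lex (k : fieldType) (A B : lincat k) (L : functor A B) (R : functor B A) :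
  adjunction L R -> flinear L -> flinear R -> flex R.
Proof.
move=> a linL linR w x y f i [fi univ]; split.
  by rewrite -fmapM fi flin0.
move=> v g fg; have [|h [ih hu]] := univ _ (adj_eps a x ∘ fmap L g).
  by rewrite compA -adj_eps_nat -compA -fmapM fg flin0 // lcomp0.
exists (fmap R h ∘ adj_eta a v); split.
  by rewrite compA -fmapM ih fmapM -compA -adj_eta_nat compA adj_t2 comp1m.
move=> h' ih'; rewrite (hu (adj_eps a w ∘ fmap L h')).
  by rewrite fmapM -compA -adj_eta_nat compA adj_t2 comp1m.
by rewrite compA -adj_eps_nat -compA -fmapM ih'.
Qed.

Lemma tlun_inj (k : fieldType) (C : tendata k) (monC : is_monoidal C) (x y : C)
    (f g : hom x y) : idm (tone C) ⊗m f = idm (tone C) ⊗m g -> f = g.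
Proof.
by move=> e; apply: (iso_cancel_r (i := tlun x)); rewrite -!tlun_nat // e.
Qed.

Lemma tlunM (k : fieldType) (C : tendata k) (monC : is_monoidal C) (x y : C) :
  fwd (tlun (x ⊗ y)) ∘ fwd (tassoc (tone C) x y) = fwd (tlun x) ⊗m idm y.
Proof.
apply: (tlun_inj monC).
apply: (iso_cancel_r (i := tassoc (tone C) (tone C ⊗ x) y)).
apply: (iso_cancel_r (i := il (tens C) y (tassoc (tone C) (tone C) x))) => /=.
rewrite f2r -!compA; have := t_pentagon monC (tone C) (tone C) x y.
rewrite -!compA => <-; rewrite (cA _ (t_triangle monC _ _)).
rewrite (cA _ (esym (tassoc_nat monC _ _ _))) -compA -f2l t_triangle //.
by rewrite -(f21 (tens C)) -(tassoc_nat monC).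
Qed.

Definition tadj (k : fieldType) (C : tendata k) (monC : is_monoidal C) (x y : C)
    (ev : hom (y ⊗ x) (tone C)) (coev : hom (tone C) (x ⊗ y)) :
  fwd (trun x) ∘ (idm x ⊗m ev) ∘ fwd (tassoc x y x) ∘ (coev ⊗m idm x) ∘ bwd (tlun x)
      = idm x ->
  fwd (tlun y) ∘ (ev ⊗m idm y) ∘ bwd (tassoc y x y) ∘ (idm y ⊗m coev) ∘ bwd (trun y)
      = idm y ->
  adjunction (tens C ∘F insr C y) (tens C ∘F insr C x).
Proof.
move=> snx sny.
exists (fun a => fwd (tassoc x y a) ∘ (coev ⊗m idm a) ∘ bwd (tlun a))
       (fun b => fwd (tlun b) ∘ (ev ⊗m idm b) ∘ bwd (tassoc y x b)).
- move=> a a' f /=; rewrite -!compA (nat_bwd (tlun_nat monC f)).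
  rewrite (cA _ (f2c _ _ _)) -(f21 (tens C)) !compA.
  by rewrite (tassoc_nat monC).
- move=> a a' f /=; rewrite -!compA (nat_bwd (tassoc_nat monC _ _ _)).
  rewrite f21 (cA _ (f2c _ _ _)) !compA.
  by rewrite (tlun_nat monC).
- move=> a /=; rewrite !f2r -!compA.
  have -> : idm y ⊗m bwd (tlun a) = fwd (tassoc y (tone C) a) ∘ (bwd (trun y) ⊗m idm a).
    apply: (iso_cancel_l (i := ir (tens C) y (tlun a))) => /=.
    by rewrite -f2r bwdK (cA _ (t_triangle monC _ _)) -f2l bwdK !f21.
  rewrite (cA _ (esym (tassoc_nat monC _ _ _))) -!compA.
  have pent : bwd (tassoc y x (y ⊗ a)) ∘ ((idm y ⊗m fwd (tassoc x y a)) ∘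
      fwd (tassoc y (x ⊗ y) a)) = fwd (tassoc (y ⊗ x) y a) ∘ (bwd (tassoc y x y) ⊗m idm a).
    apply: (iso_cancel_r (i := il (tens C) a (tassoc y x y))) => /=.
    rewrite -!compA -f2l fwdK f21 compm1.
    have := t_pentagon monC y x y a; rewrite -!compA => <-.
    by rewrite fwdKA.
  rewrite (cA3 _ pent) -!compA -(f21 (tens C)) (cA _ (esym (tassoc_nat monC _ _ _))).
  rewrite -!compA (cA _ (tlunM monC _ _)) -!f2l.
  by rewrite -!compA in sny; rewrite sny f21.
- move=> b /=; rewrite !f2r -!compA.
  have -> : bwd (tlun (x ⊗ b)) = fwd (tassoc (tone C) x b) ∘ (bwd (tlun x) ⊗m idm b).
    apply: (iso_cancel_l (i := tlun (x ⊗ b))) => /=.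
    by rewrite bwdK (cA _ (tlunM monC _ _)) -f2l bwdK !f21.
  rewrite -(f21 (tens C)) (cA _ (esym (tassoc_nat monC _ _ _))) -!compA.
  have pent : (idm x ⊗m bwd (tassoc y x b)) ∘ (fwd (tassoc x y (x ⊗ b)) ∘
      fwd (tassoc (x ⊗ y) x b)) = fwd (tassoc x (y ⊗ x) b) ∘ (fwd (tassoc x y x) ⊗m idm b).
    apply: (iso_cancel_l (i := ir (tens C) x (tassoc y x b))) => /=.
    by rewrite (cA _ (esym (f2r _ _ _ _))) bwdK f21 comp1m (t_pentagon monC) -!compA.
  rewrite (cA3 _ pent) -!compA (cA _ (esym (tassoc_nat monC _ _ _))).
  rewrite -!compA (cA _ (t_triangle monC _ _)) -!f2l.
  by rewrite -!compA in snx; rewrite snx f21.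
Defined.
(* The opposite tensor product; it serves to transport statements about     *)
(* [x ⊗ -] to statements about [- ⊗ x].                                     *)
Definition trev (k : fieldType) (C : tendata k) : tendata k :=
  @TenData k C (tens C ∘F exch C C) (tone C) (fun x y z => iinv (tassoc z y x))
    (@trun k C) (@tlun k C).

Lemma trev_mon (k : fieldType) (C : tendata k) : is_monoidal C -> is_monoidal (trev C).
Proof.
move=> monC; split=> /=.
- move=> x x' y y' z z' f g h.
  exact: (nat_bwd (tassoc_nat monC h g f)).
- by move=> x y f; exact: (trun_nat monC).
- by move=> x y f; exact: (tlun_nat monC).
- move=> w x y z.
  apply: (iso_cancel_r (i := icomp (tassoc z y (x ⊗ w)) (tassoc (z ⊗ y) x w))) => /=.
  rewrite -!compA fwdKA fwdK (t_pentagon monC) -!compA.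
  rewrite (cA _ (esym (f2r _ _ _ _))) fwdK f21 comp1m fwdKA.
  by rewrite -f2l fwdK f21.
- move=> x y.
  by rewrite -(t_triangle monC) -compA bwdK compm1.
Qed.

Lemma trev_dual (k : fieldType) (C : tendata k) (x y : C) :
  dual_pair x y -> @dual_pair k (trev C) y x.
Proof.
move=> [ev [coev [snx sny]]]; exists ev, coev; split.
- exact: sny.
- exact: snx.
Qed.

Lemma trunM (k : fieldType) (C : tendata k) (monC : is_monoidal C) (x y : C) :
  (idm x ⊗m fwd (trun y)) ∘ fwd (tassoc x y (tone C)) = fwd (trun (x ⊗ y)).
Proof.
apply/esym/(iso_cancel_r (i := iinv (tassoc x y (tone C)))) => /=.
rewrite -!compA bwdK compm1.
exact: (tlunM (trev_mon monC) y x).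
Qed.

Lemma tlun_trun1 (k : fieldType) (C : tendata k) (monC : is_monoidal C) :
  fwd (tlun (tone C)) = fwd (trun (tone C)).
Proof.
apply: (tlun_inj monC).
apply: (iso_cancel_r (i := tassoc (tone C) (tone C) (tone C))).
rewrite (t_triangle monC) (trunM monC).
apply: (iso_cancel_l (i := trun (tone C))).
by rewrite (trun_nat monC).
Qed.

Lemma ltens_exact (k : fieldType) (C : tendata k) (x : C) :
  is_monoidal C -> tlinear C ->
  (exists y : C, dual_pair x y) -> (exists y : C, dual_pair y x) ->
  lin_exact (tens C ∘F insr C x).
Proof.
move=> monC [_ lin] [y [ev [coev [s1 s2]]]] [y' [ev' [coev' [s1' s2']]]].
split; first exact: lin.
- exact: (ladj_rex (tadj monC s1' s2') (lin _) (lin _)).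
- exact: (radj_lex (tadj monC s1 s2) (lin _) (lin _)).
Qed.

Lemma tens_exact (k : fieldType) (C : tencat k) : lin_exact2 (tens C).
Proof.
case: (t_ax C) => monC linC _ ld rd; split=> x.
- have [y dy] := ld x; have [y' dy'] := rd x; have [lin1 lin2] := linC.
  apply: (@ltens_exact k (trev C) x (trev_mon monC)).
  + by split=> z; [exact: lin2 | exact: lin1].
  + by exists y'; apply: trev_dual.
  + by exists y; apply: trev_dual.
- exact: ltens_exact (monC) linC (ld x) (rd x).
Qed.

Record bimdata (k : fieldType) (C D : tencat k) := BimData {
  bbase :> lincat k;
  lact : functor (C × bbase) bbase;
  ract : functor (bbase × D) bbase;
  lassoc : forall (c c' : C) (m : bbase),
    iso (lact ⟨c ⊗ c', m⟩) (lact ⟨c, lact ⟨c', m⟩⟩);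
  lunit : forall m : bbase, iso (lact ⟨tone C, m⟩) m;
  rassoc : forall (m : bbase) (d d' : D),
    iso (ract ⟨m, d ⊗ d'⟩) (ract ⟨ract ⟨m, d⟩, d'⟩);
  runit : forall m : bbase, iso (ract ⟨m, tone D⟩) m;
  bmid : forall (c : C) (m : bbase) (d : D),
    iso (ract ⟨lact ⟨c, m⟩, d⟩) (lact ⟨c, ract ⟨m, d⟩⟩)
}.
Notation "c ▷ m" := (fob (lact _) ⟨c, m⟩) (at level 38, no associativity) : tcat_scope.
Notation "m ◁ d" := (fob (ract _) ⟨m, d⟩) (at level 38, no associativity) : tcat_scope.
Notation "f ▷m g" := (fmap2 (lact _) f g) (at level 38, no associativity) : tcat_scope.
Notation "f ◁m g" := (fmap2 (ract _) f g) (at level 38, no associativity) : tcat_scope.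

Record is_bimodule (k : fieldType) (C D : tencat k) (M : bimdata C D) : Prop := IsBimodule {
  lact_exact : lin_exact2 (lact M);
  ract_exact : lin_exact2 (ract M);
  lassoc_nat : forall (c1 c2 c1' c2' : C) (m m' : M)
      (f : hom c1 c1') (g : hom c2 c2') (h : hom m m'),
    fwd (lassoc c1' c2' m') ∘ ((f ⊗m g) ▷m h) = (f ▷m (g ▷m h)) ∘ fwd (lassoc c1 c2 m);
  lunit_nat : forall (m m' : M) (h : hom m m'),
    fwd (lunit m') ∘ (idm (tone C) ▷m h) = h ∘ fwd (lunit m);
  rassoc_nat : forall (m m' : M) (d1 d2 d1' d2' : D)
      (h : hom m m') (f : hom d1 d1') (g : hom d2 d2'),
    fwd (rassoc m' d1' d2') ∘ (h ◁m (f ⊗m g)) = ((h ◁m f) ◁m g) ∘ fwd (rassoc m d1 d2);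
  runit_nat : forall (m m' : M) (h : hom m m'),
    fwd (runit m') ∘ (h ◁m idm (tone D)) = h ∘ fwd (runit m);
  bmid_nat : forall (c c' : C) (m m' : M) (d d' : D)
      (f : hom c c') (h : hom m m') (g : hom d d'),
    fwd (bmid c' m' d') ∘ ((f ▷m h) ◁m g) = (f ▷m (h ◁m g)) ∘ fwd (bmid c m d);
  l_pentagon : forall (b c c' : C) (m : M),
    fwd (lassoc b c (c' ▷ m)) ∘ fwd (lassoc (b ⊗ c) c' m) =
    (idm b ▷m fwd (lassoc c c' m)) ∘ fwd (lassoc b (c ⊗ c') m) ∘
      (fwd (tassoc b c c') ▷m idm m);
  l_triangle : forall (c : C) (m : M),
    (idm c ▷m fwd (lunit m)) ∘ fwd (lassoc c (tone C) m) = fwd (trun c) ▷m idm m;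
  r_pentagon : forall (m : M) (d d' e : D),
    fwd (rassoc (m ◁ d) d' e) ∘ fwd (rassoc m d (d' ⊗ e)) ∘
      (idm m ◁m fwd (tassoc d d' e)) =
    (fwd (rassoc m d d') ◁m idm e) ∘ fwd (rassoc m (d ⊗ d') e);
  r_triangle : forall (m : M) (d : D),
    (fwd (runit m) ◁m idm d) ∘ fwd (rassoc m (tone D) d) = idm m ◁m fwd (tlun d);
  lmid_pentagon : forall (c c' : C) (m : M) (d : D),
    (idm c ▷m fwd (bmid c' m d)) ∘ fwd (bmid c (c' ▷ m) d) ∘
      (fwd (lassoc c c' m) ◁m idm d) =
    fwd (lassoc c c' (m ◁ d)) ∘ fwd (bmid (c ⊗ c') m d);
  rmid_pentagon : forall (c : C) (m : M) (d d' : D),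
    (idm c ▷m fwd (rassoc m d d')) ∘ fwd (bmid c m (d ⊗ d')) =
    fwd (bmid c (m ◁ d) d') ∘ (fwd (bmid c m d) ◁m idm d') ∘
      fwd (rassoc (c ▷ m) d d')
}.

Record bimod (k : fieldType) (C D : tencat k) := Bimod {
  bdata :> bimdata C D;
  b_ax : is_bimodule bdata
}.

Definition regdata (k : fieldType) (C : tencat k) : bimdata C C :=
  @BimData k C C C (tens C) (tens C) (@tassoc k C) (@tlun k C)
    (fun x y z => iinv (tassoc x y z)) (@trun k C) (@tassoc k C).

Lemma regdata_ax (k : fieldType) (C : tencat k) : is_bimodule (regdata C).
Proof.
have monC := ten_mon (t_ax C).
split=> /=.
- exact: tens_exact.
- exact: tens_exact.
- by move=> *; exact: (tassoc_nat monC).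
- exact: (tlun_nat monC).
- by move=> *; exact: (nat_bwd (tassoc_nat monC _ _ _)).
- exact: (trun_nat monC).
- by move=> *; exact: (tassoc_nat monC).
- exact: (t_pentagon monC).
- exact: (t_triangle monC).
- move=> m d d' e.
  apply: (iso_cancel_l (i := il (tens C) e (tassoc m d d'))) => /=.
  apply: (iso_cancel_l (i := tassoc m (d ⊗ d') e)) => /=.
  apply: (iso_cancel_l (i := ir (tens C) m (tassoc d d' e))) => /=.
  rewrite (cA _ (esym (f2l _ _ _ _))) bwdK f21 comp1m bwdK compm1.
  have := t_pentagon monC m d d' e; rewrite -!compA => e1.
  rewrite (cA3 _ (esym e1)) -!compA bwdKA.
  by rewrite bwdKA.
- by move=> m d; rewrite -(t_triangle monC) -compA bwdK compm1.
- by move=> c c' m d; rewrite (t_pentagon monC).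
- move=> c m d d'.
  apply: (iso_cancel_r (i := tassoc (c ⊗ m) d d')) => /=.
  rewrite -!compA fwdK compm1.
  have := t_pentagon monC c m d d'; rewrite -!compA => ->.
  by rewrite (cA _ (esym (f2r _ _ _ _))) fwdK f21 comp1m.
Qed.

Definition regbim (k : fieldType) (C : tencat k) : bimod C C := Bimod (regdata_ax C).
Lemma runit_inj (k : fieldType) (C D : tencat k) (M : bimod C D) (m m' : M)
    (f g : hom m m') : f ◁m idm (tone D) = g ◁m idm (tone D) -> f = g.
Proof.
by move=> e; apply: (iso_cancel_r (i := runit m)); rewrite -!(runit_nat (b_ax M)) e.
Qed.

Lemma lunit_inj (k : fieldType) (C D : tencat k) (M : bimod C D) (m m' : M)
    (f g : hom m m') : idm (tone C) ▷m f = idm (tone C) ▷m g -> f = g.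
Proof.
by move=> e; apply: (iso_cancel_r (i := lunit m)); rewrite -!(lunit_nat (b_ax M)) e.
Qed.

Lemma lunitM (k : fieldType) (C D : tencat k) (M : bimod C D) (c : C) (m : M) :
  fwd (lunit (c ▷ m)) ∘ fwd (lassoc (tone C) c m) = fwd (tlun c) ▷m idm m.
Proof.
have axM := b_ax M; apply: lunit_inj.
apply: (iso_cancel_r (i := lassoc (tone C) (tone C ⊗ c) m)).
apply: (iso_cancel_r (i := il (lact M) m (tassoc (tone C) (tone C) c))) => /=.
rewrite f2r -!compA; have := l_pentagon axM (tone C) (tone C) c m.
rewrite -!compA => <-; rewrite (cA _ (l_triangle axM _ _)).
rewrite (cA _ (esym (lassoc_nat axM _ _ _))) -compA -f2l (t_triangle (ten_mon (t_ax C))).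
by rewrite -(f21 (lact M)) -(lassoc_nat axM).
Qed.

Lemma runitM (k : fieldType) (C D : tencat k) (M : bimod C D) (c : C) (m : M) :
  (idm c ▷m fwd (runit m)) ∘ fwd (bmid c m (tone D)) = fwd (runit (c ▷ m)).
Proof.
have axM := b_ax M; apply: runit_inj.
apply: (iso_cancel_r (i := rassoc (c ▷ m) (tone D) (tone D))).
apply: (iso_cancel_l (i := bmid c m (tone D))) => /=.
rewrite (r_triangle axM) f2l -!compA.
rewrite (cA _ (bmid_nat axM _ _ _)) -!compA.
have := rmid_pentagon axM c m (tone D) (tone D); rewrite -!compA => <-.
rewrite (cA _ (esym (f2r _ _ _ _))) (r_triangle axM).
by rewrite -(bmid_nat axM) f21.
Qed.

Set Primitive Projections.

(* Throughout, the data of a (multi-)balanced functor (a functor together   *)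
(* with isomorphisms) is separated from the conditions [is_bal1], [is_balR],*)
(* [is_bal2], [is_bal3] it has to satisfy: natural transformations between  *)
(* such functors only involve the data, so that the categories of right     *)
(* exact (multi-)balanced functors are full subcategories.  The linear      *)
(* structure of their morphism spaces is pointwise and is not recorded, as  *)
(* all functors between them considered here act by reindexing or by        *)
(* composition with a linear functor.                                       *)
Record bal1d (k : fieldType) (C : tencat k) (M : bimod C C) (A : lincat k) := Bal1Data {
  b1f :> functor M A;
  b1b : forall (x : M) (c : C), iso (b1f (x ◁ c)) (b1f (c ▷ x))
}.

Unset Primitive Projections.

Record bal1hom (k : fieldType) (C : tencat k) (M : bimod C C) (A : lincat k)
    (F G : bal1d M A) := Bal1Hom {
  b1n :> nat_trans F G;
  b1n_bal : forall (x : M) (c : C),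
    b1n (c ▷ x) ∘ fwd (b1b F x c) = fwd (b1b G x c) ∘ b1n (x ◁ c)
}.

Lemma bal1hom_ext (k : fieldType) (C : tencat k) (M : bimod C C) (A : lincat k)
    (F G : bal1d M A) (a b : bal1hom F G) : (forall x, a x = b x) -> a = b.
Proof.
case: a b => [a Ha] [b Hb] /= e0.
have e : a = b by apply: nt_ext.
by case: _ / e in Hb *; congr Bal1Hom; apply: proof_irrelevance.
Qed.

Definition bal1_id (k : fieldType) (C : tencat k) (M : bimod C C) (A : lincat k)
  (F : bal1d M A) : bal1hom F F.
Proof. by exists (nt_id F) => x c; rewrite /= comp1m compm1. Defined.

Definition bal1_comp (k : fieldType) (C : tencat k) (M : bimod C C) (A : lincat k)
  (F G H : bal1d M A) (b : bal1hom G H) (a : bal1hom F G) : bal1hom F H.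
Proof.
by exists (nt_comp b a) => x c; rewrite /= -!compA (b1n_bal a) (cA _ (b1n_bal b _ _)) -!compA.
Defined.

Definition Bal1d (k : fieldType) (C : tencat k) (M : bimod C C) (A : lincat k) : cat.
Proof.
refine (@Cat (bal1d M A) (@bal1hom k C M A) (@bal1_id k C M A) (@bal1_comp k C M A) _ _ _).
- by move=> *; apply: bal1hom_ext => x /=; rewrite compA.
- by move=> *; apply: bal1hom_ext => x /=; rewrite comp1m.
- by move=> *; apply: bal1hom_ext => x /=; rewrite compm1.
Defined.

Record is_bal1 (k : fieldType) (C : tencat k) (M : bimod C C) (A : lincat k)
    (F : bal1d M A) : Prop := IsBal1 {
  b1_rex : lin_rex F;
  b1_nat : forall (x x' : M) (c c' : C) (f : hom x x') (u : hom c c'),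
    fwd (b1b F x' c') ∘ fmap F (f ◁m u) = fmap F (u ▷m f) ∘ fwd (b1b F x c);
  b1_pentagon : forall (x : M) (c d : C),
    fmap F (fwd (lassoc c d x)) ∘ fwd (b1b F x (c ⊗ d)) =
    fwd (b1b F (d ▷ x) c) ∘ fmap F (bwd (bmid d x c)) ∘ fwd (b1b F (x ◁ c) d) ∘
      fmap F (fwd (rassoc x c d));
  b1_triangle : forall x : M,
    fmap F (fwd (lunit x)) ∘ fwd (b1b F x (tone C)) = fmap F (fwd (runit x))
}.

(* Fun^{bal,r.e.}(M, A) *)
Definition Bal1 (k : fieldType) (C : tencat k) (M : bimod C C) (A : lincat k) : cat :=
  @fullsub (Bal1d M A) (@is_bal1 k C M A).

Definition innbal (k : fieldType) (C D E : tencat k) (M : bimod C D) (N : bimod D E)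
    (A : lincat k) (F : functor (M × N) A) : Type :=
  forall (d : D) (m : M) (n : N), iso (F ⟨m ◁ d, n⟩) (F ⟨m, d ▷ n⟩).

(* The balancing in the tensor category acting from outside: on the first   *)
(* factor from the left and on the second one from the right.               *)
Definition outbal (k : fieldType) (C D E : tencat k) (M : bimod C D) (N : bimod E C)
    (A : lincat k) (F : functor (M × N) A) : Type :=
  forall (c : C) (m : M) (n : N), iso (F ⟨c ▷ m, n⟩) (F ⟨m, n ◁ c⟩).

Record innbal_ax (k : fieldType) (C D E : tencat k) (M : bimod C D) (N : bimod D E)
    (A : lincat k) (F : functor (M × N) A) (g : innbal F) : Prop := InnBalAx {
  inn_nat : forall (d d' : D) (m m' : M) (n n' : N)
      (u : hom d d') (f : hom m m') (h : hom n n'),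
    fwd (g d' m' n') ∘ fmap2 F (f ◁m u) h = fmap2 F f (u ▷m h) ∘ fwd (g d m n);
  inn_pentagon : forall (d d' : D) (m : M) (n : N),
    fmap2 F (idm m) (fwd (lassoc d d' n)) ∘ fwd (g (d ⊗ d') m n) =
    fwd (g d m (d' ▷ n)) ∘ fwd (g d' (m ◁ d) n) ∘ fmap2 F (fwd (rassoc m d d')) (idm n);
  inn_triangle : forall (m : M) (n : N),
    fmap2 F (idm m) (fwd (lunit n)) ∘ fwd (g (tone D) m n) =
    fmap2 F (fwd (runit m)) (idm n)
}.

Record outbal_ax (k : fieldType) (C D E : tencat k) (M : bimod C D) (N : bimod E C)
    (A : lincat k) (F : functor (M × N) A) (b : outbal F) : Prop := OutBalAx {
  out_nat : forall (c c' : C) (m m' : M) (n n' : N)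
      (u : hom c c') (f : hom m m') (h : hom n n'),
    fwd (b c' m' n') ∘ fmap2 F (u ▷m f) h = fmap2 F f (h ◁m u) ∘ fwd (b c m n);
  out_pentagon : forall (c c' : C) (m : M) (n : N),
    fmap2 F (idm m) (fwd (rassoc n c c')) ∘ fwd (b (c ⊗ c') m n) =
    fwd (b c' m (n ◁ c)) ∘ fwd (b c (c' ▷ m) n) ∘ fmap2 F (fwd (lassoc c c' m)) (idm n);
  out_triangle : forall (m : M) (n : N),
    fmap2 F (idm m) (fwd (runit n)) ∘ fwd (b (tone C) m n) =
    fmap2 F (fwd (lunit m)) (idm n)
}.

Set Primitive Projections.

Record balRd (k : fieldType) (C D E : tencat k) (M : bimod C D) (N : bimod D E)
    (A : lincat k) := BalRData {
  bRf :> functor (M × N) A;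
  bRi : innbal bRf
}.

Unset Primitive Projections.

Record balRhom (k : fieldType) (C D E : tencat k) (M : bimod C D) (N : bimod D E)
    (A : lincat k) (F G : balRd M N A) := BalRHom {
  bRn :> nat_trans F G;
  bRn_inn : forall (d : D) (m : M) (n : N),
    bRn ⟨m, d ▷ n⟩ ∘ fwd (bRi F d m n) = fwd (bRi G d m n) ∘ bRn ⟨m ◁ d, n⟩
}.

Lemma balRhom_ext (k : fieldType) (C D E : tencat k) (M : bimod C D) (N : bimod D E)
    (A : lincat k) (F G : balRd M N A) (a b : balRhom F G) :
  (forall p, a p = b p) -> a = b.
Proof.
case: a b => [a Ha] [b Hb] /= e0.
have e : a = b by apply: nt_ext.
by case: _ / e in Hb *; congr BalRHom; apply: proof_irrelevance.
Qed.

Definition balR_id (k : fieldType) (C D E : tencat k) (M : bimod C D) (N : bimod D E)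
  (A : lincat k) (F : balRd M N A) : balRhom F F.
Proof. by exists (nt_id F) => d m n; rewrite /= comp1m compm1. Defined.

Definition balR_comp (k : fieldType) (C D E : tencat k) (M : bimod C D) (N : bimod D E)
  (A : lincat k) (F G H : balRd M N A) (b : balRhom G H) (a : balRhom F G) : balRhom F H.
Proof.
by exists (nt_comp b a) => d m n; rewrite /= -!compA (bRn_inn a) (cA _ (bRn_inn b _ _ _)) -!compA.
Defined.

Definition BalRd (k : fieldType) (C D E : tencat k) (M : bimod C D) (N : bimod D E)
  (A : lincat k) : cat.
Proof.
refine (@Cat (balRd M N A) (@balRhom k C D E M N A) (@balR_id k C D E M N A)
  (@balR_comp k C D E M N A) _ _ _).
- by move=> *; apply: balRhom_ext => p /=; rewrite compA.
- by move=> *; apply: balRhom_ext => p /=; rewrite comp1m.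
- by move=> *; apply: balRhom_ext => p /=; rewrite compm1.
Defined.

Definition is_balR (k : fieldType) (C D E : tencat k) (M : bimod C D) (N : bimod D E)
    (A : lincat k) (F : balRd M N A) : Prop :=
  lin_rex2 F /\ innbal_ax (bRi F).

Definition BalR (k : fieldType) (C D E : tencat k) (M : bimod C D) (N : bimod D E)
    (A : lincat k) : cat :=
  @fullsub (BalRd M N A) (@is_balR k C D E M N A).

Definition fwhisk (X Y Z : cat) (F : functor X Y) (H H' : functor Y Z)
    (a : nat_trans H H') : nat_trans (H ∘F F) (H' ∘F F) :=
  @NatTrans X Z (H ∘F F) (H' ∘F F) (fun x => a (F x)) (fun x y f => nt_nat a (fmap F f)).

Definition postRd_ob (k : fieldType) (C D E : tencat k) (M : bimod C D) (N : bimod D E)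
    (T : lincat k) (B : balRd M N T) (A : lincat k) (H : functor T A) : balRd M N A :=
  @BalRData k C D E M N A (H ∘F B) (fun d m n => imap H (bRi B d m n)).

Definition postRd_hom (k : fieldType) (C D E : tencat k) (M : bimod C D) (N : bimod D E)
    (T : lincat k) (B : balRd M N T) (A : lincat k) (H H' : functor T A)
    (a : nat_trans H H') : balRhom (postRd_ob B H) (postRd_ob B H') :=
  @BalRHom k C D E M N A (postRd_ob B H) (postRd_ob B H') (fwhisk B a)
    (fun d m n => nt_nat a _).

Definition postRd (k : fieldType) (C D E : tencat k) (M : bimod C D) (N : bimod D E)
  (T : lincat k) (B : balRd M N T) (A : lincat k) : functor (Funct T A) (BalRd M N A).
Proof.
refine (@Functor (Funct T A) (BalRd M N A) (@postRd_ob k C D E M N T B A)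
  (@postRd_hom k C D E M N T B A) _ _).
- by move=> H; apply: balRhom_ext.
- by move=> H H' H'' b a; apply: balRhom_ext.
Defined.

Definition post1d_ob (k : fieldType) (C : tencat k) (M : bimod C C)
    (T : lincat k) (B : bal1d M T) (A : lincat k) (H : functor T A) : bal1d M A :=
  @Bal1Data k C M A (H ∘F B) (fun x c => imap H (b1b B x c)).

Definition post1d_hom (k : fieldType) (C : tencat k) (M : bimod C C)
    (T : lincat k) (B : bal1d M T) (A : lincat k) (H H' : functor T A)
    (a : nat_trans H H') : bal1hom (post1d_ob B H) (post1d_ob B H') :=
  @Bal1Hom k C M A (post1d_ob B H) (post1d_ob B H') (fwhisk B a) (fun x c => nt_nat a _).

Definition post1d (k : fieldType) (C : tencat k) (M : bimod C C)
  (T : lincat k) (B : bal1d M T) (A : lincat k) : functor (Funct T A) (Bal1d M A).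
Proof.
refine (@Functor (Funct T A) (Bal1d M A) (@post1d_ob k C M T B A)
  (@post1d_hom k C M T B A) _ _).
- by move=> H; apply: bal1hom_ext.
- by move=> H H' H'' b a; apply: bal1hom_ext.
Defined.

Lemma lin_rex_comp (k : fieldType) (A B C : lincat k) (G : functor B C) (F : functor A B) :
  lin_rex G -> lin_rex F -> lin_rex (G ∘F F).
Proof.
move=> [linG rexG] [linF rexF]; split; first by move=> x y a f g /=; rewrite linF linG.
by move=> x y z f p /rexF /rexG.
Qed.

Lemma lin_rex2_comp (k : fieldType) (A B C E : lincat k) (G : functor C E)
    (F : functor (A × B) C) : lin_rex G -> lin_rex2 F -> lin_rex2 (G ∘F F).
Proof.
move=> rG [r1 r2]; split=> x; first exact: (lin_rex_comp rG (r1 x)).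
exact: (lin_rex_comp rG (r2 x)).
Qed.

Lemma postRd_bal (k : fieldType) (C D E : tencat k) (M : bimod C D) (N : bimod D E)
    (T : lincat k) (B : balRd M N T) (A : lincat k) (H : functor T A) :
  is_balR B -> lin_rex H -> is_balR (postRd B A H).
Proof.
move=> [rB axB] rH; split; first exact: lin_rex2_comp.
split=> /= *; rewrite -?fmapM.
- by rewrite (inn_nat axB).
- by rewrite (inn_pentagon axB).
- by rewrite (inn_triangle axB).
Qed.

Lemma post1d_bal (k : fieldType) (C : tencat k) (M : bimod C C)
    (T : lincat k) (B : bal1d M T) (A : lincat k) (H : functor T A) :
  is_bal1 B -> lin_rex H -> is_bal1 (post1d B A H).
Proof.
move=> axB rH; split=> /= *; rewrite -?fmapM.
- exact: lin_rex_comp rH (b1_rex axB).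
- by rewrite (b1_nat axB).
- by rewrite (b1_pentagon axB).
- by rewrite (b1_triangle axB).
Qed.

Definition postR (k : fieldType) (C D E : tencat k) (M : bimod C D) (N : bimod D E)
    (T : lincat k) (B : BalR M N T) (A : lincat k) : functor (FunRe T A) (BalR M N A) :=
  restrict (F := postRd (so B) A) (fun H => @postRd_bal k C D E M N T (so B) A H (so_prf B)).

Definition post1 (k : fieldType) (C : tencat k) (M : bimod C C)
    (T : lincat k) (B : Bal1 M T) (A : lincat k) : functor (FunRe T A) (Bal1 M A) :=
  restrict (F := post1d (so B) A) (fun H => @post1d_bal k C M T (so B) A H (so_prf B)).

(* The bimodule structure on a relative tensor product is the one inherited *)
(* from the outer actions: the universal balanced functor [rt_B] is a       *)
(* bimodule functor, and its bimodule structure commutes with the balancing. *)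
(* This determines the bimodule structure up to canonical isomorphism.      *)
Record reltensor (k : fieldType) (C D E : tencat k) (M : bimod C D) (N : bimod D E) :=
    RelTensor {
  rt_bim :> bimod C E;
  rt_B : BalR M N rt_bim;
  rt_univ : forall A : lincat k, adj_equiv (postR rt_B A);
  rt_l : forall (c : C) (m : M) (n : N), iso (so rt_B ⟨c ▷ m, n⟩) (c ▷ so rt_B ⟨m, n⟩);
  rt_r : forall (e : E) (m : M) (n : N), iso (so rt_B ⟨m, n ◁ e⟩) (so rt_B ⟨m, n⟩ ◁ e);
  rt_l_nat : forall (c c' : C) (m m' : M) (n n' : N)
      (u : hom c c') (f : hom m m') (g : hom n n'),
    fwd (rt_l c' m' n') ∘ fmap2 (so rt_B) (u ▷m f) g =
    (u ▷m fmap2 (so rt_B) f g) ∘ fwd (rt_l c m n);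
  rt_r_nat : forall (e e' : E) (m m' : M) (n n' : N)
      (u : hom e e') (f : hom m m') (g : hom n n'),
    fwd (rt_r e' m' n') ∘ fmap2 (so rt_B) f (g ◁m u) =
    (fmap2 (so rt_B) f g ◁m u) ∘ fwd (rt_r e m n);
  rt_l_assoc : forall (c c' : C) (m : M) (n : N),
    fwd (lassoc c c' (so rt_B ⟨m, n⟩)) ∘ fwd (rt_l (c ⊗ c') m n) =
    (idm c ▷m fwd (rt_l c' m n)) ∘ fwd (rt_l c (c' ▷ m) n) ∘
      fmap2 (so rt_B) (fwd (lassoc c c' m)) (idm n);
  rt_l_unit : forall (m : M) (n : N),
    fwd (lunit (so rt_B ⟨m, n⟩)) ∘ fwd (rt_l (tone C) m n) =
    fmap2 (so rt_B) (fwd (lunit m)) (idm n);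
  rt_r_assoc : forall (e e' : E) (m : M) (n : N),
    fwd (rassoc (so rt_B ⟨m, n⟩) e e') ∘ fwd (rt_r (e ⊗ e') m n) =
    (fwd (rt_r e m n) ◁m idm e') ∘ fwd (rt_r e' m (n ◁ e)) ∘
      fmap2 (so rt_B) (idm m) (fwd (rassoc n e e'));
  rt_r_unit : forall (m : M) (n : N),
    fwd (runit (so rt_B ⟨m, n⟩)) ∘ fwd (rt_r (tone E) m n) =
    fmap2 (so rt_B) (idm m) (fwd (runit n));
  rt_mid : forall (c : C) (e : E) (m : M) (n : N),
    fwd (bmid c (so rt_B ⟨m, n⟩) e) ∘ (fwd (rt_l c m n) ◁m idm e) ∘
      fwd (rt_r e (c ▷ m) n) =
    (idm c ▷m fwd (rt_r e m n)) ∘ fwd (rt_l c m (n ◁ e));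
  rt_l_bal : forall (c : C) (d : D) (m : M) (n : N),
    fwd (rt_l c m (d ▷ n)) ∘ fwd (bRi (so rt_B) d (c ▷ m) n) =
    (idm c ▷m fwd (bRi (so rt_B) d m n)) ∘ fwd (rt_l c (m ◁ d) n) ∘
      fmap2 (so rt_B) (fwd (bmid c m d)) (idm n);
  rt_r_bal : forall (d : D) (e : E) (m : M) (n : N),
    fwd (rt_r e m (d ▷ n)) ∘ fmap2 (so rt_B) (idm m) (bwd (bmid d n e)) ∘
      fwd (bRi (so rt_B) d m (n ◁ e)) =
    (fwd (bRi (so rt_B) d m n) ◁m idm e) ∘ fwd (rt_r e (m ◁ d) n)
}.

Record cvtrace (k : fieldType) (C : tencat k) (X : bimod C C) := CvTrace {
  tr_cat :> lincat k;
  tr_B : Bal1 X tr_cat;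
  tr_univ : forall A : lincat k, adj_equiv (post1 tr_B A)
}.

Set Primitive Projections.

Record bal2d (k : fieldType) (C D : tencat k) (M : bimod C D) (N : bimod D C)
    (A : lincat k) := Bal2Data {
  b2f :> functor (M × N) A;
  b2o : outbal b2f;
  b2i : innbal b2f
}.

Unset Primitive Projections.

Record bal2hom (k : fieldType) (C D : tencat k) (M : bimod C D) (N : bimod D C)
    (A : lincat k) (F G : bal2d M N A) := Bal2Hom {
  b2n :> nat_trans F G;
  b2n_out : forall (c : C) (m : M) (n : N),
    b2n ⟨m, n ◁ c⟩ ∘ fwd (b2o F c m n) = fwd (b2o G c m n) ∘ b2n ⟨c ▷ m, n⟩;
  b2n_inn : forall (d : D) (m : M) (n : N),
    b2n ⟨m, d ▷ n⟩ ∘ fwd (b2i F d m n) = fwd (b2i G d m n) ∘ b2n ⟨m ◁ d, n⟩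
}.

Lemma bal2hom_ext (k : fieldType) (C D : tencat k) (M : bimod C D) (N : bimod D C)
    (A : lincat k) (F G : bal2d M N A) (a b : bal2hom F G) :
  (forall p, a p = b p) -> a = b.
Proof.
case: a b => [a Ha Ha'] [b Hb Hb'] /= e0.
have e : a = b by apply: nt_ext.
by case: _ / e in Hb Hb' *; congr Bal2Hom; apply: proof_irrelevance.
Qed.

Definition bal2_id (k : fieldType) (C D : tencat k) (M : bimod C D) (N : bimod D C)
  (A : lincat k) (F : bal2d M N A) : bal2hom F F.
Proof. by exists (nt_id F) => d m n; rewrite /= comp1m compm1. Defined.

Definition bal2_comp (k : fieldType) (C D : tencat k) (M : bimod C D) (N : bimod D C)
  (A : lincat k) (F G H : bal2d M N A) (b : bal2hom G H) (a : bal2hom F G) : bal2hom F H.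
Proof.
exists (nt_comp b a) => d m n.
- by rewrite /= -!compA (b2n_out a) (cA _ (b2n_out b _ _ _)) -!compA.
- by rewrite /= -!compA (b2n_inn a) (cA _ (b2n_inn b _ _ _)) -!compA.
Defined.

Definition Bal2d (k : fieldType) (C D : tencat k) (M : bimod C D) (N : bimod D C)
  (A : lincat k) : cat.
Proof.
refine (@Cat (bal2d M N A) (@bal2hom k C D M N A) (@bal2_id k C D M N A)
  (@bal2_comp k C D M N A) _ _ _).
- by move=> *; apply: bal2hom_ext => p /=; rewrite compA.
- by move=> *; apply: bal2hom_ext => p /=; rewrite comp1m.
- by move=> *; apply: bal2hom_ext => p /=; rewrite compm1.
Defined.

Record is_bal2 (k : fieldType) (C D : tencat k) (M : bimod C D) (N : bimod D C)
    (A : lincat k) (F : bal2d M N A) : Prop := IsBal2 {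
  b2_rex : lin_rex2 F;
  b2_out : outbal_ax (b2o F);
  b2_inn : innbal_ax (b2i F);
  b2_compat : forall (c : C) (d : D) (m : M) (n : N),
    fmap2 F (idm m) (fwd (bmid d n c)) ∘ fwd (b2o F c m (d ▷ n)) ∘
      fwd (b2i F d (c ▷ m) n) =
    fwd (b2i F d m (n ◁ c)) ∘ fwd (b2o F c (m ◁ d) n) ∘ fmap2 F (fwd (bmid c m d)) (idm n)
}.

(* Fun^{bal,r.e.}(M x N, A) *)
Definition Bal2 (k : fieldType) (C D : tencat k) (M : bimod C D) (N : bimod D C)
    (A : lincat k) : cat :=
  @fullsub (Bal2d M N A) (@is_bal2 k C D M N A).

Definition post2d_ob (k : fieldType) (C D : tencat k) (M : bimod C D) (N : bimod D C)
    (T : lincat k) (B : bal2d M N T) (A : lincat k) (H : functor T A) : bal2d M N A :=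
  @Bal2Data k C D M N A (H ∘F B) (fun c m n => imap H (b2o B c m n))
    (fun d m n => imap H (b2i B d m n)).

(* Switching the arguments.  The inner and the outer balancing are          *)
(* exchanged; as they point in opposite directions, they get inverted.      *)
Definition switchd_ob (k : fieldType) (C D : tencat k) (M : bimod C D) (N : bimod D C)
    (A : lincat k) (F : bal2d M N A) : bal2d N M A :=
  @Bal2Data k D C N M A (F ∘F exch N M)
    (fun d n m => iinv (b2i F d m n)) (fun c n m => iinv (b2o F c m n)).

Definition switchd_hom (k : fieldType) (C D : tencat k) (M : bimod C D) (N : bimod D C)
  (A : lincat k) (F G : bal2d M N A) (a : bal2hom F G) :
  bal2hom (switchd_ob F) (switchd_ob G).
Proof.
exists (fwhisk (exch N M) a) => x y z /=.
- exact: (esym (nat_bwd (esym (b2n_inn a _ _ _)))).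
- exact: (esym (nat_bwd (esym (b2n_out a _ _ _)))).
Defined.

Definition switchd (k : fieldType) (C D : tencat k) (M : bimod C D) (N : bimod D C)
  (A : lincat k) : functor (Bal2d M N A) (Bal2d N M A).
Proof.
refine (@Functor (Bal2d M N A) (Bal2d N M A) (@switchd_ob k C D M N A)
  (@switchd_hom k C D M N A) _ _).
- by move=> F; apply: bal2hom_ext.
- by move=> F G H b a; apply: bal2hom_ext.
Defined.

Lemma lin_rex2_exch (k : fieldType) (A B E : lincat k) (F : functor (A × B) E) :
  lin_rex2 F -> lin_rex2 (F ∘F exch B A).
Proof. by case=> r1 r2; split=> x; [exact: r2 | exact: r1]. Qed.

Lemma inn_out_ax (k : fieldType) (C D E : tencat k) (M : bimod C D) (N : bimod D E)
    (A : lincat k) (F : functor (M × N) A) (g : innbal F) :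
  innbal_ax g -> @outbal_ax k D E C N M A (F ∘F exch N M) (fun d n m => iinv (g d m n)).
Proof.
move=> ax; split=> /=.
- by move=> d d' n n' m m' u f h; exact: (nat_bwd (inn_nat ax u h f)).
- move=> d d' n m.
  apply: (iso_cancel_r (i := g (d ⊗ d') m n)) => /=.
  rewrite -!compA fwdK compm1 (inn_pentagon ax) -!compA.
  by rewrite fwdKA fwdKA.
- move=> n m.
  apply: (iso_cancel_r (i := g (tone D) m n)) => /=.
  by rewrite -!compA fwdK compm1 (inn_triangle ax).
Qed.

Lemma out_inn_ax (k : fieldType) (C D E : tencat k) (M : bimod C D) (N : bimod E C)
    (A : lincat k) (F : functor (M × N) A) (b : outbal F) :
  outbal_ax b -> @innbal_ax k E C D N M A (F ∘F exch N M) (fun c n m => iinv (b c m n)).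
Proof.
move=> ax; split=> /=.
- by move=> c c' n n' m m' u h f; exact: (nat_bwd (out_nat ax u f h)).
- move=> c c' n m.
  apply: (iso_cancel_r (i := b (c ⊗ c') m n)) => /=.
  rewrite -!compA fwdK compm1 (out_pentagon ax) -!compA.
  by rewrite fwdKA fwdKA.
- move=> n m.
  apply: (iso_cancel_r (i := b (tone C) m n)) => /=.
  by rewrite -!compA fwdK compm1 (out_triangle ax).
Qed.

Lemma switch_bal (k : fieldType) (C D : tencat k) (M : bimod C D) (N : bimod D C)
    (A : lincat k) (F : bal2d M N A) : is_bal2 F -> is_bal2 (switchd M N A F).
Proof.
move=> ax; split=> /=.
- exact: lin_rex2_exch (b2_rex ax).
- exact: inn_out_ax (b2_inn ax).
- exact: out_inn_ax (b2_out ax).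
- move=> d c n m.
  have e := b2_compat ax c d m n.
  apply: (iso_cancel_r (i := icomp (b2o F c m (d ▷ n)) (b2i F d (c ▷ m) n))) => /=.
  rewrite -!compA fwdKA fwdK compm1; rewrite -!compA in e.
  by rewrite e fwdKA fwdKA.
Qed.

Definition switch (k : fieldType) (C D : tencat k) (M : bimod C D) (N : bimod D C)
    (A : lincat k) : functor (Bal2 M N A) (Bal2 N M A) :=
  restrict (F := switchd M N A) (fun F => @switch_bal k C D M N A F).

Definition ins1 (X Y Z : cat) (x : X) : functor (Y × Z) (X × Y × Z).
Proof.
refine (@Functor (Y × Z) (X × Y × Z) (fun p => ⟨⟨x, p1 p⟩, p2 p⟩)
  (fun _ _ f => ⟨⟨idm x, p1 f⟩, p2 f⟩) (fun _ => erefl) _) => *.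
by apply: pr_ext => //; apply: pr_ext => //; exact: esym (comp1m _).
Defined.

Definition ins2 (X Y Z : cat) (y : Y) : functor (X × Z) (X × Y × Z).
Proof.
refine (@Functor (X × Z) (X × Y × Z) (fun p => ⟨⟨p1 p, y⟩, p2 p⟩)
  (fun _ _ f => ⟨⟨p1 f, idm y⟩, p2 f⟩) (fun _ => erefl) _) => *.
by apply: pr_ext => //; apply: pr_ext => //; exact: esym (comp1m _).
Defined.

Definition ins3 (X Y Z : cat) (z : Z) : functor (X × Y) (X × Y × Z) := insl (X × Y) z.

Set Primitive Projections.

Record bal3d (k : fieldType) (C D E : tencat k)
    (M : bimod D C) (N : bimod C E) (K : bimod E D) (A : lincat k) := Bal3Data {
  b3f :> functor (M × N × K) A;
  b3o : forall n : N, outbal (b3f ∘F ins2 M K n);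
  b3i : forall x : K, innbal (b3f ∘F ins3 M N x);
  b3j : forall m : M, innbal (b3f ∘F ins1 N K m)
}.

Unset Primitive Projections.

Record bal3hom (k : fieldType) (C D E : tencat k)
    (M : bimod D C) (N : bimod C E) (K : bimod E D) (A : lincat k)
    (F G : bal3d M N K A) := Bal3Hom {
  b3n :> nat_trans F G;
  b3n_o : forall (d : D) (m : M) (n : N) (x : K),
    b3n ⟨⟨m, n⟩, x ◁ d⟩ ∘ fwd (b3o F n d m x) =
    fwd (b3o G n d m x) ∘ b3n ⟨⟨d ▷ m, n⟩, x⟩;
  b3n_i : forall (c : C) (m : M) (n : N) (x : K),
    b3n ⟨⟨m, c ▷ n⟩, x⟩ ∘ fwd (b3i F x c m n) =
    fwd (b3i G x c m n) ∘ b3n ⟨⟨m ◁ c, n⟩, x⟩;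
  b3n_j : forall (e : E) (m : M) (n : N) (x : K),
    b3n ⟨⟨m, n⟩, e ▷ x⟩ ∘ fwd (b3j F m e n x) =
    fwd (b3j G m e n x) ∘ b3n ⟨⟨m, n ◁ e⟩, x⟩
}.

Lemma bal3hom_ext (k : fieldType) (C D E : tencat k)
    (M : bimod D C) (N : bimod C E) (K : bimod E D) (A : lincat k)
    (F G : bal3d M N K A) (a b : bal3hom F G) :
  (forall p, a p = b p) -> a = b.
Proof.
case: a b => [a Ha Ha' Ha''] [b Hb Hb' Hb''] /= e0.
have e : a = b by apply: nt_ext.
by case: _ / e in Hb Hb' Hb'' *; congr Bal3Hom; apply: proof_irrelevance.
Qed.

Definition bal3_id (k : fieldType) (C D E : tencat k)
  (M : bimod D C) (N : bimod C E) (K : bimod E D) (A : lincat k)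
  (F : bal3d M N K A) : bal3hom F F.
Proof. by exists (nt_id F) => *; rewrite /= comp1m compm1. Defined.

Definition bal3_comp (k : fieldType) (C D E : tencat k)
  (M : bimod D C) (N : bimod C E) (K : bimod E D) (A : lincat k)
  (F G H : bal3d M N K A) (b : bal3hom G H) (a : bal3hom F G) : bal3hom F H.
Proof.
exists (nt_comp b a) => x m n p.
- by rewrite /= -!compA (b3n_o a) (cA _ (b3n_o b _ _ _ _)) -!compA.
- by rewrite /= -!compA (b3n_i a) (cA _ (b3n_i b _ _ _ _)) -!compA.
- by rewrite /= -!compA (b3n_j a) (cA _ (b3n_j b _ _ _ _)) -!compA.
Defined.

Definition Bal3d (k : fieldType) (C D E : tencat k)
  (M : bimod D C) (N : bimod C E) (K : bimod E D) (A : lincat k) : cat.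
Proof.
refine (@Cat (bal3d M N K A) (@bal3hom k C D E M N K A) (@bal3_id k C D E M N K A)
  (@bal3_comp k C D E M N K A) _ _ _).
- by move=> *; apply: bal3hom_ext => p /=; rewrite compA.
- by move=> *; apply: bal3hom_ext => p /=; rewrite comp1m.
- by move=> *; apply: bal3hom_ext => p /=; rewrite compm1.
Defined.

Record is_bal3 (k : fieldType) (C D E : tencat k)
    (M : bimod D C) (N : bimod C E) (K : bimod E D) (A : lincat k)
    (F : bal3d M N K A) : Prop := IsBal3 {
  b3_rex : lin_rex3 F;
  b3_o : forall n : N, outbal_ax (b3o F n);
  b3_i : forall x : K, innbal_ax (b3i F x);
  b3_j : forall m : M, innbal_ax (b3j F m);
  b3_o_nat : forall (d : D) (m : M) (n n' : N) (x : K) (g : hom n n'),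
    fwd (b3o F n' d m x) ∘ fmap3 F (idm (d ▷ m)) g (idm x) =
    fmap3 F (idm m) g (idm (x ◁ d)) ∘ fwd (b3o F n d m x);
  b3_i_nat : forall (c : C) (m : M) (n : N) (x x' : K) (h : hom x x'),
    fwd (b3i F x' c m n) ∘ fmap3 F (idm (m ◁ c)) (idm n) h =
    fmap3 F (idm m) (idm (c ▷ n)) h ∘ fwd (b3i F x c m n);
  b3_j_nat : forall (e : E) (m m' : M) (n : N) (x : K) (f : hom m m'),
    fwd (b3j F m' e n x) ∘ fmap3 F f (idm (n ◁ e)) (idm x) =
    fmap3 F f (idm n) (idm (e ▷ x)) ∘ fwd (b3j F m e n x);
  b3_compat_oi : forall (d : D) (c : C) (m : M) (n : N) (x : K),
    fwd (b3o F (c ▷ n) d m x) ∘ fwd (b3i F x c (d ▷ m) n) =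
    fwd (b3i F (x ◁ d) c m n) ∘ fwd (b3o F n d (m ◁ c) x) ∘
      fmap3 F (fwd (bmid d m c)) (idm n) (idm x);
  b3_compat_ij : forall (c : C) (e : E) (m : M) (n : N) (x : K),
    fwd (b3i F (e ▷ x) c m n) ∘ fwd (b3j F (m ◁ c) e n x) =
    fwd (b3j F m e (c ▷ n) x) ∘ fmap3 F (idm m) (bwd (bmid c n e)) (idm x) ∘
      fwd (b3i F x c m (n ◁ e));
  b3_compat_oj : forall (d : D) (e : E) (m : M) (n : N) (x : K),
    fmap3 F (idm m) (idm n) (fwd (bmid e x d)) ∘ fwd (b3o F n d m (e ▷ x)) ∘
      fwd (b3j F (d ▷ m) e n x) =
    fwd (b3j F m e n (x ◁ d)) ∘ fwd (b3o F (n ◁ e) d m x)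
}.

(* Fun^{bal,r.e.}(M x N x K, A) *)
Definition Bal3 (k : fieldType) (C D E : tencat k)
    (M : bimod D C) (N : bimod C E) (K : bimod E D) (A : lincat k) : cat :=
  @fullsub (Bal3d M N K A) (@is_bal3 k C D E M N K A).

Definition rot (X Y Z : cat) : functor (Z × X × Y) (X × Y × Z) :=
  @Functor (Z × X × Y) (X × Y × Z) (fun p => ⟨⟨p2 (p1 p), p2 p⟩, p1 (p1 p)⟩)
    (fun _ _ f => ⟨⟨p2 (p1 f), p2 f⟩, p1 (p1 f)⟩) (fun _ => erefl) (fun _ _ _ _ _ => erefl).

Definition rot' (X Y Z : cat) : functor (Y × Z × X) (X × Y × Z) :=
  @Functor (Y × Z × X) (X × Y × Z) (fun p => ⟨⟨p2 p, p1 (p1 p)⟩, p2 (p1 p)⟩)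
    (fun _ _ f => ⟨⟨p2 f, p1 (p1 f)⟩, p2 (p1 f)⟩) (fun _ => erefl) (fun _ _ _ _ _ => erefl).

(* F(m, n, x) regarded as a functor of (x, m, n): the pair M x N is switched *)
(* with K.                                                                  *)
Definition switch21d_ob (k : fieldType) (C D E : tencat k)
    (M : bimod D C) (N : bimod C E) (K : bimod E D) (A : lincat k)
    (F : bal3d M N K A) : bal3d K M N A :=
  @Bal3Data k D E C K M N A (F ∘F rot M N K)
    (fun m e x n => iinv (b3j F m e n x))
    (fun n d x m => iinv (b3o F n d m x))
    (fun x c m n => b3i F x c m n).

(* F(m, n, x) regarded as a functor of (n, x, m): M is switched with the     *)
(* pair N x K.                                                              *)
Definition switch12d_ob (k : fieldType) (C D E : tencat k)
    (M : bimod D C) (N : bimod C E) (K : bimod E D) (A : lincat k)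
    (F : bal3d M N K A) : bal3d N K M A :=
  @Bal3Data k E C D N K M A (F ∘F rot' M N K)
    (fun x c n m => iinv (b3i F x c m n))
    (fun m e n x => b3j F m e n x)
    (fun n d x m => iinv (b3o F n d m x)).

Definition switch21d_hom (k : fieldType) (C D E : tencat k)
  (M : bimod D C) (N : bimod C E) (K : bimod E D) (A : lincat k)
  (F G : bal3d M N K A) (a : bal3hom F G) : bal3hom (switch21d_ob F) (switch21d_ob G).
Proof.
exists (fwhisk (rot M N K) a) => * /=.
- exact: (esym (nat_bwd (esym (b3n_j a _ _ _ _)))).
- exact: (esym (nat_bwd (esym (b3n_o a _ _ _ _)))).
- exact: b3n_i.
Defined.

Definition switch12d_hom (k : fieldType) (C D E : tencat k)
  (M : bimod D C) (N : bimod C E) (K : bimod E D) (A : lincat k)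
  (F G : bal3d M N K A) (a : bal3hom F G) : bal3hom (switch12d_ob F) (switch12d_ob G).
Proof.
exists (fwhisk (rot' M N K) a) => * /=.
- exact: (esym (nat_bwd (esym (b3n_i a _ _ _ _)))).
- exact: b3n_j.
- exact: (esym (nat_bwd (esym (b3n_o a _ _ _ _)))).
Defined.

Definition switch21d (k : fieldType) (C D E : tencat k)
  (M : bimod D C) (N : bimod C E) (K : bimod E D) (A : lincat k) :
  functor (Bal3d M N K A) (Bal3d K M N A).
Proof.
refine (@Functor (Bal3d M N K A) (Bal3d K M N A) (@switch21d_ob k C D E M N K A)
  (@switch21d_hom k C D E M N K A) _ _).
- by move=> F; apply: bal3hom_ext.
- by move=> F G H b a; apply: bal3hom_ext.
Defined.

Definition switch12d (k : fieldType) (C D E : tencat k)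
  (M : bimod D C) (N : bimod C E) (K : bimod E D) (A : lincat k) :
  functor (Bal3d M N K A) (Bal3d N K M A).
Proof.
refine (@Functor (Bal3d M N K A) (Bal3d N K M A) (@switch12d_ob k C D E M N K A)
  (@switch12d_hom k C D E M N K A) _ _).
- by move=> F; apply: bal3hom_ext.
- by move=> F G H b a; apply: bal3hom_ext.
Defined.

Definition i3a (X Y Z W : cat) (F : functor (X × Y × Z) W) (x x' : X) (y : Y) (z : Z)
    (i : iso x x') : iso (F ⟨⟨x, y⟩, z⟩) (F ⟨⟨x', y⟩, z⟩) :=
  imap F (ipr (ipr i (iid y)) (iid z)).

Definition i3b (X Y Z W : cat) (F : functor (X × Y × Z) W) (x : X) (y y' : Y) (z : Z)
    (i : iso y y') : iso (F ⟨⟨x, y⟩, z⟩) (F ⟨⟨x, y'⟩, z⟩) :=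
  imap F (ipr (ipr (iid x) i) (iid z)).

Definition i3c (X Y Z W : cat) (F : functor (X × Y × Z) W) (x : X) (y : Y) (z z' : Z)
    (i : iso z z') : iso (F ⟨⟨x, y⟩, z⟩) (F ⟨⟨x, y⟩, z'⟩) :=
  imap F (ipr (@iid (X × Y) ⟨x, y⟩) i).

Lemma switch21_bal (k : fieldType) (C D E : tencat k)
    (M : bimod D C) (N : bimod C E) (K : bimod E D) (A : lincat k) (F : bal3d M N K A) :
  is_bal3 F -> is_bal3 (switch21d M N K A F).
Proof.
move=> ax; have [[r3 r12] axo axi axj] := ax.
split=> /=.
- split=> [n|x m].
    split=> z; [exact: (r12 z n) | exact: ((r3 z).1 n)].
  exact: ((r3 x).2 m).
- by move=> m; case: (inn_out_ax (axj m)) => a1 a2 a3; split; [exact: a1 | exact: a2 | exact: a3].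
- by move=> n; case: (out_inn_ax (axo n)) => a1 a2 a3; split; [exact: a1 | exact: a2 | exact: a3].
- by move=> x; case: (axi x) => a1 a2 a3; split; [exact: a1 | exact: a2 | exact: a3].
- by move=> *; exact: (nat_bwd (b3_j_nat ax _ _ _ _)).
- by move=> *; exact: (nat_bwd (b3_o_nat ax _ _ _ _)).
- by move=> *; exact: (b3_i_nat ax).
- move=> d c m n x; have := b3_compat_oj ax c d n x m; rewrite -!compA => e.
  apply: (iso_cancel_r (i := icomp (b3o F x c n (d ▷ m)) (b3j F (c ▷ n) d x m))) => /=.
  by rewrite -!compA fwdKA fwdK e !fwdKA fwdK.
- move=> c e m n x; have e1 := b3_compat_oi ax c e n x m.
  apply: (iso_cancel_l (i := b3o F (e ▷ x) c n m)) => /=.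
  rewrite bwdKA -!compA (cA _ e1) -!compA.
  rewrite (bwdKA (i3a F x m (bmid c n e))) bwdK compm1 //.
- move=> d e m n x; have e1 := b3_compat_ij ax e d n x m.
  apply: (iso_cancel_r (i := b3j F (n ◁ e) d x m)).
  rewrite -!compA fwdK compm1 e1 -!compA fwdKA.
  exact: (bwdKA (i3b F n m (bmid e x d))).
Qed.

Lemma switch12_bal (k : fieldType) (C D E : tencat k)
    (M : bimod D C) (N : bimod C E) (K : bimod E D) (A : lincat k) (F : bal3d M N K A) :
  is_bal3 F -> is_bal3 (switch12d M N K A F).
Proof.
move=> ax; have [[r3 r12] axo axi axj _ _ _ _ _ _] := ax.
split=> /=.
- split=> [m|n x].
    split=> z; [exact: ((r3 z).2 m) | exact: (r12 m z)].
  exact: ((r3 x).1 n).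
- by move=> x; case: (inn_out_ax (axi x)) => a1 a2 a3; split; [exact: a1 | exact: a2 | exact: a3].
- by move=> m; case: (axj m) => a1 a2 a3; split; [exact: a1 | exact: a2 | exact: a3].
- by move=> n; case: (out_inn_ax (axo n)) => a1 a2 a3; split; [exact: a1 | exact: a2 | exact: a3].
- by move=> *; exact: (nat_bwd (b3_i_nat ax _ _ _ _)).
- by move=> *; exact: (b3_j_nat ax).
- by move=> *; exact: (nat_bwd (b3_o_nat ax _ _ _ _)).
- move=> c e n x m; have e1 := b3_compat_ij ax c e m n x.
  apply: (iso_cancel_l (i := b3i F (e ▷ x) c m n)) => /=.
  rewrite bwdKA -!compA (cA _ e1) -!compA bwdKA.
  by rewrite (fwdK (i3b F m x (bmid c n e))) compm1.
- move=> e d n x m; have := b3_compat_oj ax d e m n x; rewrite -!compA => e1.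
  apply: (iso_cancel_l (i := b3o F n d m (e ▷ x))) => /=.
  rewrite bwdKA.
  apply: (iso_cancel_l (i := i3c F m n (bmid e x d))) => /=.
  rewrite (cA3 _ e1) -!compA bwdK compm1.
  by rewrite (bwdKA (i3c F m n (bmid e x d))).
- move=> d e m n x; have e1 := b3_compat_oi ax e d x m n.
  apply: (iso_cancel_r (i := icomp (b3o F (d ▷ m) e x n) (b3i F n d (e ▷ x) m))) => /=.
  by rewrite -!compA fwdKA fwdK compm1 e1 -!compA fwdKA fwdKA.
Qed.

Definition switch21 (k : fieldType) (C D E : tencat k)
    (M : bimod D C) (N : bimod C E) (K : bimod E D) (A : lincat k) :
    functor (Bal3 M N K A) (Bal3 K M N A) :=
  restrict (F := switch21d M N K A) (fun F => @switch21_bal k C D E M N K A F).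

Definition switch12 (k : fieldType) (C D E : tencat k)
    (M : bimod D C) (N : bimod C E) (K : bimod E D) (A : lincat k) :
    functor (Bal3 M N K A) (Bal3 N K M A) :=
  restrict (F := switch12d M N K A) (fun F => @switch12_bal k C D E M N K A F).

Lemma fsq (X Y : cat) (F : functor X Y) (w x x' y : X) (g : hom x y) (f : hom w x)
    (g' : hom x' y) (f' : hom w x') :
  g ∘ f = g' ∘ f' -> fmap F g ∘ fmap F f = fmap F g' ∘ fmap F f'.
Proof. by move=> e; rewrite -!fmapM e. Qed.

(* F |-> F(c ▷ m) *)
Definition phi1d_ob (k : fieldType) (C : tencat k) (M : bimod C C) (A : lincat k)
    (F : bal1d M A) : bal2d (regbim C) M A :=
  @Bal2Data k C C (regbim C) M A (F ∘F lact M)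
    (fun b c m => icomp (imap F (bmid c m b))
      (icomp (iinv (b1b F (c ▷ m) b)) (imap F (lassoc b c m))))
    (fun d c m => imap F (lassoc c d m)).

Definition phi1d_hom (k : fieldType) (C : tencat k) (M : bimod C C) (A : lincat k)
  (F G : bal1d M A) (a : bal1hom F G) : bal2hom (phi1d_ob F) (phi1d_ob G).
Proof.
exists (fwhisk (lact M) a) => b c m /=.
- rewrite !compA nt_nat -!compA; congr (_ ∘ _).
  have e := nat_bwd (esym (b1n_bal a (c ▷ m) b)).
  by rewrite !compA -e -!compA nt_nat.
- by rewrite nt_nat.
Defined.

Definition phi1d (k : fieldType) (C : tencat k) (M : bimod C C) (A : lincat k) :
  functor (Bal1d M A) (Bal2d (regbim C) M A).
Proof.
refine (@Functor (Bal1d M A) (Bal2d (regbim C) M A) (@phi1d_ob k C M A)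
  (@phi1d_hom k C M A) _ _).
- by move=> F; apply: bal2hom_ext.
- by move=> F G H b a; apply: bal2hom_ext.
Defined.

Lemma lin_exact_rex (k : fieldType) (A B : lincat k) (F : functor A B) :
  lin_exact F -> lin_rex F.
Proof. by case. Qed.

Lemma phi1_bal (k : fieldType) (C : tencat k) (M : bimod C C) (A : lincat k)
    (F : bal1d M A) : is_bal1 F -> is_bal2 (phi1d M A F).
Proof.
move=> ax; have axM := b_ax M; split.
- split=> x.
  + exact: (lin_rex_comp (b1_rex ax) (lin_exact_rex ((lact_exact axM).1 x))).
  + exact: (lin_rex_comp (b1_rex ax) (lin_exact_rex ((lact_exact axM).2 x))).
- split.
  + move=> b b' c c' m m' u f h /=.
    rewrite -!compA (fsq F (lassoc_nat axM _ _ _)).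
    rewrite (cA _ (nat_bwd (b1_nat ax (f ▷m h) u))) -!compA.
    by rewrite (cA _ (fsq F (bmid_nat axM _ _ _))) -!compA.
  + move=> b b' c m /=.
    have pb : bwd (b1b F (c ▷ m) (b ⊗ b')) = fmap F (bwd (rassoc (c ▷ m) b b')) ∘
      (bwd (b1b F ((c ▷ m) ◁ b) b') ∘ (fmap F (fwd (bmid b' (c ▷ m) b)) ∘
      (bwd (b1b F (b' ▷ (c ▷ m)) b) ∘ fmap F (fwd (lassoc b b' (c ▷ m)))))).
      apply: (iso_cancel_r (i := b1b F (c ▷ m) (b ⊗ b'))).
      rewrite -!compA fwdK (b1_pentagon ax) -!compA fwdKA.
      rewrite (bwdKA (imap F (bmid b' (c ▷ m) b))) fwdKA.
      by rewrite (fwdK (imap F (rassoc (c ▷ m) b b'))).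
    have e1 : fmap F (idm c ▷m fwd (rassoc m b b')) ∘ (fmap F (fwd (bmid c m (b ⊗ b'))) ∘
       fmap F (bwd (rassoc (c ▷ m) b b'))) =
       fmap F (fwd (bmid c (m ◁ b) b')) ∘ fmap F (fwd (bmid c m b) ◁m idm b').
      rewrite -!fmapM; congr (fmap F _); rewrite compA (rmid_pentagon axM) -compA bwdK.
      by rewrite compm1.
    have e2 := nat_bwd (b1_nat ax (fwd (bmid c m b)) (idm b')).
    have e3 : fmap F (idm b' ▷m fwd (bmid c m b)) ∘ fmap F (fwd (bmid b' (c ▷ m) b)) =
       fmap F (fwd (lassoc b' c (m ◁ b))) ∘ (fmap F (fwd (bmid (b' ⊗ c) m b)) ∘
       fmap F (bwd (lassoc b' c m) ◁m idm b)).
      rewrite -!fmapM; congr (fmap F _); rewrite compA.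
      apply: (iso_cancel_r (i := il (ract M) b (lassoc b' c m))) => /=.
      by rewrite (lmid_pentagon axM) -compA -f2l fwdK f21 compm1.
    have e4 := nat_bwd (b1_nat ax (bwd (lassoc b' c m)) (idm b)).
    have e5 : fmap F (idm b ▷m bwd (lassoc b' c m)) ∘
        (fmap F (fwd (lassoc b b' (c ▷ m))) ∘ fmap F (fwd (lassoc (b ⊗ b') c m))) =
        fmap F (fwd (lassoc b (b' ⊗ c) m)) ∘ fmap F (fwd (tassoc b b' c) ▷m idm m).
      rewrite -!fmapM; congr (fmap F _).
      apply: (iso_cancel_l (i := ir (lact M) b (lassoc b' c m))) => /=.
      by rewrite (l_pentagon axM) -!compA (cA _ (esym (f2r _ _ _ _))) bwdK f21 comp1m.
    rewrite pb -!compA (cA3 _ e1) -!compA (cA _ (esym e2)) -!compA (cA _ e3) -!compA.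
    by rewrite (cA _ (esym e4)) -!compA e5.
  + move=> c m /=.
    rewrite (cA _ (esym (fmapM F _ _))) runitM.
    have e : fmap F (fwd (runit (c ▷ m))) ∘ bwd (b1b F (c ▷ m) (tone C)) =
        fmap F (fwd (lunit (c ▷ m))).
      by rewrite -(b1_triangle ax) -compA bwdK compm1.
    by rewrite (cA _ e) -fmapM lunitM.
- split.
  + by move=> d d' c c' m m' u f h /=; rewrite (fsq F (lassoc_nat axM _ _ _)).
  + move=> d d' c m /=; rewrite -!fmapM; congr (fmap F _).
    rewrite (l_pentagon axM) -!compA -f2l bwdK f21 compm1 //.
  + by move=> c m /=; rewrite -fmapM (l_triangle axM).
- move=> b d c m /=.
  have e1 : fmap F (fwd (lassoc c d (m ◁ b))) ∘ fmap F (fwd (bmid (c ⊗ d) m b)) =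
      fmap F (idm c ▷m fwd (bmid d m b)) ∘ (fmap F (fwd (bmid c (d ▷ m) b)) ∘
      fmap F (fwd (lassoc c d m) ◁m idm b)).
    by rewrite -!fmapM -(lmid_pentagon axM) -!compA.
  have e2 := nat_bwd (b1_nat ax (fwd (lassoc c d m)) (idm b)).
  have e3 : fmap F (idm b ▷m fwd (lassoc c d m)) ∘ (fmap F (fwd (lassoc b (c ⊗ d) m)) ∘
      fmap F (fwd (tassoc b c d) ▷m idm m)) =
      fmap F (fwd (lassoc b c (d ▷ m))) ∘ fmap F (fwd (lassoc (b ⊗ c) d m)).
    by rewrite -!fmapM (l_pentagon axM) -!compA.
  rewrite -!compA (cA _ e1) -!compA (cA _ (esym e2)) -!compA.
  by rewrite e3.
Qed.

(* G |-> G(m x 1) *)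
Definition phi2d_ob (k : fieldType) (C : tencat k) (M : bimod C C) (A : lincat k)
    (G : bal2d M (regbim C) A) : bal1d M A :=
  @Bal1Data k C M A (G ∘F @insl M (regbim C) (tone C))
    (fun m c => icomp (iinv (b2o G c m (tone C)))
      (icomp (ir G m (icomp (iinv (tlun c)) (trun c))) (b2i G c m (tone C)))).

Definition phi2d_hom (k : fieldType) (C : tencat k) (M : bimod C C) (A : lincat k)
  (F G : bal2d M (regbim C) A) (a : bal2hom F G) : bal1hom (phi2d_ob F) (phi2d_ob G).
Proof.
exists (fwhisk (@insl M (regbim C) (tone C)) a) => m c /=.
rewrite -!compA -(b2n_inn a) (cA _ (esym (nt_nat a _))) -!compA.
by rewrite (cA _ (nat_bwd (esym (b2n_out a c m (tone C))))) -!compA.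
Defined.

Definition phi2d (k : fieldType) (C : tencat k) (M : bimod C C) (A : lincat k) :
  functor (Bal2d M (regbim C) A) (Bal1d M A).
Proof.
refine (@Functor (Bal2d M (regbim C) A) (Bal1d M A) (@phi2d_ob k C M A)
  (@phi2d_hom k C M A) _ _).
- by move=> F; apply: bal1hom_ext.
- by move=> F G H b a; apply: bal1hom_ext.
Defined.

Lemma tswitch (k : fieldType) (C : tendata k) (monC : is_monoidal C) (c d : C) :
  bwd (tassoc (tone C) c d) ∘ (bwd (tlun (c ⊗ d)) ∘ fwd (trun (c ⊗ d))) ∘
    bwd (tassoc c d (tone C)) =
  ((bwd (tlun c) ∘ fwd (trun c)) ⊗m idm d) ∘ bwd (tassoc c (tone C) d) ∘
    (idm c ⊗m (bwd (tlun d) ∘ fwd (trun d))).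
Proof.
have e1 : fwd (trun (c ⊗ d)) ∘ bwd (tassoc c d (tone C)) = idm c ⊗m fwd (trun d).
  by rewrite -(trunM monC) -compA bwdK compm1.
have e2 : bwd (tassoc (tone C) c d) ∘ bwd (tlun (c ⊗ d)) = bwd (tlun c) ⊗m idm d.
  apply: (iso_cancel_l (i := il (tens C) d (tlun c))) => /=.
  by rewrite -f2l bwdK f21 -(tlunM monC) -!compA bwdKA bwdK.
rewrite -!compA e1 (cA _ e2) f2l f2r -(t_triangle monC) -!compA bwdKA.
by rewrite (cA _ (esym (f2r _ _ _ _))) bwdK f21 comp1m.
Qed.

Lemma phi2_bal (k : fieldType) (C : tencat k) (M : bimod C C) (A : lincat k)
    (G : bal2d M (regbim C) A) : is_bal2 G -> is_bal1 (phi2d M A G).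
Proof.
move=> ax; have axM := b_ax M; have monC := ten_mon (t_ax C).
have [axo axi] := (b2_out ax, b2_inn ax).
split.
- exact: ((b2_rex ax).1 (tone C)).
- move=> x x' c c' f u /=.
  have e1 := inn_nat axi u f (idm (tone C)).
  have e2 := nat_bwd (out_nat axo u f (idm (tone C))).
  have e3 : fmap2 G (idm x') (bwd (tlun c') ∘ fwd (trun c')) ∘
      fmap2 G f (u ⊗m idm (tone C)) =
      fmap2 G f (idm (tone C) ⊗m u) ∘ fmap2 G (idm x) (bwd (tlun c) ∘ fwd (trun c)).
    rewrite !f2M comp1m compm1; congr (fmap2 G _ _).
    by rewrite -compA (trun_nat monC) compA (nat_bwd (tlun_nat monC u)) compA.
  rewrite -!compA e1 (cA _ e3) -!compA.
  by rewrite (cA _ e2) -!compA.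
- move=> x c d /=.
  have o1 : fmap2 G (fwd (lassoc c d x)) (idm (tone C)) ∘ bwd (b2o G (c ⊗ d) x (tone C)) =
      bwd (b2o G c (d ▷ x) (tone C)) ∘ (bwd (b2o G d x (tone C ⊗ c)) ∘
      fmap2 G (idm x) (bwd (tassoc (tone C) c d))).
    apply: (iso_cancel_r (i := b2o G (c ⊗ d) x (tone C))).
    rewrite -!compA fwdK compm1 (out_pentagon axo) -!compA fwdKA.
    by rewrite fwdKA.
  have i1 : fwd (b2i G (c ⊗ d) x (tone C)) = fmap2 G (idm x) (bwd (tassoc c d (tone C))) ∘
      (fwd (b2i G c x (d ⊗ tone C)) ∘ (fwd (b2i G d (x ◁ c) (tone C)) ∘
      fmap2 G (fwd (rassoc x c d)) (idm (tone C)))).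
    apply: (iso_cancel_l (i := ir G x (tassoc c d (tone C)))).
    rewrite (inn_pentagon axi) -!compA.
    by rewrite (bwdKA (ir G x (tassoc c d (tone C)))).
  have c1 : fwd (b2i G c (d ▷ x) (tone C)) ∘ (fmap2 G (bwd (bmid d x c)) (idm (tone C)) ∘
      bwd (b2o G d (x ◁ c) (tone C))) =
      bwd (b2o G d x (c ⊗ tone C)) ∘ (fmap2 G (idm x) (bwd (tassoc c (tone C) d)) ∘
      fwd (b2i G c x (tone C ⊗ d))).
    apply: (iso_cancel_l (i := b2o G d x (c ⊗ tone C))).
    apply: (iso_cancel_l (i := ir G x (tassoc c (tone C) d))).
    rewrite bwdKA (bwdKA (ir G x (tassoc c (tone C) d))).
    have := b2_compat ax d c x (tone C); rewrite -!compA => e.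
    rewrite (cA3 _ e) -!compA (bwdKA (il G (tone C) (bmid d x c))).
    by rewrite bwdK compm1.
  have i2 := inn_nat axi (idm c) (idm x) (bwd (tlun d) ∘ fwd (trun d)).
  rewrite f21 in i2.
  have o2 := nat_bwd (out_nat axo (idm d) (idm x) (bwd (tlun c) ∘ fwd (trun c))).
  rewrite f21 in o2.
  have t : fmap2 G (idm x) (bwd (tassoc (tone C) c d)) ∘
      (fmap2 G (idm x) (bwd (tlun (c ⊗ d)) ∘ fwd (trun (c ⊗ d))) ∘
      fmap2 G (idm x) (bwd (tassoc c d (tone C)))) =
      fmap2 G (idm x) ((bwd (tlun c) ∘ fwd (trun c)) ⊗m idm d) ∘
      (fmap2 G (idm x) (bwd (tassoc c (tone C) d)) ∘
      fmap2 G (idm x) (idm c ⊗m (bwd (tlun d) ∘ fwd (trun d)))).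
    by rewrite -!f2r compA (tswitch monC) -!compA.
  rewrite i1 -!compA (cA _ o1) -!compA.
  rewrite (cA3 _ c1) -!compA.
  rewrite (cA _ i2) -!compA (cA _ (esym o2)) -!compA.
  by rewrite (cA3 _ t) -!compA.
- move=> x /=.
  have o1 : fmap2 G (fwd (lunit x)) (idm (tone C)) ∘ bwd (b2o G (tone C) x (tone C)) =
      fmap2 G (idm x) (fwd (trun (tone C))).
    by rewrite -(out_triangle axo) -compA bwdK compm1.
  rewrite (cA _ o1) (cA _ (esym (f2r G _ _ _))) -(tlun_trun1 monC) bwdKA.
  exact: (inn_triangle axi).
Qed.

Definition phi1 (k : fieldType) (C : tencat k) (M : bimod C C) (A : lincat k) :
    functor (Bal1 M A) (Bal2 (regbim C) M A) :=
  restrict (F := phi1d M A) (fun F => @phi1_bal k C M A F).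

Definition phi2 (k : fieldType) (C : tencat k) (M : bimod C C) (A : lincat k) :
    functor (Bal2 M (regbim C) A) (Bal1 M A) :=
  restrict (F := phi2d M A) (fun G => @phi2_bal k C M A G).

Record bimfun (k : fieldType) (C D : tencat k) (P Q : bimod C D) := BimFun {
  bf :> functor P Q;
  bf_rex : lin_rex bf;
  bf_l : forall (c : C) (x : P), iso (bf (c ▷ x)) (c ▷ bf x);
  bf_r : forall (d : D) (x : P), iso (bf (x ◁ d)) (bf x ◁ d);
  bf_l_nat : forall (c c' : C) (x x' : P) (u : hom c c') (f : hom x x'),
    fwd (bf_l c' x') ∘ fmap bf (u ▷m f) = (u ▷m fmap bf f) ∘ fwd (bf_l c x);
  bf_r_nat : forall (d d' : D) (x x' : P) (u : hom d d') (f : hom x x'),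
    fwd (bf_r d' x') ∘ fmap bf (f ◁m u) = (fmap bf f ◁m u) ∘ fwd (bf_r d x);
  bf_l_assoc : forall (c c' : C) (x : P),
    fwd (lassoc c c' (bf x)) ∘ fwd (bf_l (c ⊗ c') x) =
    (idm c ▷m fwd (bf_l c' x)) ∘ fwd (bf_l c (c' ▷ x)) ∘ fmap bf (fwd (lassoc c c' x));
  bf_l_unit : forall x : P,
    fwd (lunit (bf x)) ∘ fwd (bf_l (tone C) x) = fmap bf (fwd (lunit x));
  bf_r_assoc : forall (d d' : D) (x : P),
    fwd (rassoc (bf x) d d') ∘ fwd (bf_r (d ⊗ d') x) =
    (fwd (bf_r d x) ◁m idm d') ∘ fwd (bf_r d' (x ◁ d)) ∘ fmap bf (fwd (rassoc x d d'));
  bf_r_unit : forall x : P,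
    fwd (runit (bf x)) ∘ fwd (bf_r (tone D) x) = fmap bf (fwd (runit x));
  bf_mid : forall (c : C) (d : D) (x : P),
    fwd (bmid c (bf x) d) ∘ (fwd (bf_l c x) ◁m idm d) ∘ fwd (bf_r d (c ▷ x)) =
    (idm c ▷m fwd (bf_r d x)) ∘ fwd (bf_l c (x ◁ d)) ∘ fmap bf (fwd (bmid c x d))
}.

(* The associator M ⊠ (N ⊠ K) -> (M ⊠ N) ⊠ K of relative tensor products:   *)
(* the bimodule functor induced by the universal property, i.e. it comes    *)
(* with an isomorphism on the generating objects that is compatible with    *)
(* both balancings and with both outer actions.                             *)
Record associator (k : fieldType) (C1 C2 C3 C4 : tencat k)
    (M : bimod C1 C2) (N : bimod C2 C3) (K : bimod C3 C4)
    (NK : reltensor N K) (R : reltensor M NK)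
    (MN : reltensor M N) (L : reltensor MN K) := Associator {
  as_fun :> bimfun R L;
  as_iso : forall (m : M) (n : N) (x : K),
    iso (as_fun (so (rt_B R) ⟨m, so (rt_B NK) ⟨n, x⟩⟩))
        (so (rt_B L) ⟨so (rt_B MN) ⟨m, n⟩, x⟩);
  as_nat : forall (m m' : M) (n n' : N) (x x' : K)
      (f : hom m m') (g : hom n n') (h : hom x x'),
    fwd (as_iso m' n' x') ∘
      fmap as_fun (fmap2 (so (rt_B R)) f (fmap2 (so (rt_B NK)) g h)) =
    fmap2 (so (rt_B L)) (fmap2 (so (rt_B MN)) f g) h ∘ fwd (as_iso m n x);
  as_bal2 : forall (c : C2) (m : M) (n : N) (x : K),
    fwd (as_iso m (c ▷ n) x) ∘
      fmap as_fun (fmap2 (so (rt_B R)) (idm m) (bwd (rt_l NK c n x))) ∘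
      fmap as_fun (fwd (bRi (so (rt_B R)) c m (so (rt_B NK) ⟨n, x⟩))) =
    fmap2 (so (rt_B L)) (fwd (bRi (so (rt_B MN)) c m n)) (idm x) ∘
      fwd (as_iso (m ◁ c) n x);
  as_bal3 : forall (e : C3) (m : M) (n : N) (x : K),
    fwd (as_iso m n (e ▷ x)) ∘
      fmap as_fun (fmap2 (so (rt_B R)) (idm m) (fwd (bRi (so (rt_B NK)) e n x))) =
    fwd (bRi (so (rt_B L)) e (so (rt_B MN) ⟨m, n⟩) x) ∘
      fmap2 (so (rt_B L)) (fwd (rt_r MN e m n)) (idm x) ∘ fwd (as_iso m (n ◁ e) x);
  as_l : forall (c : C1) (m : M) (n : N) (x : K),
    (idm c ▷m fwd (as_iso m n x)) ∘ fwd (bf_l as_fun c _) ∘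
      fmap as_fun (fwd (rt_l R c m (so (rt_B NK) ⟨n, x⟩))) =
    fwd (rt_l L c (so (rt_B MN) ⟨m, n⟩) x) ∘
      fmap2 (so (rt_B L)) (fwd (rt_l MN c m n)) (idm x) ∘ fwd (as_iso (c ▷ m) n x);
  as_r : forall (d : C4) (m : M) (n : N) (x : K),
    (fwd (as_iso m n x) ◁m idm d) ∘ fwd (bf_r as_fun d _) ∘
      fmap as_fun (fwd (rt_r R d m (so (rt_B NK) ⟨n, x⟩))) ∘
      fmap as_fun (fmap2 (so (rt_B R)) (idm m) (fwd (rt_r NK d n x))) =
    fwd (rt_r L d (so (rt_B MN) ⟨m, n⟩) x) ∘ fwd (as_iso m n (x ◁ d))
}.

(* The unit equivalences C ⊠ M -> M and M ⊠ D -> M, induced by the left and  *)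
(* the right action, respectively.                                          *)
Record lunitor (k : fieldType) (C D : tencat k) (M : bimod C D)
    (P : reltensor (regbim C) M) := LUnitor {
  lu_fun :> bimfun P M;
  lu_iso : forall (c : C) (m : M), iso (lu_fun (so (rt_B P) ⟨c, m⟩)) (c ▷ m);
  lu_nat : forall (c c' : C) (m m' : M) (u : hom c c') (f : hom m m'),
    fwd (lu_iso c' m') ∘ fmap lu_fun (fmap2 (so (rt_B P)) u f) =
    (u ▷m f) ∘ fwd (lu_iso c m);
  lu_bal : forall (d c : C) (m : M),
    fwd (lu_iso c (d ▷ m)) ∘ fmap lu_fun (fwd (bRi (so (rt_B P)) d c m)) =
    fwd (lassoc c d m) ∘ fwd (lu_iso (c ⊗ d) m);
  lu_l : forall (b c : C) (m : M),
    (idm b ▷m fwd (lu_iso c m)) ∘ fwd (bf_l lu_fun b _) ∘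
      fmap lu_fun (fwd (rt_l P b c m)) =
    fwd (lassoc b c m) ∘ fwd (lu_iso (b ⊗ c) m);
  lu_r : forall (d : D) (c : C) (m : M),
    fwd (bmid c m d) ∘ (fwd (lu_iso c m) ◁m idm d) ∘ fwd (bf_r lu_fun d _) ∘
      fmap lu_fun (fwd (rt_r P d c m)) =
    fwd (lu_iso c (m ◁ d))
}.

Record runitor (k : fieldType) (C D : tencat k) (M : bimod C D)
    (P : reltensor M (regbim D)) := RUnitor {
  ru_fun :> bimfun P M;
  ru_iso : forall (m : M) (d : D), iso (ru_fun (so (rt_B P) ⟨m, d⟩)) (m ◁ d);
  ru_nat : forall (m m' : M) (d d' : D) (f : hom m m') (u : hom d d'),
    fwd (ru_iso m' d') ∘ fmap ru_fun (fmap2 (so (rt_B P)) f u) =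
    (f ◁m u) ∘ fwd (ru_iso m d);
  ru_bal : forall (e d : D) (m : M),
    fwd (rassoc m e d) ∘ fwd (ru_iso m (e ⊗ d)) ∘
      fmap ru_fun (fwd (bRi (so (rt_B P)) e m d)) =
    fwd (ru_iso (m ◁ e) d);
  ru_l : forall (c : C) (m : M) (d : D),
    (idm c ▷m fwd (ru_iso m d)) ∘ fwd (bf_l ru_fun c _) ∘
      fmap ru_fun (fwd (rt_l P c m d)) =
    fwd (bmid c m d) ∘ fwd (ru_iso (c ▷ m) d);
  ru_r : forall (e d : D) (m : M),
    (fwd (ru_iso m d) ◁m idm e) ∘ fwd (bf_r ru_fun e _) ∘
      fmap ru_fun (fwd (rt_r P e m d)) =
    fwd (rassoc m d e) ∘ fwd (ru_iso m (d ⊗ e))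
}.

Definition pullbf (k : fieldType) (C : tencat k) (P Q : bimod C C) (f : bimfun P Q)
    (A : lincat k) (F : bal1d Q A) : bal1d P A :=
  @Bal1Data k C P A (F ∘F f)
    (fun x c => icomp (imap F (iinv (bf_l f c x)))
      (icomp (b1b F (f x) c) (imap F (bf_r f c x)))).

(* The functor Tr(f) induced on traces by a bimodule functor f. *)
Record trmap (k : fieldType) (C : tencat k) (P Q : bimod C C) (f : bimfun P Q)
    (T : cvtrace P) (S : cvtrace Q) := TrMap {
  tm_fun :> functor T S;
  tm_rex : lin_rex tm_fun;
  tm_iso : @iso (Bal1d P S) (post1d_ob (so (tr_B T)) tm_fun) (pullbf f (so (tr_B S)))
}.

(* The multi-balanced functor on M x N corresponding to a balanced functor  *)
(* on the relative tensor product.                                          *)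
Definition pull2 (k : fieldType) (C D : tencat k) (M : bimod C D) (N : bimod D C)
    (P : reltensor M N) (A : lincat k) (F : bal1d P A) : bal2d M N A :=
  @Bal2Data k C D M N A (F ∘F so (rt_B P))
    (fun c m n => icomp (imap F (iinv (rt_r P c m n)))
      (icomp (iinv (b1b F (so (rt_B P) ⟨m, n⟩) c)) (imap F (rt_l P c m n))))
    (fun d m n => imap F (bRi (so (rt_B P)) d m n)).

Definition univ2 (k : fieldType) (C D : tencat k) (M : bimod C D) (N : bimod D C)
    (P : reltensor M N) (T : cvtrace P) : bal2d M N T :=
  pull2 (so (tr_B T)).

(* A right exact functor Tr_C(M ⊠ N) -> Tr_D(N ⊠ M) induced by the switch    *)
(* functor: the one that corresponds to the multi-balanced functor on M x N *)
(* obtained by switching the arguments of the universal one on N x M.       *)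
Record cyc (k : fieldType) (C D : tencat k) (M : bimod C D) (N : bimod D C)
    (P : reltensor M N) (T : cvtrace P) (Q : reltensor N M) (S : cvtrace Q) := Cyc {
  cyc_fun :> functor T S;
  cyc_rex : lin_rex cyc_fun;
  cyc_iso : @iso (Bal2d M N S) (post2d_ob (univ2 T) cyc_fun) (switchd N M S (univ2 S))
}.

Notation "F ≅ G" := (@iso (Funct _ _) F G) (at level 70, no associativity) : tcat_scope.

(* The components of natural isomorphisms. *)
Definition nti (X Y : cat) (F G : functor X Y) (w : F ≅ G) (x : X) : hom (F x) (G x) :=
  nt (fwd w) x.

Definition cyc_th (k : fieldType) (C D : tencat k) (M : bimod C D) (N : bimod D C)
    (P : reltensor M N) (T : cvtrace P) (Q : reltensor N M) (S : cvtrace Q)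
    (F : cyc T S) (m : M) (n : N) : hom (F (univ2 T ⟨m, n⟩)) (univ2 S ⟨n, m⟩) :=
  nt (b2n (fwd (cyc_iso F))) ⟨m, n⟩.

Definition tm_th (k : fieldType) (C : tencat k) (P Q : bimod C C) (f : bimfun P Q)
    (T : cvtrace P) (S : cvtrace Q) (t : trmap f T S) (x : P) :
    hom (t (so (tr_B T) x)) (so (tr_B S) (f x)) :=
  nt (b1n (fwd (tm_iso t))) x.

(* Tr(α) for the associator α, on the images of the generating objects.      *)
Definition as_th (k : fieldType) (C1 C2 C3 : tencat k)
    (M : bimod C1 C2) (N : bimod C2 C3) (K : bimod C3 C1)
    (NK : reltensor N K) (R : reltensor M NK) (MN : reltensor M N) (L : reltensor MN K)
    (a : associator R L) (T : cvtrace R) (S : cvtrace L) (t : trmap a T S)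
    (m : M) (n : N) (x : K) :
    hom (t (univ2 T ⟨m, so (rt_B NK) ⟨n, x⟩⟩)) (univ2 S ⟨so (rt_B MN) ⟨m, n⟩, x⟩) :=
  fmap (so (tr_B S)) (fwd (as_iso a m n x)) ∘
    tm_th t (so (rt_B R) ⟨m, so (rt_B NK) ⟨n, x⟩⟩).

(* Main.v *)
(* The universal properties of [⊠] and [Tr] combine: right exact functors   *)
(* Tr(M ⊠ N) -> A are the same as right exact multi-balanced functors        *)
(* M x N -> A.  The delicate half is to produce the outer balancing of a     *)
(* functor on M ⊠ N; it is extended from the generating objects by full      *)
(* faithfulness of restriction along M x N -> M ⊠ N, which also reduces all  *)
(* its axioms to the generating objects.  Hence natural transformations      *)
(* between right exact functors on a trace are families on generating        *)
(* objects that respect naturality and the balancings, and (ii), (iii) and   *)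
(* (iv) follow by composing such families: the components of an induced      *)
(* functor, of the associators and of the unit equivalences are each         *)
(* morphisms of multi-balanced functors, up to switching arguments.          *)

From Pilot Require Import Defs.
From mathcomp Require Import all_boot all_algebra.
From Stdlib Require Import FunctionalExtensionality ProofIrrelevance.
(* Names such as [comp] and [compA] are shadowed by mathcomp otherwise. *)
Import Pilot.Defs.

Set Implicit Arguments.
Unset Strict Implicit.
Unset Printing Implicit Defensive.

Local Open Scope tcat_scope.

(** * Universal properties of relative tensor products and traces *)

Lemma iso_ext (X : cat) (x y : X) (i j : iso x y) : fwd i = fwd j -> i = j.
Proof.
case: i j => [f g fg gf] [f' g' fg' gf'] /= e.
have {}e' : g = g' by rewrite -(compm1 g) -fg' compA -e gf comp1m.
case: _ / e in fg' gf' *; case: _ / e' in fg' gf' *.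
by congr Iso; apply: proof_irrelevance.
Qed.

Lemma adj_equiv_faithful (X Y : cat) (F : functor X Y) (e : adj_equiv F) (x y : X)
    (f g : hom x y) : fmap F f = fmap F g -> f = g.
Proof.
move=> Efg.
have nat (h : hom x y) := nt_nat (fwd (ae_unit e)) h; rewrite /= in nat.
have K : nt (bwd (ae_unit e)) y ∘ nt (fwd (ae_unit e)) y = idm y.
  exact: (congr1 (fun a : nat_trans _ _ => nt a y) (fwdK (ae_unit e))).
by rewrite -(comp1m f) -(comp1m g) -K -!compA nat Efg -nat.
Qed.

Lemma adj_equiv_full (X Y : cat) (F : functor X Y) (e : adj_equiv F) (x y : X)
    (g : hom (F x) (F y)) : {f : hom x y | fmap F f = g}.
Proof.
have Ky : nt (bwd (ae_unit e)) y ∘ nt (fwd (ae_unit e)) y = idm y.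
  exact: (congr1 (fun a : nat_trans _ _ => nt a y) (fwdK (ae_unit e))).
have Ky' : nt (fwd (ae_unit e)) y ∘ nt (bwd (ae_unit e)) y = idm _.
  exact: (congr1 (fun a : nat_trans _ _ => nt a y) (bwdK (ae_unit e))).
exists (nt (bwd (ae_unit e)) y ∘ fmap (ae_inv e) g ∘ nt (fwd (ae_unit e)) x).
have c : nt (fwd (ae_counit e)) (F y) = fmap F (nt (bwd (ae_unit e)) y).
  rewrite -[LHS]compm1 -[X in _ ∘ X](fmap1 F) -Ky' fmapM compA ae_zig.
  by rewrite comp1m.
rewrite !fmapM -c.
have /= -> := nt_nat (fwd (ae_counit e)) g.
by rewrite -compA ae_zig compm1.
Qed.

Lemma adj_equiv_surj (X Y : cat) (F : functor X Y) (e : adj_equiv F) (y : Y) :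
  exists x, inhabited (iso (F x) y).
Proof.
exists (ae_inv e y); constructor.
exists (nt (fwd (ae_counit e)) y) (nt (bwd (ae_counit e)) y).
- exact: (congr1 (fun a : nat_trans _ _ => nt a y) (bwdK (ae_counit e))).
- exact: (congr1 (fun a : nat_trans _ _ => nt a y) (fwdK (ae_counit e))).
Qed.

Section Universal.
Variables (k : fieldType) (C D E : tencat k).

Lemma tr_full (X : bimod C C) (T : cvtrace X) (A : lincat k) (H H' : functor T A) :
  lin_rex H -> lin_rex H' ->
  forall a : bal1hom (post1d_ob (so (tr_B T)) H) (post1d_ob (so (tr_B T)) H'),
  {w : nat_trans H H' | forall x, w (so (tr_B T) x) = a x}.
Proof.
move=> rH rH' a.
have [w Ew] := @adj_equiv_full _ _ _ (tr_univ T A) (SubOb rH) (SubOb rH') a.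
by exists w => x; rewrite -Ew.
Qed.

Lemma tr_faithful (X : bimod C C) (T : cvtrace X) (A : lincat k) (H H' : functor T A) :
  lin_rex H -> lin_rex H' -> forall w w' : nat_trans H H',
  (forall x, w (so (tr_B T) x) = w' (so (tr_B T) x)) -> w = w'.
Proof.
move=> rH rH' w w' Ew.
apply: (@adj_equiv_faithful _ _ _ (tr_univ T A) (SubOb rH) (SubOb rH') w w').
by apply: bal1hom_ext => x; apply: Ew.
Qed.

Lemma tr_surj (X : bimod C C) (T : cvtrace X) (A : lincat k) (F : bal1d X A) :
  is_bal1 F -> exists2 H : functor T A, lin_rex H &
    inhabited (@iso (Bal1d X A) (post1d_ob (so (tr_B T)) H) F).
Proof.
move=> axF; have [[H rH] [i]] := @adj_equiv_surj _ _ _ (tr_univ T A) (SubOb axF).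
exists H => //; constructor.
by exists (fwd i) (bwd i); [exact: (bwdK i) | exact: (fwdK i)].
Qed.

Lemma rt_full (M : bimod C D) (N : bimod D E) (P : reltensor M N) (A : lincat k)
    (H H' : functor (rt_bim P) A) :
  lin_rex H -> lin_rex H' ->
  forall a : balRhom (postRd_ob (so (rt_B P)) H) (postRd_ob (so (rt_B P)) H'),
  {w : nat_trans H H' | forall p, w (so (rt_B P) p) = a p}.
Proof.
move=> rH rH' a.
have [w Ew] := @adj_equiv_full _ _ _ (rt_univ P A) (SubOb rH) (SubOb rH') a.
by exists w => x; rewrite -Ew.
Qed.

Lemma rt_faithful (M : bimod C D) (N : bimod D E) (P : reltensor M N) (A : lincat k)
    (H H' : functor (rt_bim P) A) :
  lin_rex H -> lin_rex H' -> forall w w' : nat_trans H H',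
  (forall p, w (so (rt_B P) p) = w' (so (rt_B P) p)) -> w = w'.
Proof.
move=> rH rH' w w' Ew.
apply: (@adj_equiv_faithful _ _ _ (rt_univ P A) (SubOb rH) (SubOb rH') w w').
by apply: balRhom_ext => x; apply: Ew.
Qed.

Lemma rt_surj (M : bimod C D) (N : bimod D E) (P : reltensor M N) (A : lincat k)
    (F : balRd M N A) :
  is_balR F -> exists2 H : functor (rt_bim P) A, lin_rex H &
    inhabited (@iso (BalRd M N A) (postRd_ob (so (rt_B P)) H) F).
Proof.
move=> axF; have [[H rH] [i]] := @adj_equiv_surj _ _ _ (rt_univ P A) (SubOb axF).
exists H => //; constructor.
by exists (fwd i) (bwd i); [exact: (bwdK i) | exact: (fwdK i)].
Qed.

End Universal.

Lemma iso_cancel2 (X : cat) (w x y z : X) (i : iso y z) (j : iso w x) (f g : hom x y) :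
  fwd i ∘ (f ∘ fwd j) = fwd i ∘ (g ∘ fwd j) -> f = g.
Proof. by move=> /iso_cancel_l /iso_cancel_r. Qed.

Definition funct_iso (X Y : cat) (F G : functor X Y) (i : forall x, iso (F x) (G x))
  (Hi : forall x y (f : hom x y), fwd (i y) ∘ fmap F f = fmap G f ∘ fwd (i x)) : F ≅ G.
Proof.
exists (@NatTrans X Y F G (fun x => fwd (i x)) Hi)
  (@NatTrans X Y G F (fun x => bwd (i x)) (fun x y f => nat_bwd (Hi x y f))).
- by apply: nt_ext => x; exact: bwdK.
- by apply: nt_ext => x; exact: fwdK.
Defined.

Lemma nt_bwdK (X Y : cat) (F G : functor X Y) (i : F ≅ G) x :
  nt (fwd i) x ∘ nt (bwd i) x = idm (G x).
Proof. exact: (congr1 (fun a : nat_trans _ _ => nt a x) (bwdK i)). Qed.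

Lemma nt_fwdK (X Y : cat) (F G : functor X Y) (i : F ≅ G) x :
  nt (bwd i) x ∘ nt (fwd i) x = idm (F x).
Proof. exact: (congr1 (fun a : nat_trans _ _ => nt a x) (fwdK i)). Qed.

Definition funct_iso_at (X Y : cat) (F G : functor X Y) (i : F ≅ G) (x : X) :
  iso (F x) (G x) := Iso (nt (fwd i) x) (nt (bwd i) x) (nt_bwdK i x) (nt_fwdK i x).

Section RelTensor.
Variables (k : fieldType) (C D E : tencat k) (M : bimod C D) (N : bimod D E).
Variables (P : reltensor M N) (A : lincat k).

Lemma rt_eq (G G' : functor (rt_bim P) A) (f g : forall x, hom (G x) (G' x)) :
  lin_rex G -> lin_rex G' ->
  (forall x y (u : hom x y), f y ∘ fmap G u = fmap G' u ∘ f x) ->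
  (forall x y (u : hom x y), g y ∘ fmap G u = fmap G' u ∘ g x) ->
  (forall m n, f (so (rt_B P) ⟨m, n⟩) = g (so (rt_B P) ⟨m, n⟩)) -> forall x, f x = g x.
Proof.
move=> rG rG' nf ng e x.
have := @rt_faithful _ _ _ _ _ _ P A G G' rG rG' (NatTrans nf) (NatTrans ng).
by move/(_ (fun p => e (p1 p) (p2 p)))/(congr1 (fun a : nat_trans _ _ => nt a x)).
Qed.

Lemma rt_iso (G G' : functor (rt_bim P) A)
    (i : forall m n, iso (G (so (rt_B P) ⟨m, n⟩)) (G' (so (rt_B P) ⟨m, n⟩))) :
  lin_rex G -> lin_rex G' ->
  (forall m m' n n' (f : hom m m') (g : hom n n'),
    fwd (i m' n') ∘ fmap G (fmap2 (so (rt_B P)) f g) =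
    fmap G' (fmap2 (so (rt_B P)) f g) ∘ fwd (i m n)) ->
  (forall d m n, fwd (i m (d ▷ n)) ∘ fmap G (fwd (bRi (so (rt_B P)) d m n)) =
    fmap G' (fwd (bRi (so (rt_B P)) d m n)) ∘ fwd (i (m ◁ d) n)) ->
  {j : forall x, iso (G x) (G' x) |
    (forall x y (u : hom x y), fwd (j y) ∘ fmap G u = fmap G' u ∘ fwd (j x)) /\
    (forall m n, fwd (j (so (rt_B P) ⟨m, n⟩)) = fwd (i m n))}.
Proof.
move=> rG rG' inat ibal.
have [w Ew] := @rt_full _ _ _ _ _ _ P A G G' rG rG' (@BalRHom _ _ _ _ _ _ _
  (postRd_ob (so (rt_B P)) G) (postRd_ob (so (rt_B P)) G')
  (@NatTrans _ _ (G ∘F so (rt_B P)) (G' ∘F so (rt_B P))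
    (fun p => fwd (i (p1 p) (p2 p))) (fun p q f => inat _ _ _ _ (p1 f) (p2 f))) ibal).
have [v Ev] := @rt_full _ _ _ _ _ _ P A G' G rG' rG (@BalRHom _ _ _ _ _ _ _
  (postRd_ob (so (rt_B P)) G') (postRd_ob (so (rt_B P)) G)
  (@NatTrans _ _ (G' ∘F so (rt_B P)) (G ∘F so (rt_B P))
    (fun p => bwd (i (p1 p) (p2 p)))
    (fun p q f => nat_bwd (inat _ _ _ _ (p1 f) (p2 f))))
  (fun d m n => nat_bwd (ibal d m n))).
have wv x : w x ∘ v x = idm (G' x).
  apply: (@rt_eq G' G' (fun x => w x ∘ v x) (fun x => idm _)) => // [y z u|y z u|m n].
  - by rewrite -compA nt_nat compA nt_nat compA.
  - by rewrite comp1m compm1.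
  - by rewrite Ew Ev /= bwdK.
have vw x : v x ∘ w x = idm (G x).
  apply: (@rt_eq G G (fun x => v x ∘ w x) (fun x => idm _)) => // [y z u|y z u|m n].
  - by rewrite -compA nt_nat compA nt_nat compA.
  - by rewrite comp1m compm1.
  - by rewrite Ew Ev /= fwdK.
exists (fun x => Iso (w x) (v x) (wv x) (vw x)); split=> [x y u|m n] /=.
- exact: nt_nat.
- by rewrite Ew.
Qed.

End RelTensor.

Section Pull.
Variables (k : fieldType) (C D : tencat k) (M : bimod C D) (N : bimod D C).
Variables (P : reltensor M N) (A : lincat k).

Local Notation B := (so (rt_B P)).

Lemma lin_rex_ract (F : functor (rt_bim P) A) (c : C) :
  lin_rex F -> lin_rex (F ∘F (ract (rt_bim P) ∘F insl (rt_bim P) c)).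
Proof.
by move=> rF; exact: lin_rex_comp rF (lin_exact_rex ((ract_exact (b_ax (rt_bim P))).1 c)).
Qed.

Lemma lin_rex_lact (F : functor (rt_bim P) A) (c : C) :
  lin_rex F -> lin_rex (F ∘F (lact (rt_bim P) ∘F insr (rt_bim P) c)).
Proof.
by move=> rF; exact: lin_rex_comp rF (lin_exact_rex ((lact_exact (b_ax (rt_bim P))).2 c)).
Qed.

Lemma pull2_full (F F' : bal1d (rt_bim P) A) : is_bal1 F -> is_bal1 F' ->
  forall a : bal2hom (pull2 F) (pull2 F'),
  {b : bal1hom F F' | forall m n, b (B ⟨m, n⟩) = a ⟨m, n⟩}.
Proof.
move=> axF axF' a; have [rF rF'] := (b1_rex axF, b1_rex axF').
have [w Ew] := @rt_full _ _ _ _ _ _ P A F F' rF rF' (@BalRHom _ _ _ _ _ _ _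
  (postRd_ob B F) (postRd_ob B F') (b2n a) (b2n_inn a)).
suff bal x c : w (c ▷ x) ∘ fwd (b1b F x c) = fwd (b1b F' x c) ∘ w (x ◁ c).
  by exists (Bal1Hom bal) => m n; exact: Ew.
move: x; apply: (rt_eq (lin_rex_ract c rF) (lin_rex_lact c rF')) => /=.
- move=> x y u; rewrite -compA (b1_nat axF) !compA; congr (_ ∘ _); exact: nt_nat.
- move=> x y u; rewrite -compA nt_nat !compA; congr (_ ∘ _); exact: (b1_nat axF').
move=> m n; have := b2n_out a c m n; rewrite /= -!Ew => e.
apply: esym; apply: (nat_bwd (i := iinv (b1b F _ _)) (j := iinv (b1b F' _ _))) => /=.
apply: (iso_cancel2 (i := imap F' (iinv (rt_r P c m n))) (j := imap F (rt_l P c m n))) => /=.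
rewrite -!compA in e; rewrite -!compA nt_nat -e.
by rewrite (cA _ (nt_nat w _)) -!compA.
Qed.

End Pull.

Lemma fmap_shift (X Y : cat) (F : functor X Y) (w x y z : X)
    (i : iso y z) (j : iso w x) (f : hom w y) (g : hom x z) :
  fwd i ∘ f = g ∘ fwd j -> fmap F (bwd i) ∘ fmap F g = fmap F f ∘ fmap F (bwd j).
Proof. by move=> e; rewrite -!fmapM (nat_bwd e). Qed.

Section Pull.
Variables (k : fieldType) (C D : tencat k) (M : bimod C D) (N : bimod D C).
Variables (P : reltensor M N) (A : lincat k).

Local Notation B := (so (rt_B P)).

Lemma b1_bwd_pentagon (X : bimod C C) (F : bal1d X A) : is_bal1 F ->
  forall x c d, bwd (b1b F x (c ⊗ d)) = fmap F (bwd (rassoc x c d)) ∘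
    (bwd (b1b F (x ◁ c) d) ∘ (fmap F (fwd (bmid d x c)) ∘
    (bwd (b1b F (d ▷ x) c) ∘ fmap F (fwd (lassoc c d x))))).
Proof.
move=> ax x c d; apply: (iso_cancel_r (i := b1b F x (c ⊗ d))).
rewrite -!compA fwdK (b1_pentagon ax) -!compA fwdKA.
rewrite (bwdKA (imap F (bmid d x c))) fwdKA.
by rewrite (fwdK (imap F (rassoc x c d))).
Qed.

Lemma pull2_bal (F : bal1d (rt_bim P) A) : is_bal1 F -> is_bal2 (pull2 F).
Proof.
move=> ax; have [rB axB] := so_prf (rt_B P); split.
- exact: lin_rex2_comp (b1_rex ax) rB.
- split=> /=.
  + move=> c c' m m' n n' u f h.
    rewrite -!compA (fsq F (rt_l_nat _ _ _ _)).
    rewrite (cA _ (nat_bwd (b1_nat ax _ _))) -!compA.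
    by rewrite (cA _ (fmap_shift F (rt_r_nat _ _ _ _))) -!compA.
  + move=> c c' m n; rewrite (b1_bwd_pentagon ax) -!compA.
    have e1 : fmap F (fmap2 B (@idm M m) (fwd (rassoc n c c'))) ∘
        (fmap F (bwd (rt_r P (c ⊗ c') m n)) ∘ fmap F (bwd (rassoc (B ⟨m, n⟩) c c'))) =
        fmap F (bwd (rt_r P c' m (n ◁ c))) ∘ fmap F (bwd (rt_r P c m n) ◁m @idm C c').
      rewrite -!fmapM; congr (fmap F _).
      apply: (iso_cancel_l (i := rt_r P c' m (n ◁ c))).
      apply: (iso_cancel_l (i := il (ract _) c' (rt_r P c m n))) => /=.
      rewrite bwdKA -f2l bwdK f21.
      have := rt_r_assoc P c c' m n; rewrite -!compA => e.
      by rewrite (cA3 _ (esym e)) -!compA bwdKA bwdK.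
    have e2 := nat_bwd (b1_nat ax (bwd (rt_r P c m n)) (@idm C c')).
    have e3 : fmap F (@idm C c' ▷m bwd (rt_r P c m n)) ∘ fmap F (fwd (bmid c' (B ⟨m, n⟩) c)) =
        fmap F (fwd (rt_l P c' m (n ◁ c))) ∘ (fmap F (bwd (rt_r P c (c' ▷ m) n)) ∘
        fmap F (bwd (rt_l P c' m n) ◁m @idm C c)).
      rewrite -!fmapM; congr (fmap F _).
      apply: (iso_cancel_l (i := ir (lact _) c' (rt_r P c m n))) => /=.
      apply: (iso_cancel_r (i := il (ract _) c (rt_l P c' m n))) => /=.
      apply: (iso_cancel_r (i := rt_r P c (c' ▷ m) n)).
      rewrite -!compA (cA _ (esym (f2r _ _ _ _))) bwdK f21 comp1m.
      rewrite (cA _ (esym (f2l _ _ _ _))) fwdK f21 comp1m fwdK compm1.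
      by rewrite -(rt_mid P) -compA.
    have e4 := nat_bwd (b1_nat ax (bwd (rt_l P c' m n)) (@idm C c)).
    have e5 : fmap F (@idm C c ▷m bwd (rt_l P c' m n)) ∘
        (fmap F (fwd (lassoc c c' (B ⟨m, n⟩))) ∘ fmap F (fwd (rt_l P (c ⊗ c') m n))) =
        fmap F (fwd (rt_l P c (c' ▷ m) n)) ∘ fmap F (fmap2 B (fwd (lassoc c c' m)) (@idm N n)).
      rewrite -!fmapM; congr (fmap F _).
      apply: (iso_cancel_l (i := ir (lact _) c (rt_l P c' m n))) => /=.
      rewrite (cA _ (esym (f2r _ _ _ _))) bwdK f21 comp1m.
      by rewrite (rt_l_assoc P) -!compA.
    rewrite (cA3 _ e1) -!compA (cA _ (esym e2)) -!compA (cA _ e3) -!compA.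
    by rewrite (cA _ (esym e4)) -!compA e5.
  + move=> m n; rewrite -(rt_l_unit P) -(rt_r_unit P) !fmapM -!compA.
    rewrite (bwdKA (imap F (rt_r P (tone C) m n))) -(b1_triangle ax) -!compA.
    by rewrite bwdKA.
- exact: (postRd_bal (so_prf (rt_B P)) (b1_rex ax)).2.
- move=> c d m n /=; rewrite -!compA.
  have e1 : fmap F (fwd (rt_l P c m (d ▷ n))) ∘ fmap F (fwd (bRi B d (c ▷ m) n)) =
      fmap F (@idm C c ▷m fwd (bRi B d m n)) ∘ (fmap F (fwd (rt_l P c (m ◁ d) n)) ∘
      fmap F (fmap2 B (fwd (bmid c m d)) (@idm N n))).
    by rewrite -!fmapM (rt_l_bal P) -compA.
  have e2 := nat_bwd (b1_nat ax (fwd (bRi B d m n)) (@idm C c)).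
  have e3 : fmap F (fmap2 B (@idm M m) (fwd (bmid d n c))) ∘
      (fmap F (bwd (rt_r P c m (d ▷ n))) ∘ fmap F (fwd (bRi B d m n) ◁m @idm C c)) =
      fmap F (fwd (bRi B d m (n ◁ c))) ∘ fmap F (bwd (rt_r P c (m ◁ d) n)).
    rewrite -!fmapM; congr (fmap F _).
    apply: (iso_cancel_r (i := rt_r P c (m ◁ d) n)).
    rewrite -!compA -(rt_r_bal P) fwdK compm1 -!compA fwdKA.
    by rewrite (cA _ (esym (f2r _ _ _ _))) bwdK f21 comp1m.
  by rewrite e1 (cA _ e2) -!compA (cA3 _ e3) -!compA.
Qed.

End Pull.

Section Bal2Iso.
Variables (k : fieldType) (C D : tencat k) (M : bimod C D) (N : bimod D C).
Variable (A : lincat k).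

Lemma b2n_bwdK (F G : bal2d M N A) (i : @iso (Bal2d M N A) F G) p :
  b2n (fwd i) p ∘ b2n (bwd i) p = idm (G p).
Proof. exact: (congr1 (fun a : bal2hom _ _ => b2n a p) (bwdK i)). Qed.

Lemma b2n_fwdK (F G : bal2d M N A) (i : @iso (Bal2d M N A) F G) p :
  b2n (bwd i) p ∘ b2n (fwd i) p = idm (F p).
Proof. exact: (congr1 (fun a : bal2hom _ _ => b2n a p) (fwdK i)). Qed.

Definition b2_at (F G : bal2d M N A) (i : @iso (Bal2d M N A) F G) p : iso (F p) (G p) :=
  Iso (b2n (fwd i) p) (b2n (bwd i) p) (b2n_bwdK i p) (b2n_fwdK i p).

Lemma is_bal2_iso (F G : bal2d M N A) :
  @iso (Bal2d M N A) F G -> lin_rex2 F -> is_bal2 G -> is_bal2 F.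
Proof.
move=> i rF ax; split=> //.
- split.
  + move=> c c' m m' n n' u f h.
    apply: (iso_cancel_l (i := b2_at i ⟨m', n' ◁ c'⟩)) => /=.
    rewrite (cA _ (b2n_out (fwd i) _ _ _)) -compA nt_nat.
    rewrite (cA _ (out_nat (b2_out ax) u f h)) -compA -b2n_out.
    by rewrite [RHS]compA nt_nat -compA.
  + move=> c c' m n.
    apply: (iso_cancel_l (i := b2_at i ⟨m, (n ◁ c) ◁ c'⟩)) => /=.
    rewrite -!compA (cA _ (nt_nat (fwd i) _)) -compA b2n_out.
    rewrite (cA _ (out_pentagon (b2_out ax) _ _ _ _)).
    rewrite (cA _ (b2n_out (fwd i) _ _ _)) -!compA.
    by rewrite (cA _ (b2n_out (fwd i) _ _ _)) -compA nt_nat.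
  + move=> m n.
    apply: (iso_cancel_l (i := b2_at i ⟨m, n⟩)) => /=.
    rewrite (cA _ (nt_nat (fwd i) _)) -compA b2n_out.
    by rewrite (cA _ (out_triangle (b2_out ax) _ _)) nt_nat.
- split.
  + move=> c c' m m' n n' u f h.
    apply: (iso_cancel_l (i := b2_at i ⟨m', c' ▷ n'⟩)) => /=.
    rewrite (cA _ (b2n_inn (fwd i) _ _ _)) -compA nt_nat.
    rewrite (cA _ (inn_nat (b2_inn ax) u f h)) -compA -b2n_inn.
    by rewrite [RHS]compA nt_nat -compA.
  + move=> c c' m n.
    apply: (iso_cancel_l (i := b2_at i ⟨m, c ▷ (c' ▷ n)⟩)) => /=.
    rewrite -!compA (cA _ (nt_nat (fwd i) _)) -compA b2n_inn.
    rewrite (cA _ (inn_pentagon (b2_inn ax) _ _ _ _)).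
    rewrite (cA _ (b2n_inn (fwd i) _ _ _)) -!compA.
    by rewrite (cA _ (b2n_inn (fwd i) _ _ _)) -compA nt_nat.
  + move=> m n.
    apply: (iso_cancel_l (i := b2_at i ⟨m, n⟩)) => /=.
    rewrite (cA _ (nt_nat (fwd i) _)) -compA b2n_inn.
    by rewrite (cA _ (inn_triangle (b2_inn ax) _ _)) nt_nat.
- move=> c d m n; have := b2_compat ax c d m n; rewrite -!compA => e.
  apply: (iso_cancel_l (i := b2_at i ⟨m, d ▷ (n ◁ c)⟩)) => /=.
  rewrite (cA _ (nt_nat (fwd i) _)) -compA (cA _ (b2n_out (fwd i) _ _ _)).
  rewrite -compA b2n_inn (cA3 _ e) -!compA.
  by rewrite (cA _ (b2n_inn (fwd i) _ _ _)) -compA (cA _ (b2n_out (fwd i) _ _ _)) -compA nt_nat.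
Qed.

End Bal2Iso.

Section PullSurj.
Variables (k : fieldType) (C D : tencat k) (M : bimod C D) (N : bimod D C).
Variables (P : reltensor M N) (A : lincat k).

Local Notation B := (so (rt_B P)).

Section Ext.
Variables (H : functor (rt_bim P) A) (rH : lin_rex H) (o : outbal (H ∘F B)).
Let F : bal2d M N A :=
  @Bal2Data k C D M N A (H ∘F B) o (fun d m n => imap H (bRi B d m n)).
Hypothesis ax : is_bal2 F.

Let i (c : C) (m : M) (n : N) : iso (H (B ⟨m, n⟩ ◁ c)) (H (c ▷ B ⟨m, n⟩)) :=
  icomp (imap H (rt_l P c m n)) (icomp (iinv (o c m n)) (imap H (iinv (rt_r P c m n)))).

Let outer_ext c : {b : forall x : rt_bim P, iso (H (x ◁ c)) (H (c ▷ x)) |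
  (forall x y (u : hom x y),
    fwd (b y) ∘ fmap H (u ◁m idm c) = fmap H (idm c ▷m u) ∘ fwd (b x)) /\
  (forall m n, fwd (b (B ⟨m, n⟩)) = fwd (i c m n))}.
Proof.
have [||b [nb eb]] := @rt_iso _ _ _ _ _ _ P _
  (H ∘F (ract (rt_bim P) ∘F insl (rt_bim P) c))
  (H ∘F (lact (rt_bim P) ∘F insr (rt_bim P) c)) (i c) (lin_rex_ract c rH) (lin_rex_lact c rH).
- move=> m m' n n' f g /=; rewrite -!compA.
  rewrite (fmap_shift H (rt_r_nat P (idm c) f g)).
  rewrite (cA _ (nat_bwd (out_nat (b2_out ax) (idm c) f g))) -!compA.
  by rewrite (cA _ (fsq H (rt_l_nat P (idm c) f g))) -!compA.
- move=> d m n /=; rewrite -!compA.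
  have e1 : fmap H (bwd (rt_r P c m (d ▷ n))) ∘ fmap H (fwd (bRi B d m n) ◁m idm c) =
      fmap H (fmap2 B (idm m) (bwd (bmid d n c))) ∘ (fmap H (fwd (bRi B d m (n ◁ c))) ∘
      fmap H (bwd (rt_r P c (m ◁ d) n))).
    rewrite -!fmapM; congr (fmap H _).
    apply: (iso_cancel_l (i := rt_r P c m (d ▷ n))).
    apply: (iso_cancel_r (i := rt_r P c (m ◁ d) n)).
    by rewrite bwdKA -(rt_r_bal P) -!compA fwdK compm1.
  have e2 : bwd (o c m (d ▷ n)) ∘ (fmap H (fmap2 B (idm m) (bwd (bmid d n c))) ∘
      fmap H (fwd (bRi B d m (n ◁ c)))) =
      fmap H (fwd (bRi B d (c ▷ m) n)) ∘ (fmap H (fmap2 B (bwd (bmid c m d)) (idm n)) ∘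
      bwd (o c (m ◁ d) n)).
    apply: (iso_cancel_l (i := o c m (d ▷ n))).
    apply: (iso_cancel_l (i := imap H (ir B m (bmid d n c)))).
    rewrite bwdKA (bwdKA (imap H (ir B m (bmid d n c)))).
    have := b2_compat ax c d m n; rewrite /= -!compA => e.
    by rewrite (cA3 _ e) -!compA (bwdKA (imap H (il B n (bmid c m d)))) bwdK compm1.
  have e3 : fmap H (fwd (rt_l P c m (d ▷ n))) ∘ (fmap H (fwd (bRi B d (c ▷ m) n)) ∘
      fmap H (fmap2 B (bwd (bmid c m d)) (idm n))) =
      fmap H (idm c ▷m fwd (bRi B d m n)) ∘ fmap H (fwd (rt_l P c (m ◁ d) n)).
    rewrite -!fmapM; congr (fmap H _).
    apply: (iso_cancel_r (i := il B n (bmid c m d))) => /=.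
    rewrite -!compA -f2l fwdK f21 compm1.
    by rewrite (rt_l_bal P) -!compA.
  by rewrite e1 (cA3 _ e2) -!compA (cA3 _ e3) -!compA.
- by exists b.
Qed.

Let b (x : rt_bim P) (c : C) : iso (H (x ◁ c)) (H (c ▷ x)) := proj1_sig (outer_ext c) x.

Let b_nat1 c x y (u : hom x y) :
  fwd (b y c) ∘ fmap H (u ◁m idm c) = fmap H (idm c ▷m u) ∘ fwd (b x c).
Proof. exact: (proj2_sig (outer_ext c)).1. Qed.

Let bB c m n : fwd (b (B ⟨m, n⟩) c) =
  fmap H (fwd (rt_l P c m n)) ∘ (bwd (o c m n) ∘ fmap H (bwd (rt_r P c m n))).
Proof. exact: (proj2_sig (outer_ext c)).2. Qed.

Let b_nat2 x c c' (u : hom c c') :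
  fwd (b x c') ∘ fmap H (idm x ◁m u) = fmap H (u ▷m idm x) ∘ fwd (b x c).
Proof.
move: x; apply: (rt_eq (lin_rex_ract c rH) (lin_rex_lact c' rH)) => /=.
- move=> x y f; rewrite -!compA -fmapM -f2c fmapM (cA _ (b_nat1 _ _)) -!compA.
  by [].
- move=> x y f; rewrite -!compA b_nat1 (cA _ (esym (fmapM H _ _))) -f2c fmapM -!compA.
  by [].
move=> m n; rewrite !bB -!compA.
have e1 := fmap_shift H (rt_r_nat P u (@idm M m) (@idm N n)); rewrite f21 in e1.
have e3 := fsq H (rt_l_nat P u (@idm M m) (@idm N n)); rewrite f21 in e3.
rewrite e1 (cA _ (nat_bwd (out_nat (b2_out ax) u (@idm M m) (@idm N n)))) -!compA.
by rewrite (cA _ e3) -!compA.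
Qed.

Let b_nat x x' c c' (f : hom x x') (u : hom c c') :
  fwd (b x' c') ∘ fmap H (f ◁m u) = fmap H (u ▷m f) ∘ fwd (b x c).
Proof.
have -> : f ◁m u = (f ◁m idm c') ∘ (idm x ◁m u) by rewrite f2M comp1m compm1.
have -> : u ▷m f = (idm c' ▷m f) ∘ (u ▷m idm x) by rewrite f2M comp1m compm1.
by rewrite !fmapM compA b_nat1 -!compA b_nat2.
Qed.

Let G : bal1d (rt_bim P) A := @Bal1Data k C (rt_bim P) A H b.

Let Gpent (c d : C) x :
  fmap H (fwd (lassoc c d x)) ∘ fwd (b x (c ⊗ d)) =
  fwd (b (d ▷ x) c) ∘ fmap H (bwd (bmid d x c)) ∘ fwd (b (x ◁ c) d) ∘
    fmap H (fwd (rassoc x c d)).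
Proof.
have axP := b_ax (rt_bim P); move: x.
  have := (@rt_eq _ _ _ _ _ _ P _
    (H ∘F (ract (rt_bim P) ∘F insl (rt_bim P) (c ⊗ d)))
    ((H ∘F (lact (rt_bim P) ∘F insr (rt_bim P) c)) ∘F
      (lact (rt_bim P) ∘F insr (rt_bim P) d))
    (fun x => fmap H (fwd (lassoc c d x)) ∘ fwd (b x (c ⊗ d)))
    (fun x => fwd (b (d ▷ x) c) ∘ fmap H (bwd (bmid d x c)) ∘ fwd (b (x ◁ c) d) ∘
      fmap H (fwd (rassoc x c d)))) => /=; apply.
  + exact: lin_rex_ract.
  + exact: lin_rex_comp (lin_rex_lact c rH) (lin_exact_rex ((lact_exact axP).2 d)).
  + move=> x y u; rewrite -!compA b_nat1 -(f21 (tens C)).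
    by rewrite (cA _ (fsq H (lassoc_nat axP _ _ _))) -!compA.
  + move=> x y u; rewrite -!compA -(f21 (tens C)).
    rewrite (fsq H (rassoc_nat axP _ _ _)) (cA _ (b_nat _ _)) -!compA.
    rewrite (cA _ (fmap_shift H (bmid_nat axP _ _ _))) -!compA.
    by rewrite (cA _ (b_nat _ _)) -!compA.
  move=> m n.
  have e1 : fmap H (fwd (lassoc c d (B ⟨m, n⟩))) ∘ fmap H (fwd (rt_l P (c ⊗ d) m n)) =
      fmap H (idm c ▷m fwd (rt_l P d m n)) ∘ (fmap H (fwd (rt_l P c (d ▷ m) n)) ∘
      fmap H (fmap2 B (fwd (lassoc c d m)) (@idm N n))).
    by rewrite -!fmapM (rt_l_assoc P) -!compA.
  have e2 : fmap H (fmap2 B (fwd (lassoc c d m)) (@idm N n)) ∘ bwd (o (c ⊗ d) m n) =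
      bwd (o c (d ▷ m) n) ∘ (bwd (o d m (n ◁ c)) ∘
        fmap H (fmap2 B (@idm M m) (fwd (rassoc n c d)))).
    apply: (iso_cancel_l (i := o c (d ▷ m) n)); rewrite bwdKA.
    apply: (iso_cancel_l (i := o d m (n ◁ c))); rewrite bwdKA.
    apply: (iso_cancel_r (i := o (c ⊗ d) m n)); rewrite -!compA fwdK compm1.
    by have := out_pentagon (b2_out ax) c d m n; rewrite -!compA => ->.
  have e3 : fmap H (fmap2 B (@idm M m) (fwd (rassoc n c d))) ∘
      fmap H (bwd (rt_r P (c ⊗ d) m n)) =
      fmap H (bwd (rt_r P d m (n ◁ c))) ∘ (fmap H (bwd (rt_r P c m n) ◁m idm d) ∘
      fmap H (fwd (rassoc (B ⟨m, n⟩) c d))).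
    rewrite -!fmapM; congr (fmap H _).
    apply: (iso_cancel_l (i := rt_r P d m (n ◁ c))); rewrite bwdKA.
    apply: (iso_cancel_l (i := il (ract (rt_bim P)) d (rt_r P c m n))).
    rewrite (bwdKA (il (ract (rt_bim P)) d (rt_r P c m n))).
    apply: (iso_cancel_r (i := rt_r P (c ⊗ d) m n)); rewrite -!compA fwdK compm1.
    by rewrite (rt_r_assoc P) -!compA.
  have e4 : fwd (b (B ⟨m, n⟩ ◁ c) d) =
      fmap H (idm d ▷m fwd (rt_r P c m n)) ∘ (fwd (b (B ⟨m, n ◁ c⟩) d) ∘
        fmap H (bwd (rt_r P c m n) ◁m idm d)).
    apply: (iso_cancel_r (i := imap H (il (ract (rt_bim P)) d (rt_r P c m n)))).
    rewrite -!compA (fwdK (imap H (il (ract (rt_bim P)) d (rt_r P c m n)))) compm1.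
    exact: b_nat1.
  have e5 : fwd (b (d ▷ B ⟨m, n⟩) c) =
      fmap H (idm c ▷m fwd (rt_l P d m n)) ∘ (fwd (b (B ⟨d ▷ m, n⟩) c) ∘
        fmap H (bwd (rt_l P d m n) ◁m idm c)).
    apply: (iso_cancel_r (i := imap H (il (ract (rt_bim P)) c (rt_l P d m n)))).
    rewrite -!compA (fwdK (imap H (il (ract (rt_bim P)) c (rt_l P d m n)))) compm1.
    exact: b_nat1.
  have e6 : fmap H (bwd (rt_r P c (d ▷ m) n)) ∘ (fmap H (bwd (rt_l P d m n) ◁m idm c) ∘
      (fmap H (bwd (bmid d (B ⟨m, n⟩) c)) ∘ (fmap H (idm d ▷m fwd (rt_r P c m n)) ∘
      fmap H (fwd (rt_l P d m (n ◁ c)))))) = idm _.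
    rewrite -!fmapM -fmap1; congr (fmap H _).
    by rewrite -(rt_mid P) -!compA fwdKA (fwdKA (il (ract (rt_bim P)) c (rt_l P d m n))) fwdK.
  rewrite e4 e5 !bB -!compA (cA _ e1) -!compA; congr (_ ∘ (_ ∘ _)).
  rewrite (cA _ e2) -!compA e3; congr (_ ∘ _).
  rewrite !compA in e6; rewrite !compA e6 comp1m.
  by [].
Qed.

Let Gbal : is_bal1 G.
Proof.
have axP := b_ax (rt_bim P).
split=> //=.
have := @rt_eq _ _ _ _ _ _ P _ (H ∘F (ract (rt_bim P) ∘F insl (rt_bim P) (tone C))) H
  (fun x => fmap H (fwd (lunit x)) ∘ fwd (b x (tone C)))
  (fun x => fmap H (fwd (runit x))) => /=; apply=> //.
- exact: lin_rex_ract.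
- move=> x y u; rewrite -!compA b_nat1.
  by rewrite (cA _ (fsq H (lunit_nat axP _))) -!compA.
- by move=> x y u; rewrite (fsq H (runit_nat axP _)).
move=> m n; rewrite bB.
apply: (iso_cancel_r (i := imap H (rt_r P (tone C) m n))) => /=.
rewrite -!compA (fwdK (imap H (rt_r P (tone C) m n))) compm1.
rewrite (cA _ (esym (fmapM H _ _))) -fmapM (rt_l_unit P) (rt_r_unit P).
apply: (iso_cancel_r (i := o (tone C) m n)).
by rewrite -compA fwdK compm1; have /= -> := out_triangle (b2_out ax) m n.
Qed.

Lemma pull2_surj_strict : exists2 G : bal1d (rt_bim P) A, is_bal1 G &
  inhabited (@iso (Bal2d M N A) (pull2 G) F).
Proof.
exists G; first exact: Gbal.
have bwd_b c m n : bwd (b (B ⟨m, n⟩) c) = bwd (i c m n).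
  by congr bwd; apply: iso_ext; apply: bB.
constructor.
have e c m n : fwd (b2o (pull2 G) c m n) = fwd (o c m n).
  rewrite /= bwd_b /= -!compA (fwdKA (imap H (rt_r P c m n))).
  by rewrite (fwdK (imap H (rt_l P c m n))) compm1.
exists (@Bal2Hom _ _ _ _ _ _ (pull2 G) F (nt_id (H ∘F B))
         (fun c m n => etrans (comp1m _) (etrans (e c m n) (esym (compm1 _))))
         (fun d m n => etrans (comp1m _) (esym (compm1 _))))
       (@Bal2Hom _ _ _ _ _ _ F (pull2 G) (nt_id (H ∘F B))
         (fun c m n => etrans (comp1m _) (etrans (esym (e c m n)) (esym (compm1 _))))
         (fun d m n => etrans (comp1m _) (esym (compm1 _)))).
- by apply: bal2hom_ext => p; apply: comp1m.
- by apply: bal2hom_ext => p; apply: comp1m.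
Qed.

End Ext.

Lemma pull2_surj (F : bal2d M N A) : is_bal2 F ->
  exists2 G : bal1d (rt_bim P) A, is_bal1 G & inhabited (@iso (Bal2d M N A) (pull2 G) F).
Proof.
move=> ax.
have [H rH [j]] := rt_surj P (conj (b2_rex ax) (b2_inn ax) : is_balR (BalRData (b2i F))).
have jK p : bRn (fwd j) p ∘ bRn (bwd j) p = idm _.
  exact: (congr1 (fun a : balRhom _ _ => bRn a p) (bwdK j)).
have Kj p : bRn (bwd j) p ∘ bRn (fwd j) p = idm _.
  exact: (congr1 (fun a : balRhom _ _ => bRn a p) (fwdK j)).
pose jj p : iso (H (B p)) (F p) := Iso (bRn (fwd j) p) (bRn (bwd j) p) (jK p) (Kj p).
pose o : outbal (H ∘F B) := fun c m n =>
  icomp (iinv (jj ⟨m, n ◁ c⟩)) (icomp (b2o F c m n) (jj ⟨c ▷ m, n⟩)).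
pose F' := @Bal2Data k C D M N A (H ∘F B) o (fun d m n => imap H (bRi B d m n)).
have F'F : @iso (Bal2d M N A) F' F.
  have ea c m n : fwd (jj ⟨m, n ◁ c⟩) ∘ fwd (o c m n) = fwd (b2o F c m n) ∘ fwd (jj ⟨c ▷ m, n⟩).
    exact: bwdKA (jj ⟨m, n ◁ c⟩) _.
  exists (@Bal2Hom _ _ _ _ _ _ F' F (bRn (fwd j)) ea (bRn_inn (fwd j)))
    (@Bal2Hom _ _ _ _ _ _ F F' (bRn (bwd j))
      (fun c m n => nat_bwd (i := jj ⟨c ▷ m, n⟩) (j := jj ⟨m, n ◁ c⟩) (ea c m n))
      (bRn_inn (bwd j))).
  - by apply: bal2hom_ext => p; exact: jK.
  - by apply: bal2hom_ext => p; exact: Kj.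
have axF' : is_bal2 F'.
  apply: is_bal2_iso F'F _ ax.
  exact: lin_rex2_comp rH (so_prf (rt_B P)).1.
have [G axG [g]] := pull2_surj_strict rH axF'.
by exists G => //; constructor; exact: icomp F'F g.
Qed.

End PullSurj.

Definition is_b2 (k : fieldType) (C D : tencat k) (M : bimod C D) (N : bimod D C)
    (A : lincat k) (F G : bal2d M N A) (t : forall m n, hom (F ⟨m, n⟩) (G ⟨m, n⟩)) : Prop :=
  [/\ forall (m m' : M) (n n' : N) (f : hom m m') (g : hom n n'),
        t m' n' ∘ fmap2 F f g = fmap2 G f g ∘ t m n,
      forall (c : C) (m : M) (n : N),
        t m (n ◁ c) ∘ fwd (b2o F c m n) = fwd (b2o G c m n) ∘ t (c ▷ m) n
    & forall (d : D) (m : M) (n : N),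
        t m (d ▷ n) ∘ fwd (b2i F d m n) = fwd (b2i G d m n) ∘ t (m ◁ d) n].

Section B2.
Variables (k : fieldType) (C D : tencat k) (M : bimod C D) (N : bimod D C) (A : lincat k).

Lemma is_b2_hom (F G : bal2d M N A) (a : bal2hom F G) : is_b2 (fun m n => a ⟨m, n⟩).
Proof. split=> *; [exact: nt_nat | exact: b2n_out | exact: b2n_inn]. Qed.

Lemma is_b2_comp (F G H : bal2d M N A) (t : forall m n, hom (F ⟨m, n⟩) (G ⟨m, n⟩))
    (s : forall m n, hom (G ⟨m, n⟩) (H ⟨m, n⟩)) :
  is_b2 t -> is_b2 s -> is_b2 (F := F) (G := H) (fun m n => s m n ∘ t m n).
Proof.
move=> [t1 t2 t3] [s1 s2 s3]; split=> *.
- by rewrite -compA t1 !compA s1.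
- by rewrite -compA t2 !compA s2.
- by rewrite -compA t3 !compA s3.
Qed.

Lemma is_b2_inv (F G : bal2d M N A) (i : forall m n, iso (F ⟨m, n⟩) (G ⟨m, n⟩)) :
  is_b2 (fun m n => fwd (i m n)) -> is_b2 (F := G) (G := F) (fun m n => bwd (i m n)).
Proof. by case=> i1 i2 i3; split=> *; apply: nat_bwd. Qed.

Lemma is_b2_post (F G : bal2d M N A) (t : forall m n, hom (F ⟨m, n⟩) (G ⟨m, n⟩))
    (A' : lincat k) (H : functor A A') :
  is_b2 t -> is_b2 (F := post2d_ob F H) (G := post2d_ob G H) (fun m n => fmap H (t m n)).
Proof. by case=> t1 t2 t3; split=> * /=; apply: fsq. Qed.

Lemma is_b2_switch (F G : bal2d M N A) (t : forall m n, hom (F ⟨m, n⟩) (G ⟨m, n⟩)) :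
  is_b2 t -> is_b2 (F := switchd_ob F) (G := switchd_ob G) (fun n m => t m n).
Proof.
case=> t1 t2 t3; split=> * /=; first exact: t1.
  exact/esym/nat_bwd/esym/t3.
exact/esym/nat_bwd/esym/t2.
Qed.

Definition b2_hom (F G : bal2d M N A) (t : forall m n, hom (F ⟨m, n⟩) (G ⟨m, n⟩))
  (ax : is_b2 t) : bal2hom F G :=
  @Bal2Hom k C D M N A F G
    (@NatTrans _ _ F G (fun p => t (p1 p) (p2 p))
      (fun p q f => match ax with And3 a _ _ => a _ _ _ _ (p1 f) (p2 f) end))
    (match ax with And3 _ a _ => a end) (match ax with And3 _ _ a => a end).

Definition b2_iso (F G : bal2d M N A) (i : forall m n, iso (F ⟨m, n⟩) (G ⟨m, n⟩))
  (ax : is_b2 (fun m n => fwd (i m n))) : @iso (Bal2d M N A) F G.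
Proof.
refine (@Iso (Bal2d M N A) F G (b2_hom ax) (b2_hom (is_b2_inv ax)) _ _).
- by apply: bal2hom_ext => p; exact: bwdK.
- by apply: bal2hom_ext => p; exact: fwdK.
Defined.

End B2.

Section TraceTensor.
Variables (k : fieldType) (C D : tencat k) (M : bimod C D) (N : bimod D C).
Variables (P : reltensor M N) (T : cvtrace P) (A : lincat k).

Lemma univ2_bal : is_bal2 (univ2 T).
Proof. exact: pull2_bal (so_prf (tr_B T)). Qed.

Lemma lin_rex_tr (H : functor T A) : lin_rex H -> lin_rex (H ∘F so (tr_B T)).
Proof. by move=> rH; exact: lin_rex_comp rH (b1_rex (so_prf (tr_B T))). Qed.

Lemma univ2_faithful (H H' : functor T A) : lin_rex H -> lin_rex H' ->
  forall w w' : nat_trans H H',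
  (forall m n, w (univ2 T ⟨m, n⟩) = w' (univ2 T ⟨m, n⟩)) -> w = w'.
Proof.
move=> rH rH' w w' e; apply: tr_faithful => // x; move: x.
have := @rt_eq _ _ _ _ _ _ P _ (H ∘F so (tr_B T)) (H' ∘F so (tr_B T))
  (fun x => w (so (tr_B T) x)) (fun x => w' (so (tr_B T) x)); apply.
- exact: lin_rex_tr.
- exact: lin_rex_tr.
- by move=> x y u; exact: (nt_nat w (fmap (so (tr_B T)) u)).
- by move=> x y u; exact: (nt_nat w' (fmap (so (tr_B T)) u)).
- exact: e.
Qed.

Lemma univ2_full (H H' : functor T A)
    (t : forall m n, hom (H (univ2 T ⟨m, n⟩)) (H' (univ2 T ⟨m, n⟩))) :
  lin_rex H -> lin_rex H' ->
  is_b2 (F := post2d_ob (univ2 T) H) (G := post2d_ob (univ2 T) H') t ->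
  {w : nat_trans H H' | forall m n, w (univ2 T ⟨m, n⟩) = t m n}.
Proof.
move=> rH rH' [t1 t2 t3].
pose F := post1d_ob (so (tr_B T)) H; pose F' := post1d_ob (so (tr_B T)) H'.
have axF : is_bal1 F := post1d_bal (so_prf (tr_B T)) rH.
have axF' : is_bal1 F' := post1d_bal (so_prf (tr_B T)) rH'.
have o2 : forall (c : C) (m : M) (n : N),
   t m (n ◁ c) ∘ fwd (b2o (pull2 F) c m n) = fwd (b2o (pull2 F') c m n) ∘ t (c ▷ m) n.
  by move=> c m n; have := t2 c m n; rewrite /= !fmapM.
have [b Eb] := pull2_full axF axF'
  (b2_hom (F := pull2 F) (G := pull2 F') (And3 t1 o2 t3)).
have [w Ew] := tr_full rH rH' b.
by exists w => m n; rewrite /= Ew Eb.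
Qed.

Lemma univ2_iso (H H' : functor T A)
    (i : forall m n, iso (H (univ2 T ⟨m, n⟩)) (H' (univ2 T ⟨m, n⟩))) :
  lin_rex H -> lin_rex H' ->
  is_b2 (F := post2d_ob (univ2 T) H) (G := post2d_ob (univ2 T) H') (fun m n => fwd (i m n)) ->
  exists! w : H ≅ H', forall m n, nti w (univ2 T ⟨m, n⟩) = fwd (i m n).
Proof.
move=> rH rH' ax.
have [w Ew] := univ2_full rH rH' ax.
have [v Ev] := univ2_full rH' rH (is_b2_inv ax).
have wv : nt_comp w v = nt_id H'.
  by apply: univ2_faithful => // m n; rewrite /= Ew Ev bwdK.
have vw : nt_comp v w = nt_id H.
  by apply: univ2_faithful => // m n; rewrite /= Ew Ev fwdK.
exists (@Iso (Funct T A) H H' w v wv vw); split=> // w' Ew'.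
apply: iso_ext; apply: univ2_faithful => // m n.
by rewrite [LHS]Ew -Ew'.
Qed.

Lemma univ2_surj (F : bal2d M N A) : is_bal2 F ->
  exists2 H : functor T A, lin_rex H &
    inhabited (@iso (Bal2d M N A) (post2d_ob (univ2 T) H) F).
Proof.
move=> ax.
have [G axG [g]] := pull2_surj P ax.
have [H rH [h]] := tr_surj T axG.
have hK p : b1n (fwd h) p ∘ b1n (bwd h) p = idm _.
  exact: (congr1 (fun a : bal1hom _ _ => b1n a p) (bwdK h)).
have Kh p : b1n (bwd h) p ∘ b1n (fwd h) p = idm _.
  exact: (congr1 (fun a : bal1hom _ _ => b1n a p) (fwdK h)).
pose i m n : iso (post2d_ob (univ2 T) H ⟨m, n⟩) (F ⟨m, n⟩) :=
  icomp (b2_at g ⟨m, n⟩)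
    (Iso (b1n (fwd h) (so (rt_B P) ⟨m, n⟩)) (b1n (bwd h) (so (rt_B P) ⟨m, n⟩)) (hK _) (Kh _)).
exists H => //; constructor; apply: (b2_iso (i := i)).
apply: (is_b2_comp (G := pull2 G) (s := fun m n => fwd (b2_at g ⟨m, n⟩)) _ (is_b2_hom (fwd g))).
split=> [m m' n n' f f'|c m n|d m n] /=.
- exact: (nt_nat (b1n (fwd h)) (fmap2 (so (rt_B P)) f f')).
- have e := nat_bwd (i := b1b (post1d_ob (so (tr_B T)) H) (so (rt_B P) ⟨m, n⟩) c)
    (j := b1b G (so (rt_B P) ⟨m, n⟩) c) (esym (b1n_bal (fwd h) _ c)).
  rewrite /= in e.
  have n1 := nt_nat (b1n (fwd h)) (bwd (rt_r P c m n)); rewrite /= in n1.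
  have n2 := nt_nat (b1n (fwd h)) (fwd (rt_l P c m n)); rewrite /= in n2.
  rewrite !fmapM -!compA (cA _ n1) -!compA -n2.
  by rewrite [X in _ = _ ∘ X]compA e -!compA.
- exact: (nt_nat (b1n (fwd h)) (fwd (bRi (so (rt_B P)) d m n))).
Qed.

End TraceTensor.

Section Cyclic.
Variables (k : fieldType) (C D : tencat k) (M : bimod C D) (N : bimod D C).
Variables (P : reltensor M N) (T : cvtrace P) (Q : reltensor N M) (S : cvtrace Q).

Definition cyc_at (F : cyc T S) (m : M) (n : N) :
  iso (F (univ2 T ⟨m, n⟩)) (univ2 S ⟨n, m⟩) := b2_at (cyc_iso F) ⟨m, n⟩.

Lemma cyc_is_b2 (F : cyc T S) :
  is_b2 (F := post2d_ob (univ2 T) F) (G := switchd_ob (univ2 S)) (cyc_th F).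
Proof. exact: (is_b2_hom (fwd (cyc_iso F))). Qed.

Lemma cyc_exists : inhabited (cyc T S).
Proof.
have [H rH [i]] := univ2_surj T (switch_bal (univ2_bal S)).
by constructor; exists H.
Qed.

Lemma cyc_unique (phi phi' : cyc T S) :
  exists! w : phi ≅ phi', forall (m : M) (n : N),
    cyc_th phi' m n ∘ nti w (univ2 T ⟨m, n⟩) = cyc_th phi m n.
Proof.
pose i m n := icomp (iinv (cyc_at phi' m n)) (cyc_at phi m n).
have := @univ2_iso _ _ _ _ _ _ T _ phi phi' i (cyc_rex phi) (cyc_rex phi').
case=> [|w [Ew uw]].
  apply: (is_b2_comp (F := post2d_ob (univ2 T) phi) (G := switchd_ob (univ2 S))
    (H := post2d_ob (univ2 T) phi') (s := fun m n => bwd (cyc_at phi' m n)) (cyc_is_b2 phi)).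
  exact: (is_b2_inv (F := post2d_ob (univ2 T) phi') (G := switchd_ob (univ2 S))
    (i := cyc_at phi') (cyc_is_b2 phi')).
exists w; split=> [m n|w' Ew'].
  by rewrite Ew; exact: (bwdKA (cyc_at phi' m n)).
apply: uw => m n; apply: (iso_cancel_l (i := cyc_at phi' m n)).
by rewrite [LHS]Ew' [RHS](bwdKA (cyc_at phi' m n)).
Qed.

End Cyclic.

Lemma lin_rex_id (k : fieldType) (A : lincat k) : lin_rex (fid A).
Proof. by split=> x y. Qed.

Section CyclicInverse.
Variables (k : fieldType) (C D : tencat k) (M : bimod C D) (N : bimod D C).
Variables (P : reltensor M N) (T : cvtrace P) (Q : reltensor N M) (S : cvtrace Q).

Lemma cyc_inverse (phi : cyc T S) (psi : cyc S T) :
  exists! w : psi ∘F phi ≅ fid T, forall (m : M) (n : N),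
    nti w (univ2 T ⟨m, n⟩) = cyc_th psi n m ∘ fmap psi (cyc_th phi m n).
Proof.
apply: (@univ2_iso _ _ _ _ _ _ T _ (psi ∘F phi) (fid T)
  (fun m n => icomp (cyc_at psi n m) (imap psi (cyc_at phi m n)))).
- exact: lin_rex_comp (cyc_rex psi) (cyc_rex phi).
- exact: lin_rex_id.
apply: (is_b2_comp (F := post2d_ob (univ2 T) (psi ∘F phi))
  (G := post2d_ob (switchd_ob (univ2 S)) psi) (H := post2d_ob (univ2 T) (fid T))
  (t := fun m n => fmap psi (cyc_th phi m n)) (s := fun m n => cyc_th psi n m)).
- exact: (is_b2_post psi (cyc_is_b2 phi)).
- exact: (is_b2_switch (cyc_is_b2 psi)).
Qed.

End CyclicInverse.

Lemma cyc_equiv (k : fieldType) (C D : tencat k) (M : bimod C D) (N : bimod D C)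
    (P : reltensor M N) (T : cvtrace P) (Q : reltensor N M) (S : cvtrace Q)
    (phi : cyc T S) : is_equiv phi.
Proof.
have [psi] := cyc_exists S T.
have [w _] := cyc_inverse phi psi; have [v _] := cyc_inverse psi phi.
by exists psi; split; constructor; [exact: iinv w | exact: v].
Qed.

(** * Switching arguments *)

Lemma sub_ob_ext (X : cat) (P : X -> Prop) (x y : sub_ob P) : so x = so y -> x = y.
Proof.
case: x y => [x px] [y py] /= e; case: _ / e in py *.
by congr SubOb; apply: proof_irrelevance.
Qed.

(* Equality of functors into categories whose morphisms are determined by   *)
(* components: [o] is a common computed form of the component objects, so   *)
(* that no transport remains when [eF] and [eG] are reflexivity proofs.     *)
Lemma functor_eq (X Y Z : cat) (I : Type) (cob : I -> Y -> Z)
    (chom : forall i x y, hom x y -> hom (cob i x) (cob i y)) (F G : functor X Y)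
    (o : X -> I -> Z) (eF : (fun x i => cob i (F x)) = o) (eG : (fun x i => cob i (G x)) = o) :
  (forall x y (f g : hom x y), (forall i, chom i x y f = chom i x y g) -> f = g) ->
  fob F = fob G ->
  (forall x y (f : hom x y) i,
    eq_rect _ (fun o => hom (o x i) (o y i)) (chom i _ _ (fmap F f)) o eF =
    eq_rect _ (fun o => hom (o x i) (o y i)) (chom i _ _ (fmap G f)) o eG) ->
  F = G.
Proof.
move=> ext; case: F G eF eG => [oF mF iF cF] [oG mG iG cG] /= eF eG e.
case: _ / e in mG iG cG eG *.
have -> : eG = eF by apply: proof_irrelevance.
case: _ / eF => /= e.
have {}e : mF = mG.
  do 3!apply: functional_extensionality_dep => ?.
  by apply: ext => i; apply: e.
case: _ / e in iG cG *; congr Functor; apply: proof_irrelevance.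
Qed.

Lemma bal2d_pi (k : fieldType) (C D : tencat k) (M : bimod C D) (N : bimod D C)
    (A : lincat k) (ob : M × N -> A) (mp : forall x y, hom x y -> hom (ob x) (ob y))
    p q p' q' o i :
  @Bal2Data k C D M N A (@Functor _ _ ob mp p q) o i =
  @Bal2Data k C D M N A (@Functor _ _ ob mp p' q') o i.
Proof.
have e : p = p' by apply: proof_irrelevance.
have e' : q = q' by apply: proof_irrelevance.
by case: _ / e; case: _ / e'.
Qed.

Lemma bal3d_pi (k : fieldType) (C D E : tencat k)
    (M : bimod D C) (N : bimod C E) (K : bimod E D)
    (A : lincat k) (ob : M × N × K -> A) (mp : forall x y, hom x y -> hom (ob x) (ob y))
    p q p' q' o i j :
  @Bal3Data k C D E M N K A (@Functor _ _ ob mp p q) o i j =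
  @Bal3Data k C D E M N K A (@Functor _ _ ob mp p' q') o i j.
Proof.
have e : p = p' by apply: proof_irrelevance.
have e' : q = q' by apply: proof_irrelevance.
by case: _ / e; case: _ / e'.
Qed.

Lemma switchK (k : fieldType) (C D : tencat k) (M : bimod C D) (N : bimod D C)
    (A : lincat k) : switch N M A ∘F switch M N A = fid (Bal2 M N A).
Proof.
apply: (@functor_eq _ (Bal2 M N A) A (M × N) (fun p F => so F p)
  (fun p F G (a : bal2hom (so F) (so G)) => b2n a p)
  (switch N M A ∘F switch M N A) (fid (Bal2 M N A)) (fun F p => so F p) erefl erefl) => //.
- by move=> F G a b; apply: bal2hom_ext.
- apply: functional_extensionality => F; apply: sub_ob_ext.
  pose G := so F ∘F exch N M ∘F exch M N.
  exact: (@bal2d_pi k C D M N A (so F) (@fmap _ _ (so F)) (fmap1 G) (@fmapM _ _ G)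
    (fmap1 (so F)) (@fmapM _ _ (so F)) (b2o (so F)) (b2i (so F))).
Qed.

Lemma functor_eq_iso (X Y : cat) (F G : functor X Y) : F = G -> F ≅ G.
Proof. by move=> ->; exact: iid. Qed.

Lemma switch_equiv (k : fieldType) (C D : tencat k) (M : bimod C D) (N : bimod D C)
    (A : lincat k) : is_equiv (switch M N A).
Proof.
exists (switch N M A); split; constructor; apply: functor_eq_iso.
- by rewrite switchK.
- by rewrite switchK.
Qed.

Section Rotation.
Variables (k : fieldType) (C D E : tencat k).
Variables (M : bimod D C) (N : bimod C E) (K : bimod E D) (A : lincat k).

Lemma switch21_switch21 :
  switch21 K M N A ∘F switch21 M N K A = switch12 M N K A.
Proof.
apply: (@functor_eq _ (Bal3 N K M A) A (N × K × M) (fun p F => so F p)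
  (fun p F G (a : bal3hom (so F) (so G)) => b3n a p)
  (switch21 K M N A ∘F switch21 M N K A) (switch12 M N K A)
  (fun F p => so F (rot' M N K p)) erefl erefl) => //.
- by move=> F G a b; apply: bal3hom_ext.
- apply: functional_extensionality => F; apply: sub_ob_ext; pose G := so F ∘F rot M N K ∘F rot K M N.
  exact: (@bal3d_pi k E C D N K M A (so F ∘F rot' M N K) (@fmap _ _ (so F ∘F rot' M N K))
    (fmap1 G) (@fmapM _ _ G) (fmap1 (so F ∘F rot' M N K)) (@fmapM _ _ (so F ∘F rot' M N K))
    (b3o (switch12d_ob (so F))) (b3i (switch12d_ob (so F))) (b3j (switch12d_ob (so F)))).
Qed.

Lemma switch12_switch21 :
  switch12 K M N A ∘F switch21 M N K A = fid (Bal3 M N K A).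
Proof.
apply: (@functor_eq _ (Bal3 M N K A) A (M × N × K) (fun p F => so F p)
  (fun p F G (a : bal3hom (so F) (so G)) => b3n a p)
  (switch12 K M N A ∘F switch21 M N K A) (fid (Bal3 M N K A)) (fun F p => so F p) erefl erefl) => //.
- by move=> F G a b; apply: bal3hom_ext.
- apply: functional_extensionality => F; apply: sub_ob_ext.
  pose G := so F ∘F rot M N K ∘F rot' K M N.
  exact: (@bal3d_pi k C D E M N K A (so F) (@fmap _ _ (so F)) (fmap1 G) (@fmapM _ _ G)
    (fmap1 (so F)) (@fmapM _ _ (so F)) (b3o (so F)) (b3i (so F)) (b3j (so F))).
Qed.

Lemma switch21_switch12 :
  switch21 N K M A ∘F switch12 M N K A = fid (Bal3 M N K A).
Proof.
apply: (@functor_eq _ (Bal3 M N K A) A (M × N × K) (fun p F => so F p)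
  (fun p F G (a : bal3hom (so F) (so G)) => b3n a p)
  (switch21 N K M A ∘F switch12 M N K A) (fid (Bal3 M N K A)) (fun F p => so F p) erefl erefl) => //.
- by move=> F G a b; apply: bal3hom_ext.
- apply: functional_extensionality => F; apply: sub_ob_ext.
  pose G := so F ∘F rot' M N K ∘F rot N K M.
  exact: (@bal3d_pi k C D E M N K A (so F) (@fmap _ _ (so F)) (fmap1 G) (@fmapM _ _ G)
    (fmap1 (so F)) (@fmapM _ _ (so F)) (b3o (so F)) (b3i (so F)) (b3j (so F))).
Qed.

End Rotation.

Section RotationEquiv.
Variables (k : fieldType) (C D E : tencat k).
Variables (M : bimod D C) (N : bimod C E) (K : bimod E D) (A : lincat k).

Lemma switch21_equiv : is_equiv (switch21 M N K A).
Proof.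
exists (switch12 K M N A); split; constructor; apply: functor_eq_iso.
- by rewrite switch12_switch21.
- exact: switch21_switch12.
Qed.

Lemma switch12_equiv : is_equiv (switch12 M N K A).
Proof.
exists (switch21 N K M A); split; constructor; apply: functor_eq_iso.
- by rewrite switch21_switch12.
- exact: switch12_switch21.
Qed.

End RotationEquiv.

(** * Three factors *)

Section B3.
Variables (k : fieldType) (C D E : tencat k).
Variables (M : bimod D C) (N : bimod C E) (K : bimod E D).

Definition is_b3 (A : lincat k) (F G : bal3d M N K A)
    (t : forall m n x, hom (F ⟨⟨m, n⟩, x⟩) (G ⟨⟨m, n⟩, x⟩)) : Prop :=
  [/\ forall (m m' : M) (n n' : N) (x x' : K) (f : hom m m') (g : hom n n') (h : hom x x'),
        t m' n' x' ∘ fmap3 F f g h = fmap3 G f g h ∘ t m n x,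
      forall (d : D) (m : M) (n : N) (x : K),
        t m n (x ◁ d) ∘ fwd (b3o F n d m x) = fwd (b3o G n d m x) ∘ t (d ▷ m) n x,
      forall (c : C) (m : M) (n : N) (x : K),
        t m (c ▷ n) x ∘ fwd (b3i F x c m n) = fwd (b3i G x c m n) ∘ t (m ◁ c) n x
    & forall (e : E) (m : M) (n : N) (x : K),
        t m n (e ▷ x) ∘ fwd (b3j F m e n x) = fwd (b3j G m e n x) ∘ t m (n ◁ e) x].

Definition post3d_ob (A A' : lincat k) (F : bal3d M N K A) (H : functor A A') :
    bal3d M N K A' :=
  @Bal3Data k C D E M N K A' (H ∘F F) (fun n d m x => imap H (b3o F n d m x))
    (fun x c m n => imap H (b3i F x c m n)) (fun m e n x => imap H (b3j F m e n x)).

Section Families.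
Variable A : lincat k.

Lemma is_b3_comp (F G H : bal3d M N K A)
    (t : forall m n x, hom (F ⟨⟨m, n⟩, x⟩) (G ⟨⟨m, n⟩, x⟩))
    (s : forall m n x, hom (G ⟨⟨m, n⟩, x⟩) (H ⟨⟨m, n⟩, x⟩)) :
  is_b3 t -> is_b3 s -> is_b3 (F := F) (G := H) (fun m n x => s m n x ∘ t m n x).
Proof.
move=> [t1 t2 t3 t4] [s1 s2 s3 s4]; split=> *.
- by rewrite -compA t1 !compA s1.
- by rewrite -compA t2 !compA s2.
- by rewrite -compA t3 !compA s3.
- by rewrite -compA t4 !compA s4.
Qed.

Lemma is_b3_inv (F G : bal3d M N K A)
    (i : forall m n x, iso (F ⟨⟨m, n⟩, x⟩) (G ⟨⟨m, n⟩, x⟩)) :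
  is_b3 (fun m n x => fwd (i m n x)) -> is_b3 (F := G) (G := F) (fun m n x => bwd (i m n x)).
Proof. by case=> i1 i2 i3 i4; split=> *; apply: nat_bwd. Qed.

Lemma is_b3_post (F G : bal3d M N K A)
    (t : forall m n x, hom (F ⟨⟨m, n⟩, x⟩) (G ⟨⟨m, n⟩, x⟩))
    (A' : lincat k) (H : functor A A') :
  is_b3 t -> is_b3 (F := post3d_ob F H) (G := post3d_ob G H) (fun m n x => fmap H (t m n x)).
Proof.
case=> t1 t2 t3 t4; split=> * /=; apply: fsq.
- exact: t1.
- exact: t2.
- exact: t3.
- exact: t4.
Qed.

End Families.

End B3.

Lemma is_b3_switch12 (k : fieldType) (C D E : tencat k)
    (M : bimod D C) (N : bimod C E) (K : bimod E D) (A : lincat k) (F G : bal3d M N K A)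
    (t : forall m n x, hom (F ⟨⟨m, n⟩, x⟩) (G ⟨⟨m, n⟩, x⟩)) :
  is_b3 t -> is_b3 (F := switch12d_ob F) (G := switch12d_ob G) (fun n x m => t m n x).
Proof.
case=> t1 t2 t3 t4; split=> * /=; first exact: t1.
- exact/esym/nat_bwd/esym/t3.
- exact: t4.
- exact/esym/nat_bwd/esym/t2.
Qed.

Section Triple.
Variables (k : fieldType) (C D E : tencat k).
Variables (M : bimod D C) (N : bimod C E) (K : bimod E D).

Section LiftR.
Variable (NK : reltensor N K).
Local Notation B := (so (rt_B NK)).

Definition insR : functor (M × N × K) (M × rt_bim NK).
Proof.
refine (@Functor (M × N × K) (M × rt_bim NK) (fun p => ⟨p1 (p1 p), B ⟨p2 (p1 p), p2 p⟩⟩)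
  (fun p q f => ⟨p1 (p1 f), fmap2 B (p2 (p1 f)) (p2 f)⟩) _ _).
- by move=> p; apply: pr_ext => //=; exact: f21.
- by move=> p q r g f; apply: pr_ext => //=; rewrite f2M.
Defined.

Definition lift3R (A : lincat k) (V : bal2d M (rt_bim NK) A) : bal3d M N K A :=
  @Bal3Data k C D E M N K A (V ∘F insR)
    (fun n d m x => icomp (ir V m (iinv (rt_r NK d n x))) (b2o V d m (B ⟨n, x⟩)))
    (fun x c m n => icomp (ir V m (iinv (rt_l NK c n x))) (b2i V c m (B ⟨n, x⟩)))
    (fun m e n x => ir V m (bRi B e n x)).

Section Univ3.
Variables (R : reltensor M (rt_bim NK)) (T : cvtrace R) (A : lincat k).
Local Notation U := (univ2 T).

Lemma univ3_iso (H H' : functor T A)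
    (i : forall m n x, iso (H (U ⟨m, B ⟨n, x⟩⟩)) (H' (U ⟨m, B ⟨n, x⟩⟩))) :
  lin_rex H -> lin_rex H' ->
  is_b3 (F := post3d_ob (lift3R U) H) (G := post3d_ob (lift3R U) H')
    (fun m n x => fwd (i m n x)) ->
  exists! w : H ≅ H', forall m n x, nti w (U ⟨m, B ⟨n, x⟩⟩) = fwd (i m n x).
Proof.
move=> rH rH' [i1 i2 i3 i4].
have rU := b2_rex (univ2_bal T).
have rHU (G : functor T A) (m : M) : lin_rex G -> lin_rex (G ∘F (U ∘F insr (rt_bim NK) m)).
  by move=> rG; exact: lin_rex_comp rG (rU.2 m).
have ext m : {j : forall y, iso (H (U ⟨m, y⟩)) (H' (U ⟨m, y⟩)) |
    (forall y z (u : hom y z), fwd (j z) ∘ fmap H (fmap2 U (idm m) u) =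
      fmap H' (fmap2 U (idm m) u) ∘ fwd (j y)) /\
    (forall n x, fwd (j (B ⟨n, x⟩)) = fwd (i m n x))}.
  have [||j [nj ej]] := @rt_iso _ _ _ _ _ _ NK _
    (H ∘F (U ∘F insr (rt_bim NK) m)) (H' ∘F (U ∘F insr (rt_bim NK) m)) (i m)
    (rHU _ m rH) (rHU _ m rH'); last by exists j.
  - by move=> n n' x x' g h; exact: i1 (idm m) g h.
  - by move=> e n x; exact: i4.
pose j m y := proj1_sig (ext m) y.
have jB m n x : fwd (j m (B ⟨n, x⟩)) = fwd (i m n x) by exact: (proj2_sig (ext m)).2.
have nj2 m y z (u : hom y z) : fwd (j m z) ∘ fmap H (fmap2 U (idm m) u) =
      fmap H' (fmap2 U (idm m) u) ∘ fwd (j m y) by exact: (proj2_sig (ext m)).1.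
have axU := univ2_bal T.
have nj1 m m' (f : hom m m') : forall y, fwd (j m' y) ∘ fmap H (fmap2 U f (idm y)) =
    fmap H' (fmap2 U f (idm y)) ∘ fwd (j m y).
  have := @rt_eq _ _ _ _ _ _ NK _
    (H ∘F (U ∘F insr (rt_bim NK) m)) (H' ∘F (U ∘F insr (rt_bim NK) m'))
    (fun y => fwd (j m' y) ∘ fmap H (fmap2 U f (idm y)))
    (fun y => fmap H' (fmap2 U f (idm y)) ∘ fwd (j m y)); apply.
  - exact: rHU.
  - exact: rHU.
  - move=> y z u; rewrite -compA (fsq H (f2c U f u)) !compA; congr (_ ∘ _); exact: nj2.
  - move=> y z u; rewrite -compA [X in _ ∘ X]nj2 !compA; congr (_ ∘ _).
    exact: fsq (f2c U f u).
  move=> n x; rewrite !jB.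
  by have := i1 _ _ _ _ _ _ f (@idm N n) (@idm K x); rewrite /= f21.
have njo d m : forall y, fwd (j m (y ◁ d)) ∘ fmap H (fwd (b2o U d m y)) =
    fmap H' (fwd (b2o U d m y)) ∘ fwd (j (d ▷ m) y).
  have on y z (u : hom y z) := out_nat (b2_out axU) (idm d) (idm m) u.
  have rr := lin_exact_rex ((ract_exact (b_ax (rt_bim NK))).1 d).
  have := @rt_eq _ _ _ _ _ _ NK _
    (H ∘F (U ∘F insr (rt_bim NK) (d ▷ m)))
    ((H' ∘F (U ∘F insr (rt_bim NK) m)) ∘F (ract (rt_bim NK) ∘F insl (rt_bim NK) d))
    (fun y => fwd (j m (y ◁ d)) ∘ fmap H (fwd (b2o U d m y)))
    (fun y => fmap H' (fwd (b2o U d m y)) ∘ fwd (j (d ▷ m) y)); apply.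
  - exact: rHU.
  - exact: lin_rex_comp (rHU _ _ _) rr.
  - move=> y z u; rewrite -compA.
    have := fsq H (on _ _ u); rewrite f21 => e; rewrite [X in _ ∘ X]e.
    by rewrite compA nj2 -compA.
  - move=> y z u; rewrite -compA [X in _ ∘ X]nj2.
    by have := fsq H' (on _ _ u); rewrite f21 => e; rewrite compA e -compA.
  move=> n x; rewrite !jB.
  have := i2 d m n x; rewrite /= -!jB !fmapM => e.
  apply: (iso_cancel_l (i := imap H' (ir U m (iinv (rt_r NK d n x))))) => /=.
  by rewrite [RHS]compA -e [RHS]compA nj2 -compA.
have nji c m : forall y, fwd (j m (c ▷ y)) ∘ fmap H (fwd (b2i U c m y)) =
    fmap H' (fwd (b2i U c m y)) ∘ fwd (j (m ◁ c) y).
  have on y z (u : hom y z) := inn_nat (b2_inn axU) (idm c) (idm m) u.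
  have rr := lin_exact_rex ((lact_exact (b_ax (rt_bim NK))).2 c).
  have := @rt_eq _ _ _ _ _ _ NK _
    (H ∘F (U ∘F insr (rt_bim NK) (m ◁ c)))
    ((H' ∘F (U ∘F insr (rt_bim NK) m)) ∘F (lact (rt_bim NK) ∘F insr (rt_bim NK) c))
    (fun y => fwd (j m (c ▷ y)) ∘ fmap H (fwd (b2i U c m y)))
    (fun y => fmap H' (fwd (b2i U c m y)) ∘ fwd (j (m ◁ c) y)); apply.
  - exact: rHU.
  - exact: lin_rex_comp (rHU _ _ _) rr.
  - move=> y z u; rewrite -compA.
    have := fsq H (on _ _ u); rewrite f21 => e; rewrite [X in _ ∘ X]e.
    by rewrite compA nj2 -compA.
  - move=> y z u; rewrite -compA [X in _ ∘ X]nj2.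
    by have := fsq H' (on _ _ u); rewrite f21 => e; rewrite compA e -compA.
  move=> n x; rewrite !jB.
  have := i3 c m n x; rewrite /= -!jB !fmapM => e.
  apply: (iso_cancel_l (i := imap H' (ir U m (iinv (rt_l NK c n x))))) => /=.
  by rewrite [RHS]compA -e [RHS]compA nj2 -compA.
have [|w [Ew uw]] := univ2_iso (i := j) rH rH'.
  split=> [m m' y y' f g|d m y|c m y] /=; [|exact: njo|exact: nji].
  change (fwd (j m' y') ∘ fmap H (fmap2 U f g) = fmap H' (fmap2 U f g) ∘ fwd (j m y)).
  have -> : fmap2 U f g = fmap2 U f (idm y') ∘ fmap2 U (idm m) g.
    by rewrite f2M comp1m compm1.
  by rewrite !fmapM compA nj1 -compA nj2 compA.
exists w; split=> [m n x|w' Ew']; first by rewrite Ew jB.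
apply: uw => m.
have := @rt_eq _ _ _ _ _ _ NK _
  (H ∘F (U ∘F insr (rt_bim NK) m)) (H' ∘F (U ∘F insr (rt_bim NK) m))
  (fun y => nti w' (U ⟨m, y⟩)) (fun y => fwd (j m y)); apply.
- exact: rHU.
- exact: rHU.
- by move=> y z u; exact: (nt_nat (fwd w') (fmap2 U (idm m) u)).
- exact: nj2.
- by move=> n x; rewrite Ew' jB.
Qed.

End Univ3.
End LiftR.

Section LiftL.
Variable (MN : reltensor M N).
Local Notation B := (so (rt_B MN)).

Definition insL : functor (M × N × K) (rt_bim MN × K).
Proof.
refine (@Functor (M × N × K) (rt_bim MN × K) (fun p => ⟨B (p1 p), p2 p⟩)
  (fun p q f => ⟨fmap2 B (p1 (p1 f)) (p2 (p1 f)), p2 f⟩) _ _).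
- by move=> p; apply: pr_ext => //=; exact: f21.
- by move=> p q r g f; apply: pr_ext => //=; rewrite f2M.
Defined.

Definition lift3L (A : lincat k) (V : bal2d (rt_bim MN) K A) : bal3d M N K A :=
  @Bal3Data k C D E M N K A (V ∘F insL)
    (fun n d m x => icomp (b2o V d (B ⟨m, n⟩) x) (il V x (rt_l MN d m n)))
    (fun x c m n => il V x (bRi B c m n))
    (fun m e n x => icomp (b2i V e (B ⟨m, n⟩) x) (il V x (rt_r MN e m n))).

End LiftL.
End Triple.

Section TripleMaps.
Variables (k : fieldType) (C D E : tencat k).
Variables (M : bimod D C) (N : bimod C E) (K : bimod E D).

Lemma cyc_LR (MN : reltensor M N) (MN_K : reltensor (rt_bim MN) K)
    (K_MN : reltensor K (rt_bim MN)) (T : cvtrace MN_K) (S : cvtrace K_MN)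
    (phi : cyc T S) :
  is_b3 (F := post3d_ob (lift3L (univ2 T)) phi)
    (G := switch12d_ob (lift3R (univ2 S)))
    (fun m n x => cyc_th phi (so (rt_B MN) ⟨m, n⟩) x).
Proof.
have [t1 t2 t3] := cyc_is_b2 phi.
split=> /=.
- by move=> m m' n n' x x' f g h; exact: t1.
- move=> d m n x; have := t1 _ _ _ _ (fwd (rt_l MN d m n)) (@idm K x) => /= e.
  by rewrite fmapM compA [X in X ∘ _]t2 -!compA e.
- by move=> c m n x; exact: t1 _ _ _ _ (fwd (bRi (so (rt_B MN)) c m n)) (@idm K x).
- move=> e m n x; have := t1 _ _ _ _ (fwd (rt_r MN e m n)) (@idm K x) => /= e'.
  by rewrite fmapM compA [X in X ∘ _]t3 -!compA e'.
Qed.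

Lemma cyc_RL (NK : reltensor N K) (M_NK : reltensor M (rt_bim NK))
    (NK_M : reltensor (rt_bim NK) M) (T : cvtrace M_NK) (S : cvtrace NK_M)
    (phi : cyc T S) :
  is_b3 (F := post3d_ob (lift3R (univ2 T)) phi)
    (G := switch21d_ob (lift3L (univ2 S)))
    (fun m n x => cyc_th phi m (so (rt_B NK) ⟨n, x⟩)).
Proof.
have [t1 t2 t3] := cyc_is_b2 phi.
split=> /=.
- by move=> m m' n n' x x' f g h; exact: t1.
- move=> d m n x; have := t1 _ _ _ _ (@idm M m) (bwd (rt_r NK d n x)) => /= e.
  by rewrite fmapM compA e -!compA; congr (_ ∘ _); exact: t2.
- move=> c m n x; have := t1 _ _ _ _ (@idm M m) (bwd (rt_l NK c n x)) => /= e'.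
  by rewrite fmapM compA e' -!compA; congr (_ ∘ _); rewrite [LHS]t3 /= -!compA.
- by move=> e m n x; exact: t1 _ _ _ _ (@idm M m) (fwd (bRi (so (rt_B NK)) e n x)).
Qed.

End TripleMaps.

Section TraceMap.
Variables (k : fieldType) (C : tencat k) (P Q : bimod C C) (f : bimfun P Q).
Variables (T : cvtrace P) (S : cvtrace Q) (t : trmap f T S).

Definition tm_at (x : P) : iso (t (so (tr_B T) x)) (so (tr_B S) (f x)).
Proof.
exists (tm_th t x) (nt (b1n (bwd (tm_iso t))) x).
- exact: (congr1 (fun a : bal1hom _ _ => b1n a x) (bwdK (tm_iso t))).
- exact: (congr1 (fun a : bal1hom _ _ => b1n a x) (fwdK (tm_iso t))).
Defined.

Lemma tm_nat (y z : P) (u : hom y z) :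
  tm_th t z ∘ fmap t (fmap (so (tr_B T)) u) =
  fmap (so (tr_B S)) (fmap f u) ∘ tm_th t y.
Proof. exact: (nt_nat (b1n (fwd (tm_iso t))) u). Qed.

Lemma tm_bal_bwd (y : P) (d : C) :
  tm_th t (y ◁ d) ∘ fmap t (bwd (b1b (so (tr_B T)) y d)) =
  fmap (so (tr_B S)) (bwd (bf_r f d y)) ∘ (bwd (b1b (so (tr_B S)) (f y) d) ∘
    (fmap (so (tr_B S)) (fwd (bf_l f d y)) ∘ tm_th t (d ▷ y))).
Proof.
have e : tm_th t (d ▷ y) ∘ fmap t (fwd (b1b (so (tr_B T)) y d)) =
    fmap (so (tr_B S)) (bwd (bf_l f d y)) ∘ (fwd (b1b (so (tr_B S)) (f y) d) ∘
    fmap (so (tr_B S)) (fwd (bf_r f d y))) ∘ tm_th t (y ◁ d).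
  exact: (b1n_bal (fwd (tm_iso t)) y d).
apply: (iso_cancel_r (i := imap t (b1b (so (tr_B T)) y d))).
rewrite -!compA (fwdK (imap t (b1b (so (tr_B T)) y d))) compm1 e -!compA.
rewrite (bwdKA (imap (so (tr_B S)) (bf_l f d y))) fwdKA.
by rewrite (fwdKA (imap (so (tr_B S)) (bf_r f d y))).
Qed.

End TraceMap.

Section Assoc.
Variables (k : fieldType) (C D E : tencat k).
Variables (M : bimod D C) (N : bimod C E) (K : bimod E D).
Variables (NK : reltensor N K) (R : reltensor M (rt_bim NK)).
Variables (MN : reltensor M N) (L : reltensor (rt_bim MN) K).
Variables (a : associator R L) (T : cvtrace R) (S : cvtrace L) (t : trmap a T S).

Definition as_at (m : M) (n : N) (x : K) :
    iso (t (univ2 T ⟨m, so (rt_B NK) ⟨n, x⟩⟩)) (univ2 S ⟨so (rt_B MN) ⟨m, n⟩, x⟩) :=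
  icomp (imap (so (tr_B S)) (as_iso a m n x)) (tm_at t _).

Lemma as_is_b3 :
  is_b3 (F := post3d_ob (lift3R (univ2 T)) t) (G := lift3L (univ2 S)) (as_th t).
Proof.
have tn := @tm_nat _ _ _ _ _ _ _ t.
rewrite /as_th; split=> /=.
- move=> m m' n n' x x' f g h.
  rewrite -!compA tn (cA _ (fsq (so (tr_B S)) (as_nat a f g h))) -!compA.
  by [].
- move=> d m n x; rewrite !fmapM -!compA.
  set y := so (rt_B R) ⟨m, so (rt_B NK) ⟨n, x⟩⟩.
  have e1 : fmap (so (tr_B S)) (fwd (as_iso a m n (x ◁ d))) ∘
      (fmap (so (tr_B S)) (fmap a (fmap2 (so (rt_B R)) (@idm M m) (bwd (rt_r NK d n x)))) ∘
      (fmap (so (tr_B S)) (fmap a (bwd (rt_r R d m (so (rt_B NK) ⟨n, x⟩)))) ∘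
      fmap (so (tr_B S)) (bwd (bf_r a d y)))) =
      fmap (so (tr_B S)) (bwd (rt_r L d (so (rt_B MN) ⟨m, n⟩) x)) ∘
      fmap (so (tr_B S)) (fwd (as_iso a m n x) ◁m @idm D d).
    rewrite -!fmapM; congr (fmap _ _).
    apply: (iso_cancel_l (i := rt_r L d (so (rt_B MN) ⟨m, n⟩) x)); rewrite bwdKA.
    have := as_r a d m n x; rewrite -!compA => e.
    rewrite compA -e -!compA.
    rewrite (cA _ (bwdK (imap a (ir (so (rt_B R)) m (rt_r NK d n x))))) comp1m.
    rewrite (bwdKA (imap a (rt_r R d m (so (rt_B NK) ⟨n, x⟩)))).
    by rewrite bwdK compm1.
  have e2 := nat_bwd (b1_nat (so_prf (tr_B S)) (fwd (as_iso a m n x)) (@idm D d)).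
  have e3 : fmap (so (tr_B S)) (@idm D d ▷m fwd (as_iso a m n x)) ∘
      (fmap (so (tr_B S)) (fwd (bf_l a d y)) ∘
      fmap (so (tr_B S)) (fmap a (fwd (rt_l R d m (so (rt_B NK) ⟨n, x⟩))))) =
      fmap (so (tr_B S)) (fwd (rt_l L d (so (rt_B MN) ⟨m, n⟩) x)) ∘
      (fmap (so (tr_B S)) (fmap2 (so (rt_B L)) (fwd (rt_l MN d m n)) (@idm K x)) ∘
      fmap (so (tr_B S)) (fwd (as_iso a (d ▷ m) n x))).
    rewrite -!fmapM; congr (fmap _ _).
    by have := as_l a d m n x; rewrite -!compA.
  rewrite (cA _ (tn _ _ _)) -!compA (cA _ (tn _ _ _)) -!compA.
  rewrite (cA _ (tm_bal_bwd _ _ _)) -!compA tn -/y.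
  rewrite !compA in e1; rewrite !compA e1 -!compA.
  by rewrite (cA _ (esym e2)) -!compA (cA3 _ e3) -!compA.
- move=> c m n x; rewrite fmapM -!compA (cA _ (tn _ _ _)) -!compA tn.
  have := as_bal2 a c m n x; rewrite -!compA => e.
  by rewrite !compA -!fmapM -!compA e.
- move=> e m n x; rewrite -!compA tn !compA -!fmapM (as_bal3 a).
  by rewrite -!compA.
Qed.

End Assoc.

Section Multiplication.
Variables (k : fieldType) (C D E : tencat k).
Variables (M : bimod D C) (N : bimod C E) (K : bimod E D).
Variables (MN : reltensor M N) (NK : reltensor N K) (KM : reltensor K M).
Variables (MN_K : reltensor (rt_bim MN) K) (M_NK : reltensor M (rt_bim NK)).
Variables (KM_N : reltensor (rt_bim KM) N) (K_MN : reltensor K (rt_bim MN)).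
Variables (NK_M : reltensor (rt_bim NK) M) (N_KM : reltensor N (rt_bim KM)).
Variables (T1 : cvtrace MN_K) (T1' : cvtrace M_NK).
Variables (T2 : cvtrace KM_N) (T2' : cvtrace K_MN).
Variables (T3 : cvtrace NK_M) (T3' : cvtrace N_KM).
Variables (a1 : associator M_NK MN_K) (t1 : trmap a1 T1' T1).
Variables (a2 : associator K_MN KM_N) (t2 : trmap a2 T2' T2).
Variables (a3 : associator N_KM NK_M) (t3 : trmap a3 T3' T3).
Variables (phi1 : cyc T1 T2') (phi2 : cyc T2 T3') (phi3 : cyc T1' T3).

Let H := t3 ∘F phi2 ∘F t2 ∘F phi1 ∘F t1.

Let i5 m n x : iso (H (univ2 T1' ⟨m, so (rt_B NK) ⟨n, x⟩⟩))
    (univ2 T3 ⟨so (rt_B NK) ⟨n, x⟩, m⟩) :=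
  icomp (as_at t3 n x m) (imap t3 (icomp (cyc_at phi2 (so (rt_B KM) ⟨x, m⟩) n)
    (imap phi2 (icomp (as_at t2 x m n) (imap t2
      (icomp (cyc_at phi1 (so (rt_B MN) ⟨m, n⟩) x) (imap phi1 (as_at t1 m n x)))))))).

Let i5_b3 : is_b3 (F := post3d_ob (lift3R (univ2 T1')) H)
  (G := switch21d_ob (lift3L (univ2 T3))) (fun m n x => fwd (i5 m n x)).
Proof.
have q1 := as_is_b3 t1.
pose i2 m n x := icomp (cyc_at phi1 (so (rt_B MN) ⟨m, n⟩) x) (imap phi1 (as_at t1 m n x)).
have q2 : is_b3 (F := post3d_ob (lift3R (univ2 T1')) (phi1 ∘F t1))
    (G := switch12d_ob (lift3R (univ2 T2'))) (fun m n x => fwd (i2 m n x)).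
  exact: (is_b3_comp (F := post3d_ob (lift3R (univ2 T1')) (phi1 ∘F t1))
    (G := post3d_ob (lift3L (univ2 T1)) phi1) (is_b3_post phi1 q1) (cyc_LR phi1)).
pose i3 m n x := icomp (as_at t2 x m n) (imap t2 (i2 m n x)).
have q3 : is_b3 (F := post3d_ob (lift3R (univ2 T1')) (t2 ∘F phi1 ∘F t1))
    (G := switch12d_ob (lift3L (univ2 T2))) (fun m n x => fwd (i3 m n x)).
  exact: (is_b3_comp (F := post3d_ob (lift3R (univ2 T1')) (t2 ∘F phi1 ∘F t1))
    (G := post3d_ob (switch12d_ob (lift3R (univ2 T2'))) t2) (is_b3_post t2 q2)
    (is_b3_switch12 (as_is_b3 t2))).
pose i4 m n x := icomp (cyc_at phi2 (so (rt_B KM) ⟨x, m⟩) n) (imap phi2 (i3 m n x)).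
have q4 : is_b3 (F := post3d_ob (lift3R (univ2 T1')) (phi2 ∘F t2 ∘F phi1 ∘F t1))
    (G := switch12d_ob (switch12d_ob (lift3R (univ2 T3')))) (fun m n x => fwd (i4 m n x)).
  exact: (is_b3_comp (F := post3d_ob (lift3R (univ2 T1')) (phi2 ∘F t2 ∘F phi1 ∘F t1))
    (G := post3d_ob (switch12d_ob (lift3L (univ2 T2))) phi2) (is_b3_post phi2 q3)
    (is_b3_switch12 (cyc_LR phi2))).
exact: (is_b3_comp (F := post3d_ob (lift3R (univ2 T1')) H)
    (G := post3d_ob (switch12d_ob (switch12d_ob (lift3R (univ2 T3')))) t3) (is_b3_post t3 q4)
    (is_b3_switch12 (is_b3_switch12 (as_is_b3 t3)))).
Qed.

Lemma cyc_mult : exists! w : H ≅ phi3, forall (m : M) (n : N) (x : K),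
  cyc_th phi3 m (so (rt_B NK) ⟨n, x⟩) ∘ nti w (univ2 T1' ⟨m, so (rt_B NK) ⟨n, x⟩⟩) =
  fwd (i5 m n x).
Proof.
pose i m n x := icomp (iinv (cyc_at phi3 m (so (rt_B NK) ⟨n, x⟩))) (i5 m n x).
have := @univ3_iso _ _ _ _ _ _ _ _ _ T1' _ H phi3 i.
case.
- do !apply: lin_rex_comp; do ?[exact: tm_rex | exact: cyc_rex].
- exact: cyc_rex.
- apply: (is_b3_comp (F := post3d_ob (lift3R (univ2 T1')) H)
    (G := switch21d_ob (lift3L (univ2 T3))) (H := post3d_ob (lift3R (univ2 T1')) phi3)
    (s := fun m n x => bwd (cyc_at phi3 m (so (rt_B NK) ⟨n, x⟩))) i5_b3).
  exact: (is_b3_inv (F := post3d_ob (lift3R (univ2 T1')) phi3)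
    (G := switch21d_ob (lift3L (univ2 T3)))
    (i := fun m n x => cyc_at phi3 m (so (rt_B NK) ⟨n, x⟩)) (cyc_RL phi3)).
move=> w [Ew uw]; exists w; split=> [m n x|w' Ew'].
  rewrite Ew; exact: (bwdKA (cyc_at phi3 m _)).
apply: uw => m n x; apply: (iso_cancel_l (i := cyc_at phi3 m (so (rt_B NK) ⟨n, x⟩))).
by rewrite [LHS]Ew' [RHS](bwdKA (cyc_at phi3 m _)).
Qed.

End Multiplication.

(** * Unit equivalences *)

Lemma cA4 (X : cat) (u v w x y z : X) (f : hom y z) (g : hom x y) (h : hom w x)
    (l : hom v w) (r : hom v z) (e : hom u v) :
  f ∘ (g ∘ (h ∘ l)) = r -> f ∘ (g ∘ (h ∘ (l ∘ e))) = r ∘ e.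
Proof. by move=> <-; rewrite !compA. Qed.

Lemma is_equiv_comp (X Y Z : cat) (G : functor Y Z) (F : functor X Y) :
  is_equiv F -> is_equiv G -> is_equiv (G ∘F F).
Proof.
move=> [F' [[uF] [cF]]] [G' [[uG] [cG]]]; exists (F' ∘F G'); split; constructor.
- apply: (@funct_iso _ _ (fid X) (F' ∘F G' ∘F (G ∘F F))
    (fun x => icomp (imap F' (funct_iso_at uG (F x))) (funct_iso_at uF x))) => x y f /=.
  rewrite -compA [X in _ ∘ X](nt_nat (fwd uF) f) !compA; congr (_ ∘ _).
  exact: fsq (nt_nat (fwd uG) (fmap F f)).
- apply: (@funct_iso _ _ (G ∘F F ∘F (F' ∘F G')) (fid Z)
    (fun z => icomp (funct_iso_at cG z) (imap G (funct_iso_at cF (G' z))))) => x y f /=.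
  rewrite -compA.
  have /= -> := fsq G (nt_nat (fwd cF) (fmap G' f)).
  by rewrite !compA; congr (_ ∘ _); exact: (nt_nat (fwd cG) f).
Qed.

Lemma is_equiv_retraction (X Y : cat) (F : functor Y X) (G : functor X Y) :
  is_equiv G -> F ∘F G ≅ fid X -> is_equiv F.
Proof.
move=> [G' [_ [c]]] r; exists G; split; constructor; last exact: r.
have cn x y (f : hom x y) : nt (fwd c) y ∘ fmap G (fmap G' f) = f ∘ nt (fwd c) x.
  exact: (nt_nat (fwd c) f).
have rn x y (f : hom x y) : nt (fwd r) y ∘ fmap F (fmap G f) = f ∘ nt (fwd r) x.
  exact: (nt_nat (fwd r) f).
pose i y := icomp (icomp (imap G (imap F (funct_iso_at c y)))
  (imap G (iinv (funct_iso_at r (G' y))))) (iinv (funct_iso_at c y)).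
apply: (@funct_iso _ _ (fid Y) (G ∘F F) i) => x y f /=.
rewrite -!compA.
have e1 : nt (bwd c) y ∘ f = fmap G (fmap G' f) ∘ nt (bwd c) x.
  exact: (nat_bwd (i := funct_iso_at c x) (j := funct_iso_at c y) (cn _ _ f)).
have e2 := fmap_shift G (i := funct_iso_at r (G' y)) (j := funct_iso_at r (G' x)) (rn _ _ (fmap G' f)).
have e3 := fsq G (fsq F (cn _ _ f)).
by rewrite e1 [X in _ ∘ X](cA _ e2) -!compA (cA _ e3) -!compA.
Qed.

Definition fullsub_iso (X : cat) (P : X -> Prop) (x y : fullsub P) (i : iso (so x) (so y)) :
  iso x y := @Iso (fullsub P) x y (fwd i) (bwd i) (bwdK i) (fwdK i).

Lemma lunit_mid (k : fieldType) (C D : tencat k) (M : bimod C D) (m : M) (d : D) :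
  fwd (lunit (m ◁ d)) ∘ fwd (bmid (tone C) m d) = fwd (lunit m) ◁m idm d.
Proof.
have axM := b_ax M; apply: lunit_inj.
apply: (iso_cancel_r (i := icomp (bmid (tone C) (tone C ▷ m) d)
  (il (ract M) d (lassoc (tone C) (tone C) m)))) => /=.
rewrite f2r -!compA; have := lmid_pentagon axM (tone C) (tone C) m d.
rewrite -!compA => ->; rewrite (cA _ (l_triangle axM _ _)).
rewrite (cA _ (esym (bmid_nat axM _ _ _))) -compA -f2l (l_triangle axM).
by rewrite -(f21 (ract M)) (bmid_nat axM).
Qed.

Section UnitEquiv.
Variables (k : fieldType) (C : tencat k) (M : bimod C C) (A : lincat k).

Definition b1_iso (F G : bal1d M A) (i : forall m, iso (F m) (G m))
  (inat : forall m m' (f : hom m m'), fwd (i m') ∘ fmap F f = fmap G f ∘ fwd (i m))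
  (ibal : forall m c, fwd (i (c ▷ m)) ∘ fwd (b1b F m c) = fwd (b1b G m c) ∘ fwd (i (m ◁ c))) :
  @iso (Bal1d M A) F G.
Proof.
refine (@Iso (Bal1d M A) F G
  (@Bal1Hom _ _ _ _ F G (@NatTrans _ _ F G (fun m => fwd (i m)) inat) ibal)
  (@Bal1Hom _ _ _ _ G F
    (@NatTrans _ _ G F (fun m => bwd (i m)) (fun m m' f => nat_bwd (inat m m' f)))
    (fun m c => nat_bwd (ibal m c))) _ _).
- by apply: bal1hom_ext => p; exact: bwdK.
- by apply: bal1hom_ext => p; exact: fwdK.
Defined.

Lemma phi_retraction_bal (F : bal1d M A) : is_bal1 F -> forall m c,
  fmap F (fwd (lunit (c ▷ m))) ∘
    fwd (b1b (phi2d_ob (switchd_ob (phi1d_ob F))) m c) =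
  fwd (b1b F m c) ∘ fmap F (fwd (lunit (m ◁ c))).
Proof.
move=> ax m c /=; have axM := b_ax M.
have e1 : fmap F (fwd (lunit (c ▷ m))) ∘ (fmap F (fwd (lassoc (tone C) c m)) ∘
    (fmap F ((bwd (tlun c) ∘ fwd (trun c)) ▷m idm m) ∘
    fmap F (bwd (lassoc c (tone C) m)))) = fmap F (idm c ▷m fwd (lunit m)).
  rewrite -!fmapM; congr (fmap F _); rewrite (cA _ (lunitM _ _)) f2l !compA.
  rewrite -f2l bwdK f21 comp1m -(l_triangle axM).
  by rewrite -compA bwdK compm1.
have e2 : fmap F (fwd (lunit m) ◁m idm c) ∘ fmap F (bwd (bmid (tone C) m c)) =
    fmap F (fwd (lunit (m ◁ c))).
  by rewrite -fmapM -lunit_mid -compA bwdK compm1.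
rewrite !compA in e1; rewrite !compA e1 -!compA.
by rewrite (cA _ (esym (b1_nat ax _ _))) -compA e2.
Qed.

Lemma phi_retraction :
  exists w : phi2 M A ∘F switch (regbim C) M A ∘F phi1 M A ≅ fid (Bal1 M A),
    forall (F : Bal1 M A) (m : M), nt (b1n (nti w F)) m = fmap (so F) (fwd (lunit m)).
Proof.
have axM := b_ax M.
pose i (F : Bal1 M A) : iso ((phi2 M A ∘F switch (regbim C) M A ∘F phi1 M A) F) F :=
  @fullsub_iso (Bal1d M A) (@is_bal1 k C M A)
    ((phi2 M A ∘F switch (regbim C) M A ∘F phi1 M A) F) F
    (b1_iso (F := phi2d_ob (switchd_ob (phi1d_ob (so F)))) (G := so F)
    (i := fun m => imap (so F) (lunit m))
    (fun m m' f => fsq (so F) (lunit_nat axM f)) (phi_retraction_bal (so_prf F))).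
unshelve eexists (@funct_iso _ _ _ (fid (Bal1 M A)) i _); last by [].
by move=> F G a; apply: bal1hom_ext => m; exact: (esym (nt_nat (b1n a) _)).
Qed.

End UnitEquiv.

Section UnitSection.
Variables (k : fieldType) (C : tencat k) (M : bimod C C) (A : lincat k).

Definition unit_at (G : bal2d (regbim C) M A) (c : C) (m : M) :
    iso (G ⟨tone C, c ▷ m⟩) (G ⟨c, m⟩) :=
  icomp (il G m (tlun c)) (iinv (b2i G c (tone C) m)).

Lemma unit_at_lassoc (G : bal2d (regbim C) M A) : is_bal2 G -> forall (c d : C) (m : M),
  bwd (b2i G c (tone C) (d ▷ m)) ∘ fmap2 G (idm (tone C)) (fwd (lassoc c d m)) =
  fwd (b2i G d (tone C ⊗ c) m) ∘ (fmap2 G (bwd (tassoc (tone C) c d)) (idm m) ∘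
    bwd (b2i G (c ⊗ d) (tone C) m)).
Proof.
move=> ax c d m.
apply: (iso_cancel_l (i := b2i G c (tone C) (d ▷ m))); rewrite bwdKA.
apply: (iso_cancel_r (i := b2i G (c ⊗ d) (tone C) m)).
rewrite -!compA fwdK compm1.
by have := inn_pentagon (b2_inn ax) c d (tone C) m; rewrite -!compA => ->.
Qed.

Lemma tlunM_bwd (c d : C) :
  (fwd (tlun c) ⊗m idm d) ∘ bwd (tassoc (tone C) c d) = fwd (tlun (c ⊗ d)).
Proof. by rewrite -(tlunM (ten_mon (t_ax C))) -compA bwdK compm1. Qed.

Lemma unit_at_out (G : bal2d (regbim C) M A) : is_bal2 G -> forall (b c : C) (m : M),
  fwd (unit_at G c (m ◁ b)) ∘ fwd (b2o (phi1d_ob (phi2d_ob (switchd_ob G))) b c m) =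
  fwd (b2o G b c m) ∘ fwd (unit_at G (b ⊗ c) m).
Proof.
move=> ax b c m; have monC := ten_mon (t_ax C).
have e1 := unit_at_lassoc ax b c m.
have e2 : fmap2 G (bwd (trun b) ∘ fwd (tlun b)) (idm (c ▷ m)) ∘
    fwd (b2i G c (tone C ⊗ b) m) =
    fwd (b2i G c (b ⊗ tone C) m) ∘ fmap2 G ((bwd (trun b) ∘ fwd (tlun b)) ⊗m idm c) (idm m).
  have := inn_nat (b2_inn ax) (idm c) (bwd (trun b) ∘ fwd (tlun b)) (idm m).
  by rewrite f21 => ->.
have e3 : bwd (b2i G c (tone C) (m ◁ b)) ∘ (fmap2 G (idm (tone C)) (fwd (bmid c m b)) ∘
    (fwd (b2o G b (tone C) (c ▷ m)) ∘ fwd (b2i G c (b ⊗ tone C) m))) =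
    fwd (b2o G b (tone C ⊗ c) m) ∘ fmap2 G (fwd (tassoc b (tone C) c)) (idm m).
  have := b2_compat ax b c (tone C) m; rewrite -!compA => ->.
  by rewrite fwdKA.
have e4 : fmap2 G (fwd (tlun c)) (idm (m ◁ b)) ∘ fwd (b2o G b (tone C ⊗ c) m) =
    fwd (b2o G b c m) ∘ fmap2 G (idm b ⊗m fwd (tlun c)) (idm m).
  by have := out_nat (b2_out ax) (idm b) (fwd (tlun c)) (idm m); rewrite f21 => ->.
have e5 : fmap2 G (idm b ⊗m fwd (tlun c)) (idm m) ∘
    (fmap2 G (fwd (tassoc b (tone C) c)) (idm m) ∘
    (fmap2 G ((bwd (trun b) ∘ fwd (tlun b)) ⊗m idm c) (idm m) ∘
    fmap2 G (bwd (tassoc (tone C) b c)) (idm m))) = fmap2 G (fwd (tlun (b ⊗ c))) (idm m).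
  rewrite -!f2l; congr (fmap2 G _ _).
  rewrite (cA _ (t_triangle monC _ _)) compA -f2l (compA (fwd _)) bwdK comp1m.
  exact: tlunM_bwd.
rewrite /= -!compA [X in _ ∘ (_ ∘ (_ ∘ (_ ∘ (_ ∘ X))))]e1.
rewrite (cA _ e2) -!compA.
by rewrite (cA4 _ e3) -!compA (cA _ e4) -!compA (cA4 _ e5).
Qed.

Lemma unit_at_b2 (G : bal2d (regbim C) M A) : is_bal2 G ->
  is_b2 (F := phi1d_ob (phi2d_ob (switchd_ob G))) (G := G) (fun c m => fwd (unit_at G c m)).
Proof.
move=> ax; have axM := b_ax M; have monC := ten_mon (t_ax C).
split=> /=.
- move=> c c' m m' f g; rewrite -!compA.
  have e := nat_bwd (inn_nat (b2_inn ax) f (idm (tone C)) g).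
  rewrite [X in _ ∘ X]e !compA !f2M comp1m compm1.
  by rewrite [X in fmap2 G X _](tlun_nat monC).
- exact: unit_at_out.
- move=> d c m; rewrite -!compA.
  rewrite [X in _ ∘ X](unit_at_lassoc ax c d m).
  have := inn_nat (b2_inn ax) (@idm C d) (fwd (tlun c)) (@idm M m); rewrite f21 => /= e.
  rewrite (cA _ (esym e)) -!compA; congr (_ ∘ _).
  by rewrite compA -f2l tlunM_bwd.
Qed.

End UnitSection.

Section PhiEquiv.
Variables (k : fieldType) (C : tencat k) (M : bimod C C) (A : lincat k).

Lemma phi_section :
  phi1 M A ∘F (phi2 M A ∘F switch (regbim C) M A) ≅ fid (Bal2 (regbim C) M A).
Proof.
pose i (G : Bal2 (regbim C) M A) :
    iso ((phi1 M A ∘F (phi2 M A ∘F switch (regbim C) M A)) G) G :=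
  @fullsub_iso (Bal2d (regbim C) M A) (@is_bal2 k C C (regbim C) M A)
    ((phi1 M A ∘F (phi2 M A ∘F switch (regbim C) M A)) G) G (b2_iso (unit_at_b2 (so_prf G))).
apply: (@funct_iso _ _ _ (fid (Bal2 (regbim C) M A)) i) => F G a.
apply: bal2hom_ext => p /=; rewrite -!compA.
have e := nat_bwd (esym (b2n_inn a (p1 p) (tone C) (p2 p))).
rewrite [X in _ ∘ X]e !compA; congr (_ ∘ _); exact: (esym (nt_nat (b2n a) _)).
Qed.

Lemma phi1_equiv : is_equiv (phi1 M A).
Proof.
have [w _] := phi_retraction M A.
exists (phi2 M A ∘F switch (regbim C) M A); split; constructor.
- exact: iinv w.
- exact: phi_section.
Qed.

Lemma phi2_equiv : is_equiv (phi2 M A).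
Proof.
have [w _] := phi_retraction M A.
apply: (@is_equiv_retraction _ _ (phi2 M A) (switch (regbim C) M A ∘F phi1 M A)).
  exact: is_equiv_comp phi1_equiv (switch_equiv _ _ _).
exact: (@funct_iso _ _ (phi2 M A ∘F (switch (regbim C) M A ∘F phi1 M A)) (fid (Bal1 M A))
  (funct_iso_at w) (fun x y f => nt_nat (fwd w) f)).
Qed.

End PhiEquiv.

Section UnitTrace.
Variables (k : fieldType) (C : tencat k) (M : bimod C C) (T : cvtrace M).

Section Left.
Variables (CM : reltensor (regbim C) M) (T1 : cvtrace CM) (l : lunitor CM).
Variable (u : trmap l T1 T).

Definition lu_at (c : C) (m : M) : iso (u (univ2 T1 ⟨c, m⟩)) (so (tr_B T) (c ▷ m)) :=
  icomp (imap (so (tr_B T)) (lu_iso l c m)) (tm_at u (so (rt_B CM) ⟨c, m⟩)).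

Lemma lu_at_out (d c : C) (m : M) :
  fwd (lu_at c (m ◁ d)) ∘ fwd (b2o (post2d_ob (univ2 T1) u) d c m) =
  fwd (b2o (phi1d_ob (so (tr_B T))) d c m) ∘ fwd (lu_at (d ⊗ c) m).
Proof.
rewrite /= !fmapM -!compA (cA _ (tm_nat u _)) -!compA (cA _ (tm_bal_bwd u _ _)).
rewrite -!compA (tm_nat u).
have e1 : fmap (so (tr_B T)) (fwd (lu_iso l c (m ◁ d))) ∘
    (fmap (so (tr_B T)) (fmap l (bwd (rt_r CM d c m))) ∘
    fmap (so (tr_B T)) (bwd (bf_r l d (so (rt_B CM) ⟨c, m⟩)))) =
    fmap (so (tr_B T)) (fwd (bmid c m d)) ∘
    fmap (so (tr_B T)) (fwd (lu_iso l c m) ◁m idm d).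
  rewrite -!fmapM; congr (fmap _ _); rewrite -(lu_r l) -!compA.
  rewrite (bwdKA (imap l (rt_r CM d c m))) bwdK compm1.
  by [].
have e2 := nat_bwd (b1_nat (so_prf (tr_B T)) (fwd (lu_iso l c m)) (idm d)).
have e3 : fmap (so (tr_B T)) (idm d ▷m fwd (lu_iso l c m)) ∘
    (fmap (so (tr_B T)) (fwd (bf_l l d (so (rt_B CM) ⟨c, m⟩))) ∘
    fmap (so (tr_B T)) (fmap l (fwd (rt_l CM d c m)))) =
    fmap (so (tr_B T)) (fwd (lassoc d c m)) ∘ fmap (so (tr_B T)) (fwd (lu_iso l (d ⊗ c) m)).
  by rewrite -!fmapM -(lu_l l) -!compA.
by rewrite (cA3 _ e1) -!compA (cA _ (esym e2)) -!compA (cA3 _ e3) -!compA.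
Qed.

Lemma lu_at_b2 : is_b2 (F := post2d_ob (univ2 T1) u) (G := phi1d_ob (so (tr_B T)))
  (fun c m => fwd (lu_at c m)).
Proof.
split.
- move=> c c' m m' f g; rewrite /= -!compA (tm_nat u).
  by rewrite (cA _ (fsq (so (tr_B T)) (lu_nat l f g))) -!compA.
- exact: lu_at_out.
- move=> d c m; rewrite /= -!compA (tm_nat u).
  by rewrite (cA _ (fsq (so (tr_B T)) (lu_bal l d c m))) -!compA.
Qed.

End Left.

Section Right.
Variables (MC : reltensor M (regbim C)) (T2 : cvtrace MC) (r : runitor MC).
Variable (u : trmap r T2 T).

Definition ru_at (m : M) (c : C) : iso (u (univ2 T2 ⟨m, c⟩)) (so (tr_B T) (c ▷ m)) :=
  icomp (b1b (so (tr_B T)) m c)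
    (icomp (imap (so (tr_B T)) (ru_iso r m c)) (tm_at u (so (rt_B MC) ⟨m, c⟩))).

Lemma ru_at_out (c : C) (m : M) (x : C) :
  fwd (ru_at m (x ⊗ c)) ∘ fwd (b2o (post2d_ob (univ2 T2) u) c m x) =
  fwd (b2o (switchd_ob (phi1d_ob (so (tr_B T)))) c m x) ∘ fwd (ru_at (c ▷ m) x).
Proof.
rewrite /= !fmapM -!compA (cA _ (tm_nat u _)) -!compA (cA _ (tm_bal_bwd u _ _)).
rewrite -!compA (tm_nat u).
have e1 : fmap (so (tr_B T)) (fwd (ru_iso r m (x ⊗ c))) ∘
    (fmap (so (tr_B T)) (fmap r (bwd (rt_r MC c m x))) ∘
    fmap (so (tr_B T)) (bwd (bf_r r c (so (rt_B MC) ⟨m, x⟩)))) =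
    fmap (so (tr_B T)) (bwd (rassoc m x c)) ∘
    fmap (so (tr_B T)) (fwd (ru_iso r m x) ◁m idm c).
  rewrite -!fmapM; congr (fmap _ _).
  apply: (iso_cancel_l (i := rassoc m x c)); rewrite bwdKA.
  have := ru_r r c x m; rewrite -!compA => e; rewrite (compA (fwd (rassoc _ _ _))) -e -!compA.
  rewrite (bwdKA (imap r (rt_r MC c m x))) bwdK compm1.
  by [].
have e2 := nat_bwd (b1_nat (so_prf (tr_B T)) (fwd (ru_iso r m x)) (idm c)).
have e3 : fmap (so (tr_B T)) (idm c ▷m fwd (ru_iso r m x)) ∘
    (fmap (so (tr_B T)) (fwd (bf_l r c (so (rt_B MC) ⟨m, x⟩))) ∘
    fmap (so (tr_B T)) (fmap r (fwd (rt_l MC c m x)))) =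
    fmap (so (tr_B T)) (fwd (bmid c m x)) ∘ fmap (so (tr_B T)) (fwd (ru_iso r (c ▷ m) x)).
  by rewrite -!fmapM -(ru_l r) -!compA.
have e4 : fwd (b1b (so (tr_B T)) m (x ⊗ c)) ∘ (fmap (so (tr_B T)) (bwd (rassoc m x c)) ∘
    (bwd (b1b (so (tr_B T)) (m ◁ x) c) ∘ fmap (so (tr_B T)) (fwd (bmid c m x)))) =
    fmap (so (tr_B T)) (bwd (lassoc x c m)) ∘ fwd (b1b (so (tr_B T)) (c ▷ m) x).
  apply: (iso_cancel_l (i := imap (so (tr_B T)) (lassoc x c m))).
  rewrite (bwdKA (imap (so (tr_B T)) (lassoc x c m))).
  rewrite (cA _ (b1_pentagon (so_prf (tr_B T)) _ _ _)) -!compA.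
  rewrite (bwdKA (imap (so (tr_B T)) (rassoc m x c))) bwdKA.
  by rewrite (fwdK (imap (so (tr_B T)) (bmid c m x))) compm1.
rewrite (cA3 _ e1) -!compA (cA _ (esym e2)) -!compA (cA3 _ e3) -!compA.
by rewrite (cA4 _ e4) -!compA.
Qed.

Lemma ru_at_inn (d : C) (m : M) (x : C) :
  fwd (ru_at m (d ⊗ x)) ∘ fwd (b2i (post2d_ob (univ2 T2) u) d m x) =
  fwd (b2i (switchd_ob (phi1d_ob (so (tr_B T)))) d m x) ∘ fwd (ru_at (m ◁ d) x).
Proof.
rewrite /= -!compA (tm_nat u).
have e1 : fmap (so (tr_B T)) (fwd (ru_iso r m (d ⊗ x))) ∘
    fmap (so (tr_B T)) (fmap r (fwd (bRi (so (rt_B MC)) d m x))) =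
    fmap (so (tr_B T)) (bwd (rassoc m d x)) ∘ fmap (so (tr_B T)) (fwd (ru_iso r (m ◁ d) x)).
  by rewrite -!fmapM -(ru_bal r) -!compA fwdKA.
have e2 : fwd (b1b (so (tr_B T)) m (d ⊗ x)) ∘ fmap (so (tr_B T)) (bwd (rassoc m d x)) =
    fmap (so (tr_B T)) (bwd (lassoc d x m)) ∘ (fwd (b1b (so (tr_B T)) (x ▷ m) d) ∘
    (fmap (so (tr_B T)) (bwd (bmid x m d)) ∘ fwd (b1b (so (tr_B T)) (m ◁ d) x))).
  apply: (iso_cancel_l (i := imap (so (tr_B T)) (lassoc d x m))).
  rewrite (bwdKA (imap (so (tr_B T)) (lassoc d x m))).
  rewrite (cA _ (b1_pentagon (so_prf (tr_B T)) _ _ _)) -!compA.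
  by rewrite (bwdK (imap (so (tr_B T)) (rassoc m d x))) compm1.
by rewrite (cA _ e1) -!compA (cA _ e2) -!compA.
Qed.

Lemma ru_at_b2 :
  is_b2 (F := post2d_ob (univ2 T2) u) (G := switchd_ob (phi1d_ob (so (tr_B T))))
    (fun m c => fwd (ru_at m c)).
Proof.
split.
- move=> m m' c c' f g; rewrite /= -!compA (tm_nat u).
  rewrite (cA _ (fsq (so (tr_B T)) (ru_nat r f g))) -!compA.
  by rewrite (cA _ (b1_nat (so_prf (tr_B T)) _ _)) -!compA.
- exact: ru_at_out.
- exact: ru_at_inn.
Qed.

End Right.

(* [<c, m>] is isomorphic to [<1 ⊗ c, m>] and hence to [<1, c ▷ m>]. *)
Lemma univ2_unit_eq (CM : reltensor (regbim C) M) (T1 : cvtrace CM) (A : lincat k)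
    (H H' : functor T1 A) (w w' : nat_trans H H') :
  (forall m, w (univ2 T1 ⟨tone C, m⟩) = w' (univ2 T1 ⟨tone C, m⟩)) ->
  forall c m, w (univ2 T1 ⟨c, m⟩) = w' (univ2 T1 ⟨c, m⟩).
Proof.
move=> e c m.
apply: (iso_cancel_r (i := imap H (unit_at (univ2 T1) c m))).
by rewrite [LHS](nt_nat w) [RHS](nt_nat w') [X in _ ∘ X]e.
Qed.

Lemma cyc_unit (CM : reltensor (regbim C) M) (MC : reltensor M (regbim C))
    (T1 : cvtrace CM) (T2 : cvtrace MC)
    (l : lunitor CM) (u1 : trmap l T1 T) (r : runitor MC) (u2 : trmap r T2 T)
    (phi : cyc T1 T2) :
  exists! w : u2 ∘F phi ≅ u1, forall m : M,
    fmap (so (tr_B T)) (fwd (lunit m) ∘ fwd (lu_iso l (tone C) m)) ∘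
      tm_th u1 (so (rt_B CM) ⟨tone C, m⟩) ∘ nti w (univ2 T1 ⟨tone C, m⟩) =
    fmap (so (tr_B T)) (fwd (runit m) ∘ fwd (ru_iso r m (tone C))) ∘
      tm_th u2 (so (rt_B MC) ⟨m, tone C⟩) ∘ fmap u2 (cyc_th phi (tone C) m).
Proof.
pose i c m := icomp (iinv (lu_at u1 c m)) (icomp (ru_at u2 m c) (imap u2 (cyc_at phi c m))).
have := @univ2_iso _ _ _ _ _ _ T1 _ (u2 ∘F phi) u1 i.
case.
- exact: lin_rex_comp (tm_rex u2) (cyc_rex phi).
- exact: tm_rex.
- apply: (is_b2_comp (F := post2d_ob (univ2 T1) (u2 ∘F phi)) (G := phi1d_ob (so (tr_B T)))
    (H := post2d_ob (univ2 T1) u1)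
    (t := fun c m => fwd (ru_at u2 m c) ∘ fmap u2 (cyc_th phi c m))
    (s := fun c m => bwd (lu_at u1 c m))).
  + apply: (is_b2_comp (F := post2d_ob (univ2 T1) (u2 ∘F phi))
      (G := post2d_ob (switchd_ob (univ2 T2)) u2)
      (H := switchd_ob (switchd_ob (phi1d_ob (so (tr_B T)))))
      (t := fun c m => fmap u2 (cyc_th phi c m)) (s := fun c m => fwd (ru_at u2 m c))).
    * exact: (is_b2_post u2 (cyc_is_b2 phi)).
    * exact: (is_b2_switch (ru_at_b2 u2)).
  + exact: (is_b2_inv (F := post2d_ob (univ2 T1) u1) (G := phi1d_ob (so (tr_B T)))
      (i := fun c m => lu_at u1 c m) (lu_at_b2 u1)).
have iP m (f : hom (u2 (phi (univ2 T1 ⟨tone C, m⟩))) (u1 (univ2 T1 ⟨tone C, m⟩))) :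
    fmap (so (tr_B T)) (fwd (lunit m) ∘ fwd (lu_iso l (tone C) m)) ∘
      tm_th u1 (so (rt_B CM) ⟨tone C, m⟩) ∘ f =
    fmap (so (tr_B T)) (fwd (runit m) ∘ fwd (ru_iso r m (tone C))) ∘
      tm_th u2 (so (rt_B MC) ⟨m, tone C⟩) ∘ fmap u2 (cyc_th phi (tone C) m) <->
    f = fwd (i (tone C) m).
  rewrite !fmapM -(b1_triangle (so_prf (tr_B T)) m).
  split=> [e|->].
    apply: (iso_cancel_l (i := icomp (imap (so (tr_B T)) (lunit m)) (lu_at u1 (tone C) m))).
    rewrite /= -!compA in e; rewrite /= -!compA e.
    by rewrite (bwdKA (tm_at u1 _)) (bwdKA (imap (so (tr_B T)) (lu_iso l _ _))).
  rewrite /= -!compA.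
  by rewrite (bwdKA (tm_at u1 _)) (bwdKA (imap (so (tr_B T)) (lu_iso l _ _))).
move=> w [Ew uw]; exists w; split=> [m|w' Ew']; first by apply/iP; exact: Ew.
apply: uw => c m; rewrite -Ew; apply: univ2_unit_eq => x.
by rewrite [RHS]Ew; apply/iP; exact: Ew'.
Qed.

End UnitTrace.

Theorem proposition5p11 (k : fieldType) (C D E : tencat k) :
  (forall (M : bimod C D) (N : bimod D C) (A : lincat k),
     is_equiv (switch M N A) /\
     switch N M A ∘F switch M N A = fid (Bal2 M N A))
  /\
  (forall (M : bimod C D) (N : bimod D C)
     (MN : reltensor M N) (T : cvtrace MN) (NM : reltensor N M) (S : cvtrace NM),
     [/\ inhabited (cyc T S),
         forall phi : cyc T S, is_equiv phi,
         forall phi phi' : cyc T S,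
           exists! w : phi ≅ phi', forall (m : M) (n : N),
             cyc_th phi' m n ∘ nti w (univ2 T ⟨m, n⟩) = cyc_th phi m n
       & forall (phi : cyc T S) (psi : cyc S T),
           exists! w : psi ∘F phi ≅ fid T, forall (m : M) (n : N),
             nti w (univ2 T ⟨m, n⟩) = cyc_th psi n m ∘ fmap psi (cyc_th phi m n)])
  /\
  (forall (M : bimod D C) (N : bimod C E) (K : bimod E D),
     (forall A : lincat k,
        [/\ is_equiv (switch21 M N K A), is_equiv (switch12 M N K A)
          & switch21 K M N A ∘F switch21 M N K A = switch12 M N K A])
     /\
     (forall (MN : reltensor M N) (NK : reltensor N K) (KM : reltensor K M)
        (MN_K : reltensor MN K) (M_NK : reltensor M NK)
        (KM_N : reltensor KM N) (K_MN : reltensor K MN)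
        (NK_M : reltensor NK M) (N_KM : reltensor N KM)
        (T1 : cvtrace MN_K) (T1' : cvtrace M_NK)
        (T2 : cvtrace KM_N) (T2' : cvtrace K_MN)
        (T3 : cvtrace NK_M) (T3' : cvtrace N_KM)
        (a1 : associator M_NK MN_K) (t1 : trmap a1 T1' T1)
        (a2 : associator K_MN KM_N) (t2 : trmap a2 T2' T2)
        (a3 : associator N_KM NK_M) (t3 : trmap a3 T3' T3)
        (phi1 : cyc T1 T2') (phi2 : cyc T2 T3') (phi3 : cyc T1' T3),
        exists! w : t3 ∘F phi2 ∘F t2 ∘F phi1 ∘F t1 ≅ phi3,
          forall (m : M) (n : N) (x : K),
            cyc_th phi3 m (so (rt_B NK) ⟨n, x⟩) ∘
              nti w (univ2 T1' ⟨m, so (rt_B NK) ⟨n, x⟩⟩) =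
            as_th t3 n x m ∘
              fmap t3 (cyc_th phi2 (so (rt_B KM) ⟨x, m⟩) n ∘
                fmap phi2 (as_th t2 x m n ∘
                  fmap t2 (cyc_th phi1 (so (rt_B MN) ⟨m, n⟩) x ∘
                    fmap phi1 (as_th t1 m n x))))))
  /\
  (forall M : bimod C C,
     (forall A : lincat k,
        [/\ is_equiv (phi1 M A), is_equiv (phi2 M A)
          & exists w : phi2 M A ∘F switch (regbim C) M A ∘F phi1 M A ≅ fid (Bal1 M A),
              forall (F : Bal1 M A) (m : M),
                nt (b1n (nti w F)) m = fmap (so F) (fwd (lunit m))])
     /\
     (forall (CM : reltensor (regbim C) M) (MC : reltensor M (regbim C))
        (T : cvtrace M) (T1 : cvtrace CM) (T2 : cvtrace MC)
        (l : lunitor CM) (u1 : trmap l T1 T) (r : runitor MC) (u2 : trmap r T2 T)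
        (phi : cyc T1 T2),
        exists! w : u2 ∘F phi ≅ u1, forall m : M,
          fmap (so (tr_B T)) (fwd (lunit m) ∘ fwd (lu_iso l (tone C) m)) ∘
            tm_th u1 (so (rt_B CM) ⟨tone C, m⟩) ∘ nti w (univ2 T1 ⟨tone C, m⟩) =
          fmap (so (tr_B T)) (fwd (runit m) ∘ fwd (ru_iso r m (tone C))) ∘
            tm_th u2 (so (rt_B MC) ⟨m, tone C⟩) ∘ fmap u2 (cyc_th phi (tone C) m))).
Proof.
split; [|split; [|split]].
- by move=> M N A; split; [exact: switch_equiv | exact: switchK].
- move=> M N MN T NM S; split.
  + exact: cyc_exists.
  + by move=> phi; exact: cyc_equiv.
  + by move=> phi phi'; exact: cyc_unique.
  + by move=> phi psi; exact: cyc_inverse.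
- move=> M N K; split.
    by move=> A; split; [exact: switch21_equiv | exact: switch12_equiv
      | exact: switch21_switch21].
  by move=> MN NK KM MN_K M_NK KM_N K_MN NK_M N_KM T1 T1' T2 T2' T3 T3'
    a1 t1 a2 t2 a3 t3 phi1 phi2 phi3; exact: cyc_mult.
- move=> M; split.
    by move=> A; split; [exact: phi1_equiv | exact: phi2_equiv | exact: phi_retraction].
  by move=> CM MC T T1 T2 l u1 r u2 phi; exact: cyc_unit.
Qed.
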